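(* There exist a real $\epsilon>0$ and a term $F(x,y)$ of the language $\mathcal M$ such that the following holds. If $G=\langle G_d(y)\mid d\in\omega\rangle$ is a sequence of terms of $\mathcal M$ such that $G$ decides whether there exists a solution for $F$, then for infinitely many $d\in\omega$ the depth of $G_d$ is at least $\epsilon(\log d)^{1/2}=\epsilon(\log\log n)^{1/2}$, where $n=2^d$.
   Context: $\omega=\{0,1,2,\dots\}$. $\mathcal M$ is the first-order language with equality (and no other relation symbols) with constant symbols $\mathbf 0,\mathbf 1,-\mathbf 1,\mathbf n$, unary function symbols $\mathcal N,\mathbf p$, and binary function symbols $+,\times,\div,\max,\min,\cap$. For $d\in\omega$ and $n=2^d$, $\mathbf M_d$ is the interpretation of $\mathcal M$ with universe $\{0,1,\dots,2^n-1\}$ in which: $+$ and $\times$ are addition and multiplication modulo $2^n$; $\mathbf p(x)=\min\{2^x,2^n-1\}$; $\div(x,y)=\lfloor x/y\rfloor$ if $y\neq0$ and $\div(x,0)=0$; $\mathbf 0,\mathbf 1,\mathbf n,-\mathbf 1$ denote $0,1,n,2^n-1$; $\max,\min$ are the usual ones; $x\cap y$ is the componentwise minimum (AND) of the $n$-bit binary representations; $\mathcal N(x)$ flips each of the $n$ binary bits of $x$. The depth of a term is the maximal number of nestings of function symbols in it. A sequence $G=\langle G_d(y)\mid d\in\omega\rangle$ of terms decides whether there exists a solution for the term $F(x,y)$ if for all sufficiently large $d$, $\mathbf M_d\models\forall y\,[G_d(y)=\mathbf 0\leftrightarrow\exists x\,F(x,y)=\mathbf 0]$. Logarithms are base 2.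 *)

(* Defs.v *)
From HB Require Import structures.
From mathcomp Require Import all_boot all_order all_algebra.
From mathcomp Require Import all_reals exp.
Set Implicit Arguments.
Unset Strict Implicit.
Unset Printing Implicit Defensive.

Variant const_symbol := Zero | One | MinusOne | En.
Variant unary_symbol := Neg | Pow.
Variant binary_symbol := Add | Mul | Div | Max | Min | Cap.

(* [term k] : terms all of whose variables are among the k variables
   [Var 0], ..., [Var (k - 1)]. *)
Inductive term (k : nat) : Type :=
| Var of 'I_k
| Const of const_symbol
| Unary of unary_symbol & term k
| Binary of binary_symbol & term k & term k.

(* Constant symbols are not function symbols: they have depth 0. *)
Fixpoint depth (k : nat) (t : term k) : nat :=
  match t with
  | Var _ | Const _ => 0
  | Unary _ u => (depth u).+1
  | Binary _ u v => (maxn (depth u) (depth v)).+1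
  end.

Definition bit (x i : nat) : bool := odd (x %/ 2 ^ i).

Definition of_bits (n : nat) (b : nat -> bool) : nat :=
  \sum_(i < n) b i * 2 ^ i.

Lemma of_bits_lt (n : nat) (b : nat -> bool) : of_bits n b < 2 ^ n.
Proof.
elim: n => [|n IHn]; first by rewrite /of_bits big_ord0.
rewrite /of_bits big_ord_recr /= expnS mul2n -addnn -addSn leq_add //.
by case: (b n); rewrite ?mul1n.
Qed.

Section Structure.
Variable d : nat.

Definition width : nat := 2 ^ d.
Definition universe : Type := 'I_(2 ^ width).

Lemma universe_gt0 : 0 < 2 ^ width. Proof. by rewrite expn_gt0. Qed.

Lemma one_lt_universe : 1 < 2 ^ width.
Proof. by rewrite -(expn0 2) ltn_exp2l // expn_gt0. Qed.

Lemma pred_lt_universe : 2 ^ width - 1 < 2 ^ width.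
Proof. by rewrite subn1 prednK // universe_gt0. Qed.

Lemma width_lt_universe : width < 2 ^ width. Proof. exact: ltn_expl. Qed.

Lemma pow_lt_universe (x : nat) : minn (2 ^ x) (2 ^ width - 1) < 2 ^ width.
Proof. exact: leq_ltn_trans (geq_minr _ _) pred_lt_universe. Qed.

Lemma div_lt_universe (x : universe) (y : nat) : x %/ y < 2 ^ width.
Proof. exact: leq_ltn_trans (leq_div _ _) (ltn_ord x). Qed.

Lemma max_lt_universe (x y : universe) : maxn x y < 2 ^ width.
Proof. by rewrite gtn_max !ltn_ord. Qed.

Lemma min_lt_universe (x y : universe) : minn x y < 2 ^ width.
Proof. exact: leq_ltn_trans (geq_minl _ _) (ltn_ord x). Qed.

Definition const_interp (c : const_symbol) : universe :=
  match c with
  | Zero => Ordinal universe_gt0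
  | One => Ordinal one_lt_universe
  | MinusOne => Ordinal pred_lt_universe
  | En => Ordinal width_lt_universe
  end.

Definition unary_interp (f : unary_symbol) (x : universe) : universe :=
  match f with
  | Neg => Ordinal (of_bits_lt width (fun i => ~~ bit x i))
  | Pow => Ordinal (pow_lt_universe x)
  end.

(* [Div] relies on the convention [x %/ 0 = 0] of [divn]. *)
Definition binary_interp (f : binary_symbol) (x y : universe) : universe :=
  match f with
  | Add => Ordinal (ltn_pmod (x + y) universe_gt0)
  | Mul => Ordinal (ltn_pmod (x * y) universe_gt0)
  | Div => Ordinal (div_lt_universe x y)
  | Max => Ordinal (max_lt_universe x y)
  | Min => Ordinal (min_lt_universe x y)
  | Cap => Ordinal (of_bits_lt width (fun i => bit x i && bit y i))
  end.

Fixpoint eval (k : nat) (rho : k.-tuple universe) (t : term k) : universe :=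
  match t with
  | Var i => tnth rho i
  | Const c => const_interp c
  | Unary f u => unary_interp f (eval rho u)
  | Binary f u v => binary_interp f (eval rho u) (eval rho v)
  end.

End Structure.

(* In [F : term 2], variable 0 is x and variable 1 is y. *)
Definition decides_solvability (G : nat -> term 1) (F : term 2) : Prop :=
  exists d0 : nat, forall d : nat, d0 <= d ->
    forall y : universe d,
      eval [tuple y] (G d) = const_interp d Zero <->
      exists x : universe d, eval [tuple x; y] F = const_interp d Zero.

Definition log2 (R : realType) (x : R) : R := (ln x / ln 2)%R.

(* Main.v *)
Require Import Defs.
From HB Require Import structures.
From mathcomp Require Import all_boot all_order all_algebra.
From mathcomp Require Import all_reals exp.
From mathcomp Require Import zify.
From mathcomp Require boolp.
Set Implicit Arguments.
Unset Strict Implicit.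
Unset Printing Implicit Defensive.

(** Suppose that from some point on [G D] has depth at most [log2 D], for [F] a universal term saying
    that [x] packs a solution of a system of equations [v_a v_b + (v_c AND v_d) = v_e] described by [y].
    Terms of small depth compile to such systems, so [G] eliminates an existential quantifier over
    the small structure [M_d] (a predicate given by a shallow term over a structure [M_D] stays
    such a predicate, over a slightly larger [M_D'], with the bits of the system as advice).  Iterating,
    every formula with few quantifiers over [M_d] becomes a shallow term over [M_D*], with [D*]
    only slightly larger than [d].  On the other hand such formulas are strong: guessing words with
    many short fields gives iteration of definable functions (Savitch), hence the bits of sums,
    and, by Chinese remaindering, of products and quotients of the numbers of [M_D*], which are
    themselves too long to be quantified over.  So the value of a shallow term over [M_D*] is definable over
    [M_d], and diagonalizing against the terms over [M_D*] gives a contradiction. *)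

(** The obstacle is a circularity: the number of quantifiers to eliminate grows with the depth of
    the terms over the large structure, and the size of that structure grows with the number of
    eliminations. Two facts break it. Eliminating a quantifier does not add to the depth: the new
    term is [G] at the next level applied to a fixed packing term, so the old terms enter only
    through the advice that describes the system, and their depth affects only its number of rows
    [n]; the level rises by [3 log2 n + 12]. And the formulas for one round of evaluation and for
    the diagonal predicate are fixed, independent of [d]. With depth [O(log d)] there are [O(log d)]
    eliminations, each raising the level by [O(log d)], a total of [O((log d)^2)]. What the other
    half of the proof asks is only that this total stay below a fixed fraction of [d]: then the bits
    of a number of the large structure are few enough to be indexed by elements of [M_d] and scanned
    with boundedly many levels of guessing. Quantifiers range over [M_d] at every level. *)

(** * Binary digits, positional numerals and bitwise conjunction *)

Lemma bit0E x : bit x 0 = odd x.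
Proof. by rewrite /bit expn0 divn1. Qed.

Lemma bit_div x i j : bit (x %/ 2 ^ i) j = bit x (i + j).
Proof. by rewrite /bit -divnMA expnD. Qed.

Lemma bitS x i : bit x i.+1 = bit x./2 i.
Proof. by rewrite -divn2 -{1}[2]expn1 bit_div. Qed.

Lemma bit_small x i : x < 2 ^ i -> bit x i = false.
Proof. by move=> h; rewrite /bit divn_small. Qed.

Lemma bit_out x n i : x < 2 ^ n -> n <= i -> bit x i = false.
Proof. by move=> h le; apply/bit_small/(leq_trans h); rewrite leq_exp2l. Qed.

Lemma bit_mod x n i : bit (x %% 2 ^ n) i = (i < n) && bit x i.
Proof.
case: (ltnP i n) => [lt|le] /=; last first.
  by apply: (@bit_out _ n) => //; rewrite ltn_mod expn_gt0.
rewrite /bit [in RHS](divn_eq x (2 ^ n)).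
have -> : 2 ^ n = 2 ^ (n - i).-1 * 2 * 2 ^ i.
  by rewrite -expnSr -expnD; congr (2 ^ _); lia.
rewrite mulnA divnMDl ?expn_gt0 // oddD !oddM /= !andbF /=.
by [].
Qed.

Lemma bit_ext x y : (forall i, bit x i = bit y i) -> x = y.
Proof.
elim/ltn_ind: x y => x IH y h.
have e0 := h 0; rewrite !bit0E in e0.
have [x0|x0] := posnP x; last first.
  rewrite -(odd_double_half x) -(odd_double_half y) e0; congr (_ + _.*2).
  by apply: IH => [|i]; [rewrite -divn2 ltn_Pdiv|rewrite -!bitS].
rewrite {x IH}x0 in h e0 *; case: y h {e0} => // y h.
have b : bit y.+1 (trunc_log 2 y.+1) = true.
  rewrite /bit; set e := trunc_log _ _.
  have := trunc_log_bounds (isT : 1 < 2) (isT : 0 < y.+1); rewrite -/e => /andP[h1 h2].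
  have -> // : y.+1 %/ 2 ^ e = 1.
  apply/eqP; rewrite eqn_leq -ltnS ltn_divLR ?expn_gt0 // -expnS h2 /=.
  by rewrite divn_gt0 ?expn_gt0.
by move: b; rewrite -h /bit div0n.
Qed.

(** All packed words of the development are values of [num] for suitable bases: the fields of [y],
    the states guessed for a loop, the tags of a coded term. *)
Definition num (b n : nat) (f : nat -> nat) := \sum_(k < n) f k * b ^ k.

Lemma num0 b f : num b 0 f = 0. Proof. by rewrite /num big_ord0. Qed.

Lemma numSr b n f : num b n.+1 f = num b n f + f n * b ^ n.
Proof. by rewrite /num big_ord_recr. Qed.

Lemma numSl b n f : num b n.+1 f = f 0 + num b n (fun k => f k.+1) * b.
Proof.
rewrite /num big_ord_recl expn0 muln1; congr (_ + _); rewrite big_distrl /=.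
by apply: eq_bigr => i _; rewrite expnSr mulnA.
Qed.

Lemma eq_num b n f g : (forall k, k < n -> f k = g k) -> num b n f = num b n g.
Proof. by move=> h; apply: eq_bigr => i _; rewrite h. Qed.

Lemma num_lt b n f : (forall k, k < n -> f k < b) -> num b n f < b ^ n.
Proof.
elim: n => [|n IH] h; first by rewrite num0.
rewrite numSr expnS; have h1 := IH (fun k lt => h k (ltnW lt)).
have h2 := h n (leqnn _); apply: (@leq_trans (b ^ n + f n * b ^ n)).
  by rewrite ltn_add2r.
by rewrite -mulSn leq_mul2r h2 orbT.
Qed.

Lemma num_div b n f k : 0 < b -> (forall k, k < n -> f k < b) -> k <= n ->
  num b n f %/ b ^ k = num b (n - k) (fun i => f (k + i)).
Proof.
move=> b0; elim: k n f => [|k IH] n f h le.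
  by rewrite divn1 subn0; apply: eq_num.
case: n h le => // n h le.
rewrite numSl expnS divnMA addnC divnMDl // (divn_small (h 0 isT)) addn0 IH //.
by move=> i lt; apply: h.
Qed.

Lemma num_dig b n f k : (forall k, k < n -> f k < b) -> k < n ->
  (num b n f %/ b ^ k) %% b = f k.
Proof.
move=> h lt; have b0 : 0 < b by apply: leq_ltn_trans (h _ lt).
rewrite num_div // 1?ltnW //.
have -> : n - k = (n - k).-1.+1 by lia.
by rewrite numSl addnC modnMDl addn0 modn_small // h.
Qed.

Lemma num_digs b n x : x < b ^ n -> num b n (fun k => (x %/ b ^ k) %% b) = x.
Proof.
elim: n x => [|n IH] x; first by rewrite expn0 num0; case: x.
move=> h; rewrite numSl expn0 divn1.
have b0 : 0 < b by rewrite lt0n; apply/eqP => e; rewrite e exp0n in h.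
rewrite [RHS](divn_eq x b) addnC; congr (_ * _ + _).
rewrite -[RHS]IH; last by rewrite ltn_divLR // -expnSr.
by apply: eq_num => k _; rewrite expnS divnMA.
Qed.

Lemma num_inj b n f g : (forall k, k < n -> f k < b) -> (forall k, k < n -> g k < b) ->
  num b n f = num b n g -> forall k, k < n -> f k = g k.
Proof. by move=> hf hg e k lt; rewrite -(num_dig hf lt) e (num_dig hg lt). Qed.

Lemma numD b n f g : num b n f + num b n g = num b n (fun k => f k + g k).
Proof. by rewrite /num -big_split; apply: eq_bigr => i _; rewrite mulnDl. Qed.

Lemma numM b n c f : c * num b n f = num b n (fun k => c * f k).
Proof. by rewrite /num big_distrr; apply: eq_bigr => i _ /=; rewrite mulnA. Qed.

Lemma num_block b m n f :
  num b (m * n) f = num (b ^ m) n (fun k => num b m (fun i => f (m * k + i))).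
Proof.
elim: n => [|n IH]; first by rewrite muln0 !num0.
rewrite numSr -IH mulnSr -expnM {IH}; move: (m * n) => p.
elim: m => [|m IH]; first by rewrite addn0 num0 addn0.
by rewrite addnS !numSr IH mulnDl addnA; congr (_ + _); rewrite expnD; lia.
Qed.

Lemma geoE b n : num b n (fun=> 1) * b.-1 = b ^ n - 1.
Proof.
case: b => [|b]; first by rewrite muln0; case: n => // n; rewrite exp0n.
elim: n => [|n IH]; first by rewrite num0.
rewrite numSr mulnDl IH mul1n /= expnS mulSn.
by have := expn_gt0 b.+1 n; lia.
Qed.

Lemma geo_div b n : 1 < b -> (b ^ n - 1) %/ (b - 1) = num b n (fun=> 1).
Proof. by move=> h; rewrite -geoE subn1 mulnK //; lia. Qed.

Lemma bit_num a n f k i : i < a -> (forall k, k < n -> f k < 2 ^ a) ->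
  bit (num (2 ^ a) n f) (k * a + i) = (k < n) && bit (f k) i.
Proof.
move=> lt h; case: (ltnP k n) => [lk|le] /=; last first.
  apply: (@bit_out _ (n * a)); last by rewrite (leq_trans _ (leq_addr _ _)) // leq_mul2r le orbT.
  by rewrite mulnC expnM num_lt.
by rewrite -bit_div mulnC expnM -[in RHS](num_dig h lk) bit_mod lt.
Qed.

Lemma bit_of_bits n b i : bit (of_bits n b) i = (i < n) && b i.
Proof.
have -> : of_bits n b = num (2 ^ 1) n b by rewrite expn1.
have := @bit_num 1 n b i 0 isT (fun k _ => _); rewrite muln1 addn0 => -> //.
  by rewrite bit0E oddb.
by move=> k; case: (b k).
Qed.

(** Cutting at [x] bits loses nothing, because [x < 2^x]. *)
Definition land x y := of_bits x (fun i => bit x i && bit y i).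

Lemma bit_land x y i : bit (land x y) i = bit x i && bit y i.
Proof.
rewrite bit_of_bits; case: ltnP => //= le; apply/esym.
by rewrite (@bit_out x x) // ltn_expl.
Qed.

Lemma land_of_bits n x y : x < 2 ^ n ->
  of_bits n (fun i => bit x i && bit y i) = land x y.
Proof.
move=> h; apply: bit_ext => i; rewrite bit_land bit_of_bits.
by case: ltnP => //= le; rewrite (bit_out h).
Qed.

Lemma land_le x y : land x y <= x.
Proof.
elim/ltn_ind: x y => x IH y; have [->|x0] := posnP x.
  by rewrite /land /of_bits big_ord0.
rewrite -(odd_double_half (land x y)) -{3}(odd_double_half x).
apply: leq_add; first by rewrite -!bit0E bit_land; case: (bit x 0); case: (bit y 0).
rewrite leq_double; have -> : (land x y)./2 = land x./2 y./2.
  by apply: bit_ext => i; rewrite -bitS !bit_land !bitS.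
by apply: IH; rewrite -divn2 ltn_Pdiv.
Qed.

Lemma landC x y : land x y = land y x.
Proof. by apply: bit_ext => i; rewrite !bit_land andbC. Qed.

Lemma landxx x : land x x = x.
Proof. by apply: bit_ext => i; rewrite bit_land andbb. Qed.

Lemma bit_mask n i : bit (2 ^ n - 1) i = (i < n).
Proof.
have e : of_bits n (fun=> true) = 2 ^ n - 1.
  rewrite -[RHS]geoE muln1; apply: eq_bigr => j _; by rewrite mul1n.
by rewrite -e bit_of_bits andbT.
Qed.

Lemma land_mask x n : land x (2 ^ n - 1) = x %% 2 ^ n.
Proof. by apply: bit_ext => i; rewrite bit_land bit_mod bit_mask andbC. Qed.

Lemma bit_mulX x n i : bit (x * 2 ^ n) i = (n <= i) && bit x (i - n).
Proof.
case: leqP => [le|lt] /=; last first.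
  rewrite /bit; have -> : 2 ^ n = 2 ^ (n - i).-1 * 2 * 2 ^ i.
    by rewrite -expnSr -expnD; congr (2 ^ _); lia.
  by rewrite mulnA mulnK ?expn_gt0 // !oddM /= !andbF.
by rewrite -{1}(subnKC le) -bit_div mulnK // expn_gt0.
Qed.

Lemma land_mulX x y n : land (x * 2 ^ n) (y * 2 ^ n) = land x y * 2 ^ n.
Proof. by apply: bit_ext => i; rewrite bit_land !bit_mulX bit_land; case: leqP. Qed.

Lemma land_field x a o :
  land x ((2 ^ a - 1) * 2 ^ o) = (x %/ 2 ^ o) %% 2 ^ a * 2 ^ o.
Proof.
apply: bit_ext => i; rewrite bit_land !bit_mulX bit_mask bit_mod bit_div.
by case: (leqP o i) => [le|]; rewrite ?andbF //= subnKC // andbC.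
Qed.

Lemma land_num a n f g : 0 < a -> (forall k, k < n -> f k < 2 ^ a) ->
  (forall k, k < n -> g k < 2 ^ a) ->
  land (num (2 ^ a) n f) (num (2 ^ a) n g) = num (2 ^ a) n (fun k => land (f k) (g k)).
Proof.
move=> a0 hf hg; apply: bit_ext => i; rewrite (divn_eq i a) bit_land.
rewrite !bit_num ?ltn_mod //; first by case: ltnP => //=; rewrite bit_land.
by move=> k lt; apply: leq_ltn_trans (land_le _ _) (hf _ lt).
Qed.

(** * Terms with variables indexed by [nat], evaluated in [nat] *)

Inductive tm :=
| V of nat
| C of const_symbol
| U1 of unary_symbol & tm
| B2 of binary_symbol & tm & tm.

Fixpoint tdepth t := match t with
  | V _ | C _ => 0
  | U1 _ u => (tdepth u).+1
  | B2 _ u v => (maxn (tdepth u) (tdepth v)).+1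
  end.

Definition cst D c := match c with
  | Zero => 0 | One => 1 | MinusOne => 2 ^ 2 ^ D - 1 | En => 2 ^ D end.

Definition uop D f x := match f with
  | Neg => 2 ^ 2 ^ D - 1 - x
  | Pow => minn (2 ^ x) (2 ^ 2 ^ D - 1) end.

Definition bop D f x y := match f with
  | Add => (x + y) %% 2 ^ 2 ^ D
  | Mul => (x * y) %% 2 ^ 2 ^ D
  | Div => x %/ y
  | Max => maxn x y
  | Min => minn x y
  | Cap => land x y end.

Fixpoint ev D (env : seq nat) t := match t with
  | V i => nth 0 env i
  | C c => cst D c
  | U1 f u => uop D f (ev D env u)
  | B2 f u v => bop D f (ev D env u) (ev D env v)
  end.

Lemma cst_lt D c : cst D c < 2 ^ 2 ^ D.
Proof.
have h := expn_gt0 2 (2 ^ D); case: c => //=; first exact: one_lt_universe.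
  by lia.
exact: ltn_expl.
Qed.

Lemma uop_lt D f x : uop D f x < 2 ^ 2 ^ D.
Proof.
have h := expn_gt0 2 (2 ^ D); case: f => /=; first by lia.
by apply: leq_ltn_trans (geq_minr _ _) _; lia.
Qed.

Lemma bop_lt D f x y : x < 2 ^ 2 ^ D -> y < 2 ^ 2 ^ D -> bop D f x y < 2 ^ 2 ^ D.
Proof.
move=> hx hy; case: f => /=; rewrite ?ltn_mod ?expn_gt0 //.
- exact: leq_ltn_trans (leq_div _ _) hx.
- by rewrite gtn_max hx.
- by rewrite gtn_min hx.
- exact: leq_ltn_trans (land_le _ _) hx.
Qed.

Definition bounded b (s : seq nat) := all (fun x => x < b) s.

Lemma bounded_nth b s i : 0 < b -> bounded b s -> nth 0 s i < b.
Proof.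
move=> b0 h; case: (ltnP i (size s)) => lt; first by apply: (allP h); apply: mem_nth.
by rewrite nth_default.
Qed.

Lemma ev_lt D env t : bounded (2 ^ 2 ^ D) env -> ev D env t < 2 ^ 2 ^ D.
Proof.
move=> h; elim: t => [i|c|f u _|f u hu v hv] /=.
- by apply: bounded_nth h; rewrite expn_gt0.
- exact: cst_lt.
- exact: uop_lt.
- exact: bop_lt.
Qed.

Lemma neg_of_bits n x : x < 2 ^ n -> of_bits n (fun i => ~~ bit x i) = 2 ^ n - 1 - x.
Proof.
move=> h; have e : of_bits n (fun i => ~~ bit x i) + x = 2 ^ n - 1.
  have -> : x = of_bits n (bit x).
    by apply: bit_ext => i; rewrite bit_of_bits; case: ltnP => //= /(bit_out h).
  rewrite -[RHS]geoE muln1 /of_bits -big_split /=; apply: eq_bigr => i _.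
  by rewrite -mulnDl -/(of_bits n (bit x)) bit_of_bits ltn_ord /=; case: (bit _ _).
by rewrite -e addnK.
Qed.

Fixpoint tm_of k (t : term k) : tm := match t with
  | Var i => V i | Const c => C c
  | Unary f u => U1 f (tm_of u)
  | Binary f u v => B2 f (tm_of u) (tm_of v) end.

Lemma tdepth_tm_of k (t : term k) : tdepth (tm_of t) = depth t.
Proof. by elim: t => //= [f u ->|f u -> v ->]. Qed.

Lemma val_unary D f (x : universe D) : val (unary_interp f x) = uop D f x.
Proof. by case: f => //=; apply: neg_of_bits; exact: ltn_ord. Qed.

Lemma val_binary D f (x y : universe D) : val (binary_interp f x y) = bop D f x y.
Proof. by case: f => //=; apply: land_of_bits; exact: ltn_ord. Qed.

Lemma ev_tm_of D k (rho : k.-tuple (universe D)) (t : term k) :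
  val (eval rho t) = ev D [seq val i | i <- rho] (tm_of t).
Proof.
elim: t => [i|c|f u IH|f u IHu v IHv] /=.
- by rewrite (tnth_nth (const_interp D Zero)) (nth_map (const_interp D Zero)) ?size_tuple.
- by case: c.
- by rewrite val_unary IH.
- by rewrite val_binary IHu IHv.
Qed.

Fixpoint term_of k (t : tm) : term k.+1 := match t with
  | V i => Var (inord i) | C c => Const _ c
  | U1 f u => Unary f (term_of k u)
  | B2 f u v => Binary f (term_of k u) (term_of k v) end.

Fixpoint vars_lt k t := match t with
  | V i => i < k | C _ => true
  | U1 _ u => vars_lt k u
  | B2 _ u v => vars_lt k u && vars_lt k v end.

Lemma tm_of_term_of k t : vars_lt k.+1 t -> tm_of (term_of k t) = t.
Proof.
elim: t => //= [i lt|f u IH /IH->|f u IHu v IHv /andP[/IHu-> /IHv->]] //.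
by rewrite inordK.
Qed.

Fixpoint tsub (s : nat -> tm) t := match t with
  | V i => s i | C c => C c
  | U1 f u => U1 f (tsub s u)
  | B2 f u v => B2 f (tsub s u) (tsub s v) end.

Lemma ev_tsub D env env' s t : (forall i, ev D env (s i) = nth 0 env' i) ->
  ev D env (tsub s t) = ev D env' t.
Proof. by move=> h; elim: t => //= [f u ->|f u -> v ->]. Qed.

Lemma tdepth_tsub s t m : (forall i, tdepth (s i) <= m) -> tdepth (tsub s t) <= tdepth t + m.
Proof.
move=> h; elim: t => [i|c|f u IH|f u IHu v IHv] //=.
by rewrite addSn ltnS geq_max (leq_trans IHu) ?leq_add2r ?leq_maxl //
  (leq_trans IHv) // leq_add2r leq_maxr.
Qed.

Notation "a +t b" := (B2 Add a b) (at level 50, left associativity).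
Notation "a *t b" := (B2 Mul a b) (at level 40, left associativity).
Notation "a /t b" := (B2 Div a b) (at level 40, left associativity).
Notation "a &t b" := (B2 Cap a b) (at level 40, left associativity).
(** Two's complement: the complement of [b] plus 1 is [-b] modulo [2^(2^D)]. *)
Definition tsubt a b := a +t (U1 Neg b +t C One).
Notation "a -t b" := (tsubt a b) (at level 50, left associativity).
Definition tmod a b := a -t ((a /t b) *t b).
Notation "a %t b" := (tmod a b) (at level 40, left associativity).
Fixpoint tnat n := if n is m.+1 then tnat m +t C One else C Zero.
(** The distance of the two values; it turns an equation into the vanishing of a term, which is the
    form of every atom. *)
Definition tdiff a b := B2 Max a b -t B2 Min a b.

Section Eval.
Variables (D : nat) (env : seq nat).
Hypothesis henv : bounded (2 ^ 2 ^ D) env.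
Let Q := 2 ^ 2 ^ D.
Let Q0 : 0 < Q. Proof. by rewrite expn_gt0. Qed.

Lemma ev_tsubt a b : ev D env b <= ev D env a ->
  ev D env (a -t b) = ev D env a - ev D env b.
Proof.
move=> le; rewrite /tsubt /= -/Q.
have := ev_lt a henv; have := ev_lt b henv; rewrite -/Q.
move: (ev D env a) (ev D env b) le => x y le hy hx.
rewrite modnDmr; have -> : x + (Q - 1 - y + 1) = x - y + Q by lia.
by rewrite modnDr modn_small //; lia.
Qed.

Lemma ev_tmod a b : ev D env (a %t b) = ev D env a %% ev D env b.
Proof.
have h : ev D env (a /t b *t b) = ev D env a %/ ev D env b * ev D env b.
  rewrite /= modn_small //; apply: leq_ltn_trans (leq_divM _ _) _; exact: ev_lt.
rewrite /tmod ev_tsubt h ?leq_divM //.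
by rewrite {1}(divn_eq (ev D env a) (ev D env b)) addKn.
Qed.

Lemma ev_tnat n : n < Q -> ev D env (tnat n) = n.
Proof. by elim: n => //= n IH h; rewrite IH ?(ltnW h) // addn1 modn_small. Qed.

Lemma ev_tdiff a b : (ev D env (tdiff a b) == 0) = (ev D env a == ev D env b).
Proof.
rewrite /tdiff ev_tsubt /=; last by rewrite geq_min leq_max leqnn.
by lia.
Qed.

End Eval.

(** * A universal term for systems of quadratic and bitwise equations *)

(** The word [y] is divided into 64 fields of [2^D / 64] bits. Field 0 holds [n], the number of rows
    and of guessed digits; fields 1 to 5 hold codes of the five columns of row indices. All 64
    fields also serve as the first 64 variables of the system. *)
Definition yfield j :=
  (V 1 /t U1 Pow (tnat j *t (C En /t tnat 64))) %t U1 Pow (C En /t tnat 64).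
Definition tV := yfield 0.
Definition tV2 := tV *t tV.
Definition tV3 := tV2 *t tV.
(** The width of one digit. With [B = 2^be] the universe has room for [L = 64 n^3] digits in base
    [B]; the words for the products occupy about [16 n^3] of them. *)
Definition tbe := C En /t (tnat 64 *t tV3).
Definition tpB m := U1 Pow (tbe *t m).
Definition tgeo th := (tpB (th *t tV) -t C One) /t (tpB th -t C One).
Definition tgeo1 m := (tpB m -t C One) /t (tpB (C One) -t C One).
(** Copies of [c] at distance [be - 1] are sampled at the positions [k be = k (be - 1) + k], where
    bit [k] of copy [k] lies. So every bit of [c] becomes a digit in base [B], and a short code
    stored in [y] unfolds into a long word. *)
Definition tspread c th :=
  (c *t ((U1 Pow ((tbe -t C One) *t (th *t tV)) -t C One)
         /t (U1 Pow (tbe -t C One) -t C One))) &t tgeo1 (th *t tV).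
Fixpoint tsumfields k :=
  if k is m.+1 then tsumfields m +t yfield m *t tpB (tnat m) else C Zero.
(** The digits of this word are the variables of the system: the 64 fields of [y], followed by the
    digits guessed in [x]. *)
Definition tX := V 0 *t tpB (tnat 64) +t tsumfields 64.
Definition tmask th o := tgeo th *t ((tpB (C One) -t C One) *t tpB o).
(** In block [k] the word [tX] is multiplied by [B^(o - r k)], which moves its digit [r k] to
    position [o], where the mask keeps it. One multiplication serves all rows. *)
Definition tsel c th o := (tX *t tspread c th) &t tmask th o.
(** The factors of the products are laid out in blocks of [8 n] and of [16 n^2] digits. Up to a
    common offset, the product of the factors of rows [k] and [l] then stands at [8 n k + 16 n^2 l],
    a different place for each pair, and the wanted diagonal [k = l] is again equally spaced, by
    [16 n^2 + 8 n]. *)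
Definition tha := tnat 8 *t tV.
Definition thb := tnat 16 *t tV2.
Definition thk := thb +t tha.
Definition to2 := tnat 2 *t tV.
(** A mask for the lowest [be / 4] bits of each of [n] digits: values in this range cannot overflow
    a digit in [v_a v_b + (v_c AND v_d)]. *)
Definition trange := tgeo1 tV *t (U1 Pow (tbe /t tnat 4) -t C One).
Definition tcheck :=
  tdiff (((tsel (yfield 1) tha tV *t tsel (yfield 2) thb tV) &t tmask thk to2)
         +t (tsel (yfield 3) thk to2 &t tsel (yfield 4) thk to2))
        (tsel (yfield 5) thk to2).
Definition Funiv := B2 Max tcheck (tdiff (V 0 &t trange) (V 0)).

Definition code n th o (r : nat -> nat) := num (2 ^ th) n (fun k => 2 ^ (o - r k)).

Lemma code_lt n m o r : o < m -> code n m o r < 2 ^ (m * n).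
Proof. by move=> lt; rewrite expnM; apply: num_lt => k _; rewrite ltn_exp2l //; lia. Qed.

Lemma digit_mod b x i j : i < j -> 0 < b -> (x %% b ^ j %/ b ^ i) %% b = (x %/ b ^ i) %% b.
Proof.
move=> lt b0; rewrite [in RHS](divn_eq x (b ^ j)).
have -> : b ^ j = b ^ (j - i).-1 * b * b ^ i.
  by rewrite -expnSr -expnD; congr (b ^ _); lia.
by rewrite mulnA divnMDl ?expn_gt0 ?b0 // mulnA modnMDl.
Qed.

Lemma spreadE a c m : c < 2 ^ m -> m < a ->
  land (c * num (2 ^ a.-1) m (fun=> 1)) (num (2 ^ a) m (fun=> 1))
  = num (2 ^ a) m (fun j => bit c j).
Proof.
move=> hc ma; have a0 : 0 < a by lia.
have ha k : k < m -> 1 < 2 ^ a by rewrite -{1}(expn0 2) ltn_exp2l.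
apply: bit_ext => q; rewrite bit_land (divn_eq q a) numM muln1.
rewrite [bit (num _ _ (fun=> 1)) _]bit_num ?ltn_mod //.
rewrite [in RHS]bit_num ?ltn_mod //; last first.
  by move=> k lt; apply: leq_ltn_trans (ha _ lt); case: (bit c k).
set k := q %/ a; set i := q %% a; case: (ltnP k m) => [lk|] /=; last by rewrite andbF.
case: i => [|i] /=; last first.
  have z (b : bool) : bit b i.+1 = false by rewrite bitS; case: b; rewrite /bit /= div0n.
  by rewrite (z true) z andbF.
rewrite addn0 !bit0E oddb andbT.
have -> : k * a = k * a.-1 + k by nia.
rewrite bit_num ?lk //; first lia.
by move=> _ _; apply: (leq_trans hc); rewrite leq_exp2l //; lia.
Qed.

Lemma spread_code n a th o r : 0 < a -> (forall k, k < n -> o < th) ->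
  num (2 ^ a) (th * n) (fun j => bit (code n th o r) j)
  = num ((2 ^ a) ^ th) n (fun k => (2 ^ a) ^ (o - r k)).
Proof.
move=> a0 oth; rewrite num_block; apply: eq_num => k lt.
have h : o - r k < th by have := oth _ lt; lia.
rewrite (@eq_num _ _ _ (fun i => i == o - r k)); last first.
  move=> i li; rewrite mulnC bit_num // ?lt /=; last first.
    by move=> k' lt'; rewrite ltn_exp2l //; have := oth _ lt'; lia.
  rewrite -[2 ^ (o - r k)]mul1n bit_mulX.
  case: (ltngtP i (o - r k)) => [l|l|->]; rewrite ?subnn ?bit0E //=.
  have -> : i - (o - r k) = (i - (o - r k)).-1.+1 by lia.
  by rewrite bitS /bit div0n.
rewrite /num (bigD1 (Ordinal h)) //= eqxx mul1n big1 ?addn0 // => i /negP ne.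
by case: eqP => // e; case: ne; apply/eqP/val_inj.
Qed.

Section Layout.
Variables (be n : nat).
Hypothesis be0 : 0 < be.
Let B := 2 ^ be.
Let B0 : 0 < B. Proof. by rewrite expn_gt0. Qed.
Let Bexp k : B ^ k = 2 ^ (be * k). Proof. by rewrite expnM. Qed.
Let B1 : 1 < B. Proof. by rewrite /B -{1}(expn0 2) ltn_exp2l. Qed.

Lemma land_digit x o : land x ((B - 1) * B ^ o) = (x %/ B ^ o) %% B * B ^ o.
Proof. by rewrite Bexp; exact: land_field. Qed.

(** The condition [q + o <= th] keeps each shifted copy of [X] inside its own block, so the blocks
    do not interact and each can be masked separately. *)
Lemma selE X q th o r : X < B ^ q -> q + o <= th -> 0 < th -> o < th ->
  (forall k, k < n -> r k <= o) ->
  land (X * num (B ^ th) n (fun k => B ^ (o - r k)))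
       (num (B ^ th) n (fun=> 1) * ((B - 1) * B ^ o))
  = num (B ^ th) n (fun k => (X %/ B ^ r k) %% B * B ^ o).
Proof.
move=> hX hq th0 oth hr; rewrite numM [num _ _ _ * _]mulnC numM Bexp.
have bth : 0 < be * th by rewrite muln_gt0 be0.
rewrite land_num //; last 2 first.
- move=> k lt; rewrite -Bexp; apply: (@leq_trans (B ^ q * B ^ o)).
    by apply: (@leq_trans (X.+1 * B ^ (o - r k))); rewrite ?ltn_pmul2r ?expn_gt0 ?B0 // leq_mul // leq_exp2l //; lia.
  by rewrite -expnD leq_exp2l.
- move=> k lt; rewrite muln1 -Bexp; apply: (@leq_trans (B ^ o.+1)); last by rewrite leq_exp2l.
  by rewrite expnS ltn_pmul2r ?expn_gt0 ?B0 //; lia.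
apply: eq_num => k lt; rewrite muln1 land_digit.
congr (_ %% _ * _); have -> : B ^ o = B ^ (o - r k) * B ^ r k by rewrite -expnD subnK // hr.
by rewrite mulnC divnMl // expn_gt0 B0.
Qed.

(** Seen in base [B^w], the product has the digits [A * (g k * B^m)], where [A] is the first factor,
    itself a numeral in base [B^(8 m)]. The bound [hw] keeps such a digit within its block, and the
    mask at [8 m k + 2 m] inside block [k] leaves exactly the term [f k * g k]. *)
Lemma diagE m w f g : (forall k, k < n -> f k * g k < B) -> 0 < m ->
  4 * m <= w -> (8 * m) * n + 2 * m + 2 <= w ->
  (forall k, k < n -> f k < B) -> (forall k, k < n -> g k < B) ->
  (forall k l, k < n -> l < n -> f k * g l < B) ->
  land (num (B ^ (8 * m)) n (fun k => f k * B ^ m) * num (B ^ w) n (fun k => g k * B ^ m))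
       (num (B ^ (w + 8 * m)) n (fun=> 1) * ((B - 1) * B ^ (2 * m)))
  = num (B ^ (w + 8 * m)) n (fun k => f k * g k * B ^ (2 * m)).
Proof.
move=> hfg m0 _ hw hf hg hfl.
set A := num (B ^ (8 * m)) n _.
have scale h : num (B ^ (w + 8 * m)) n h = num (B ^ w) n (fun k => h k * B ^ (8 * m * k)).
  by apply: eq_bigr => i _; rewrite -mulnA -(expnM B w) -(expnM B (w + _)) -expnD; congr (_ * expn B _); lia.
have hA : A < B ^ (8 * m * n).
  rewrite expnM; apply: num_lt => k lt; apply: (@leq_trans (B ^ m.+1)).
    by rewrite expnS ltn_pmul2r ?expn_gt0 ?B0 ?hf.
  by rewrite leq_exp2l //; lia.
rewrite numM [num _ _ (fun=> 1) * _]mulnC numM !scale Bexp.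
have w0 : 0 < w by lia.
rewrite land_num ?muln_gt0 ?be0 //; last 2 first.
- move=> k lt; rewrite -Bexp; apply: (@leq_trans (B ^ (8 * m * n) * B ^ m.+1)).
    apply: ltn_mul => //; by rewrite expnS ltn_pmul2r ?expn_gt0 ?B0 ?hg.
  by rewrite -expnD leq_exp2l //; lia.
- move=> k lt; rewrite -Bexp muln1; apply: (@leq_trans (B * B ^ (2 * m) * B ^ (8 * m * k))).
    by rewrite !ltn_pmul2r ?expn_gt0 ?B0 //; lia.
  rewrite -expnS -expnD leq_exp2l //.
  have : 8 * m * k <= 8 * m * n by rewrite leq_mul2l ltnW ?orbT.
  lia.
apply: eq_num => k lt; rewrite muln1 -[in LHS](mulnA (B - 1)) -expnD land_digit.
rewrite expnD mulnA; congr (_ * _); rewrite [B ^ (2 * m) * _]mulnC divnMA.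
have -> : A * (g k * B ^ m) = num (B ^ (8 * m)) n (fun i => f i * g k * B ^ (2 * m)).
  rewrite mulnC numM; apply: eq_num => i li; have -> : 2 * m = m + m by lia.
  by rewrite expnD; lia.
set z := num _ _ _; rewrite -(@digit_mod _ (z %/ _) _ (8 * m)) //; last by lia.
rewrite expnM num_dig //.
  by rewrite mulnK ?expn_gt0 ?B0 // modn_small // hfg.
move=> i li; apply: (@leq_trans (B ^ (2 * m).+1)); last by rewrite leq_exp2l //; lia.
by rewrite expnS ltn_pmul2r ?expn_gt0 ?B0 // hfl.
Qed.

End Layout.

(** * Correctness of the universal term *)

Section Universal.
Variables (D n be : nat).
Hypothesis n64 : 64 <= n.
Hypothesis hD : 2 ^ D = 64 * (n * n * n) * be.
Hypothesis hbe : 64 * (n * n * n) <= be.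
Let B := 2 ^ be.
Let L := 64 * (n * n * n).
Let W := n * n * n * be.
Variables (yf ra rb rc rd re : nat -> nat).
Hypothesis yf_lt : forall j, j < 64 -> yf j < 2 ^ (be %/ 4).
Hypothesis yf0 : yf 0 = n.
Hypothesis yf1 : yf 1 = code n (8 * n) n ra.
Hypothesis yf2 : yf 2 = code n (16 * (n * n)) n rb.
Hypothesis yf3 : yf 3 = code n (16 * (n * n) + 8 * n) (2 * n) rc.
Hypothesis yf4 : yf 4 = code n (16 * (n * n) + 8 * n) (2 * n) rd.
Hypothesis yf5 : yf 5 = code n (16 * (n * n) + 8 * n) (2 * n) re.
Hypothesis rows_lt : forall k, k < n ->
  [&& ra k <= n, rb k <= n, rc k <= n, rd k <= n & re k <= n].
Let y := num (2 ^ W) 64 yf.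

Let hV1 : 4096 * n <= n * n * 64. Proof. by nia. Qed.
Let hV2 : 4096 * (n * n) <= n * n * n * 64. Proof. by nia. Qed.
Let be0 : 0 < be. Proof. by lia. Qed.
Let B1 : 1 < B. Proof. by rewrite /B -{1}(expn0 2) ltn_exp2l. Qed.
Let B0 : 0 < B. Proof. exact: ltnW. Qed.
Let BL : 2 ^ 2 ^ D = B ^ L. Proof. by rewrite hD mulnC expnM. Qed.
Let BexpE k : B ^ k = 2 ^ (be * k). Proof. by rewrite expnM. Qed.
Let L100 : 100 <= L. Proof. by rewrite /L; nia. Qed.
Let be100 : 100 <= be. Proof. exact: leq_trans L100 hbe. Qed.
Let small v : v <= be -> v < B. Proof. by move=> h; apply: leq_ltn_trans h (ltn_expl _ _). Qed.
Let WL : 64 * W = 2 ^ D. Proof. by rewrite hD; lia. Qed.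
Let yf_ltB j : j < 64 -> yf j < B.
Proof. by move=> lt; apply: (leq_trans (yf_lt lt)); rewrite leq_exp2l // leq_div. Qed.
Let beW : be <= W. Proof. by rewrite /W; nia. Qed.
Let yf_ltW j : j < 64 -> yf j < 2 ^ W.
Proof. by move=> lt; apply: (leq_trans (yf_ltB lt)); rewrite leq_exp2l. Qed.
Let y_lt : y < 2 ^ 2 ^ D. Proof. by rewrite -WL mulnC expnM num_lt. Qed.

Section Fix_x.
Variable x : nat.
Hypothesis hx : x < 2 ^ 2 ^ D.
Let env := [:: x; y].
Let henv : bounded (2 ^ 2 ^ D) env. Proof. by rewrite /bounded /= hx y_lt. Qed.

(** The bound [e] counts digits in base [B]; carrying it along shows that no operation wraps around
    modulo [2^(2^D) = B^L]. *)
Definition evB t v e := [/\ ev D env t = v, v < B ^ e & e <= L].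

Lemma evB_mul t u v w e f : evB t v e -> evB u w f -> e + f <= L -> evB (t *t u) (v * w) (e + f).
Proof.
move=> [h1 h2 _] [h3 h4 _] le; have lt : v * w < B ^ (e + f) by rewrite expnD ltn_mul.
split=> //=; rewrite h1 h3 modn_small // BL; apply: leq_trans lt _.
by rewrite leq_exp2l.
Qed.

Lemma evB_add t u v w e : evB t v e -> evB u w e -> e < L -> evB (t +t u) (v + w) e.+1.
Proof.
move=> [h1 h2 _] [h3 h4 _] le; have lt : v + w < B ^ e.+1.
  by rewrite expnS; apply: (@leq_trans (2 * B ^ e)); [lia|rewrite leq_mul2r B1 orbT].
split=> //=; rewrite h1 h3 modn_small // BL; apply: leq_trans lt _.
by rewrite leq_exp2l.
Qed.

Lemma evB_sub t u v w e f : evB t v e -> evB u w f -> w <= v -> evB (t -t u) (v - w) e.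
Proof.
move=> [h1 h2 h] [h3 h4 _] le; split=> //; last by apply: leq_ltn_trans h2; lia.
by rewrite ev_tsubt // h1 h3.
Qed.

Lemma evB_div t u v w e f : evB t v e -> evB u w f -> evB (t /t u) (v %/ w) e.
Proof.
move=> [h1 h2 h] [h3 h4 _]; split=> //=; first by rewrite h1 h3.
exact: leq_ltn_trans (leq_div _ _) h2.
Qed.

Lemma evB_cap t u v w e f : evB t v e -> evB u w f -> evB (t &t u) (land v w) e.
Proof.
move=> [h1 h2 h] [h3 h4 _]; split=> //=; first by rewrite h1 h3.
exact: leq_ltn_trans (land_le _ _) h2.
Qed.

Lemma evB_1 : evB (C One) 1 1.
Proof. by split; rewrite ?expn1 //; rewrite /L; nia. Qed.

Lemma evB_small t v e : evB t v e -> v <= be -> evB t v 1.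
Proof. by case=> h1 h2 h le; split; rewrite ?expn1 ?small //; lia. Qed.

Lemma evB_nat k : k <= be -> evB (tnat k) k 1.
Proof.
move=> le; have s := small le; split; rewrite ?expn1 //; last by rewrite /L; nia.
by apply: ev_tnat => //; rewrite BL; apply: (leq_trans s); rewrite -{1}(expn1 B) leq_exp2l // /L; nia.
Qed.

Lemma ev_pow t k : ev D env t = k -> k < 2 ^ D -> ev D env (U1 Pow t) = 2 ^ k.
Proof.
move=> /= -> lt; apply/minn_idPl; have : 2 ^ k < 2 ^ 2 ^ D by rewrite ltn_exp2l.
lia.
Qed.

Lemma ev_En64 : ev D env (C En /t tnat 64) = W.
Proof.
have [e _ _] : evB (tnat 64) 64 1 by apply: evB_nat; lia.
have -> u : ev D env (C En /t u) = 2 ^ D %/ ev D env u by [].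
by rewrite e -WL mulKn.
Qed.

Lemma evB_field j : j < 64 -> evB (yfield j) (yf j) 1.
Proof.
move=> lt; split; last by rewrite /L; nia.
  2: by rewrite expn1 yf_ltB.
have W0 : 0 < W by rewrite /W; nia.
have hj : ev D env (tnat j) = j by case: (@evB_nat j _) => //; nia.
rewrite /yfield ev_tmod // (@ev_pow _ W) ?ev_En64 //; last by rewrite -WL; lia.
have e : ev D env (tnat j *t (C En /t tnat 64)) = j * W.
  have -> t u : ev D env (t *t u) = (ev D env t * ev D env u) %% 2 ^ 2 ^ D by [].
  rewrite hj ev_En64 modn_small //; apply: (@leq_trans (2 ^ D)); last by rewrite ltnW // ltn_expl.
  by rewrite -WL ltn_pmul2r.
have -> t u : ev D env (t /t u) = ev D env t %/ ev D env u by [].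
rewrite (@ev_pow _ (j * W)) //; last by rewrite -WL ltn_pmul2r.
by rewrite mulnC expnM num_dig.
Qed.

Lemma evB_V : evB tV n 1.
Proof. by have := @evB_field 0 isT; rewrite yf0. Qed.

Lemma evB_V2 : evB tV2 (n * n) 1.
Proof. by apply: evB_small; [apply: (evB_mul evB_V evB_V)|]; rewrite /L; nia. Qed.

Lemma evB_V3 : evB tV3 (n * n * n) 1.
Proof. by apply: evB_small; [apply: (evB_mul evB_V2 evB_V)|]; rewrite /L; nia. Qed.

Lemma evB_be : evB tbe be 1.
Proof.
have h : evB (tnat 64 *t tV3) L 1.
  apply: evB_small; first by apply: evB_mul evB_V3 _; [apply: evB_nat|]; rewrite /L; nia.
  by [].
split; rewrite ?expn1 ?small //; last by rewrite /L; nia.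
have -> : ev D env tbe = 2 ^ D %/ ev D env (tnat 64 *t tV3) by [].
by case: h => -> _ _; rewrite hD mulKn // /L; nia.
Qed.

Lemma evB_pB t k e : evB t k e -> k < L -> evB (tpB t) (B ^ k) k.+1.
Proof.
move=> [h1 _ h3] lt; split=> //; last by rewrite ltn_exp2l.
rewrite BexpE; apply: ev_pow; last by rewrite hD mulnC ltn_pmul2r.
have -> u : ev D env (u *t t) = (ev D env u * ev D env t) %% 2 ^ 2 ^ D by [].
case: evB_be => -> _ _; rewrite h1 modn_small //.
apply: leq_trans (ltn_expl (2 ^ D) (isT : 1 < 2)).
by rewrite ltnS hD mulnC leq_pmul2r // ltnW.
Qed.

Lemma evB_geo1 t m e : evB t m e -> m < L -> evB (tgeo1 t) (num B m (fun=> 1)) m.+1.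
Proof.
move=> h lt; rewrite -geo_div //; apply: (evB_div (f := 2)).
  by apply: evB_sub evB_1 _; [exact: evB_pB h lt|rewrite expn_gt0 B0].
have := evB_pB evB_1 (_ : 1 < L); rewrite expn1 => h1.
by apply: evB_sub evB_1 _ => //; apply: h1; lia.
Qed.

Lemma evB_geo t m e : evB t m e -> 0 < m -> m * n < L -> m <= be ->
  evB (tgeo t) (num (B ^ m) n (fun=> 1)) (m * n).+1.
Proof.
move=> h m0 lt hm; have n0 : 0 < n by lia.
have h1 := evB_small h hm.
have mL : m < L by apply: leq_ltn_trans lt; nia.
rewrite -geo_div //; last by rewrite -{1}(expn0 B) ltn_exp2l.
rewrite -expnM; apply: (evB_div (f := m.+1)).
  apply: evB_sub evB_1 _; last by rewrite expn_gt0 B0.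
  by apply: (evB_pB (e := 2)) lt; apply: (evB_mul h1 evB_V); rewrite /L; nia.
by apply: evB_sub evB_1 _; [exact: evB_pB h mL|rewrite expn_gt0 B0].
Qed.

Lemma evB_spread t c u m : evB t c 1 -> c < 2 ^ (m * n) -> evB u m 1 ->
  0 < m -> (m * n).+2 < L -> m * n < be ->
  evB (tspread t u) (num B (m * n) (fun j => bit c j)) (m * n).+2.
Proof.
move=> hc hlt hu m0 lt lt'; rewrite -spreadE //.
have hmn : evB (u *t tV) (m * n) 1.
  by apply: evB_small; [apply: (evB_mul hu evB_V); lia|lia].
have bem : evB (tbe -t C One) be.-1 1.
  by rewrite -subn1; apply: evB_sub evB_be evB_1 _.
have q1 : be.-1 * (m * n) < 2 ^ D.
  rewrite hD mulnC; apply: (@leq_trans (L * be)); last by [].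
  apply: (@leq_trans ((m * n).+1 * be)); last by rewrite leq_mul2r; lia.
  by rewrite ltn_mul //; lia.
have hp1 : evB (U1 Pow ((tbe -t C One) *t (u *t tV))) (2 ^ (be.-1 * (m * n))) (m * n).+1.
  split; last by lia.
    apply: ev_pow q1; have [|//] := evB_mul bem hmn (_ : 1 + 1 <= L); lia.
  rewrite BexpE ltn_exp2l //; have : be.-1 * (m * n) <= be * (m * n) by rewrite leq_mul2r leq_pred orbT.
  by rewrite mulnS; lia.
have hp2 : evB (U1 Pow (tbe -t C One)) (2 ^ be.-1) 1.
  split; [|by rewrite expn1 ltn_exp2l //; lia|lia].
  apply: ev_pow; first by case: bem.
  by apply: leq_trans q1; rewrite ltnS leq_pmulr //; nia.
have one1 k : 0 < 2 ^ k by rewrite expn_gt0.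
apply: (evB_cap (e := 1 + (m * n).+1) (f := (m * n).+1)); last by apply: evB_geo1 hmn _; lia.
rewrite -geo_div; last by rewrite -{1}(expn0 2) ltn_exp2l //; lia.
apply: evB_mul hc _ _; last by lia.
rewrite -expnM; apply: (evB_div (f := 1)).
  by apply: evB_sub hp1 evB_1 _.
by apply: evB_sub hp2 evB_1 _.
Qed.

Lemma evB_addlt t u v w e f g : evB t v e -> evB u w f -> v + w < B ^ g -> g <= L ->
  evB (t +t u) (v + w) g.
Proof.
move=> [h1 h2 _] [h3 h4 _] lt le; split=> //=; rewrite h1 h3 modn_small // BL.
by apply: leq_trans lt _; rewrite leq_exp2l.
Qed.

Lemma evB_sumfields k : k <= 64 -> evB (tsumfields k) (num B k yf) k.+1.
Proof.
elim: k => [|k IH] le; first by rewrite num0; split; rewrite ?expn_gt0 ?B0 //; lia.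
rewrite numSr; apply: (evB_addlt (IH (ltnW le)) (f := 1 + k.+1)); last by lia.
  apply: evB_mul (evB_field le) _ _; last by lia.
  by apply: evB_pB (evB_nat _) _; lia.
rewrite -numSr; apply: (@leq_trans (B ^ k.+1)); last by rewrite leq_exp2l.
by apply: num_lt => j lt; apply: yf_ltB; lia.
Qed.

Lemma evB_range : evB trange (num B n (fun=> 2 ^ (be %/ 4) - 1)) n.+2.
Proof.
have nL : n.+2 < L by rewrite /L; nia.
have -> : num B n (fun=> 2 ^ (be %/ 4) - 1) = num B n (fun=> 1) * (2 ^ (be %/ 4) - 1).
  by rewrite mulnC numM; apply: eq_num => k _; rewrite muln1.
have -> : n.+2 = n.+1 + 1 by lia.
apply: evB_mul; [by apply: evB_geo1 evB_V _; lia| |lia].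
apply: evB_sub evB_1 _; last by rewrite expn_gt0.
have [e1 _ _] : evB (tbe /t tnat 4) (be %/ 4) 1.
  by apply: evB_div evB_be (evB_nat _); lia.
split; [apply: ev_pow e1 _| |lia].
  apply: (@leq_trans be); first by rewrite ltn_Pdiv //; lia.
  by rewrite hD leq_pmull //; lia.
by rewrite expn1 ltn_exp2l //; rewrite ltn_Pdiv //; lia.
Qed.

Lemma ev_in_range : (ev D env (tdiff (V 0 &t trange) (V 0)) == 0)
  = (land x (num B n (fun=> 2 ^ (be %/ 4) - 1)) == x).
Proof.
rewrite ev_tdiff //; have -> u : ev D env (V 0 &t u) = land x (ev D env u) by [].
by case: evB_range => -> _ _.
Qed.

Definition packX := x * B ^ 64 + num B 64 yf.

Let nL : 2 * n + 200 < L. Proof. by rewrite /L; nia. Qed.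

Section Small_x.
Hypothesis hxn : x < B ^ n.
Variable X : nat.
Hypothesis XE : X = packX.

Lemma X_lt : X < B ^ (2 * n).
Proof.
apply: (@leq_trans (B ^ (n + 64))); last by rewrite leq_exp2l //; lia.
rewrite expnD; apply: (@leq_trans (x.+1 * B ^ 64)); last by rewrite leq_mul2r hxn orbT.
by rewrite XE /packX mulSn addnC ltn_add2r; apply: num_lt => k lt; apply: yf_ltB.
Qed.

Lemma evB_X : evB tX X (2 * n).
Proof.
have := X_lt; rewrite XE => lt.
apply: (evB_addlt (e := n + 65) _ (evB_sumfields _)) lt _ => //; last by lia.
apply: evB_mul; [split=> //; lia|apply: evB_pB (evB_nat _) _; lia|lia].
Qed.

Lemma evB_mask u m v o : evB u m 1 -> evB v o 1 -> 0 < m -> m * n + o + 5 < L -> m <= be ->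
  evB (tmask u v) (num (B ^ m) n (fun=> 1) * ((B - 1) * B ^ o)) (m * n + o + 4).
Proof.
move=> hu hv m0 lt hm; have -> : m * n + o + 4 = (m * n).+1 + (2 + o.+1) by lia.
apply: evB_mul; [by apply: evB_geo hu _ _ _ => //; lia| |lia].
apply: evB_mul; [|by apply: evB_pB hv _; lia|lia].
have := evB_pB evB_1 (_ : 1 < L); rewrite expn1 => h1.
by apply: evB_sub evB_1 _ => //; apply: h1; lia.
Qed.

Lemma evB_sel t u m v o r : evB t (code n m o r) 1 -> evB u m 1 -> evB v o 1 ->
  2 * n + o <= m -> m * n + 2 * n + o + 5 < L -> m <= be ->
  (forall k, k < n -> r k <= o) ->
  evB (tsel t u v) (num (B ^ m) n (fun k => (X %/ B ^ r k) %% B * B ^ o)) (2 * n + (m * n).+2).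
Proof.
move=> ht hu hv om lt hm hr; have m0 : 0 < m by lia.
have om' : o < m by lia.
rewrite -(selE be0 X_lt) // -(@spread_code n be m) //.
apply: (evB_cap (f := m * n + o + 4)); last by apply: evB_mask => //; lia.
apply: evB_mul evB_X _ _; last by lia.
by apply: evB_spread => //; [apply: code_lt|lia|lia].
Qed.

Let v i := (X %/ B ^ i) %% B.

(** Both compared words are numerals in base [B^(16 n^2 + 8 n)] with one digit at position [2 n] of
    each block. The range condition [hv] keeps every left side below [B], so equality of the words
    is equality row by row. *)
Lemma ev_tcheck : (forall i, v i < 2 ^ (be %/ 4)) -> (ev D env tcheck == 0) =
  [forall k : 'I_n, v (ra k) * v (rb k) + land (v (rc k)) (v (rd k)) == v (re k)].
Proof.
move=> hv; have vB i : v i < B by rewrite ltn_mod.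
have Bh : B = 2 ^ be.-1 * 2 by rewrite -expnSr prednK.
(* Two values below [2^(be / 4)] have a product below [B / 2]; the other half of the range is left
   for the conjunction. *)
have ab i j : v i * v j < B %/ 2.
  apply: (@leq_trans (2 ^ (be %/ 4) * 2 ^ (be %/ 4))); first exact: ltn_mul.
  by rewrite -expnD Bh mulnK // leq_exp2l //; have := divn_eq be 4; lia.
have Bd : B %/ 2 * 2 = B by rewrite Bh mulnK.
have ab' i j : v i * v j < B by apply: leq_trans (ab i j) _; lia.
have hrow k : k < n -> [&& ra k <= n, rb k <= n, rc k <= n, rd k <= n & re k <= n].
  exact: rows_lt.
have h8 : evB tha (8 * n) 1.
  apply: evB_small; first by apply: (evB_mul (@evB_nat 8 _) evB_V); lia.
  by lia.
have h16 : evB thb (16 * (n * n)) 1.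
  apply: evB_small; first by apply: (evB_mul (@evB_nat 16 _) evB_V2); lia.
  by nia.
have h24 : evB thk (16 * (n * n) + 8 * n) 1.
  apply: evB_small; first by apply: (evB_add h16 h8); lia.
  by nia.
have h2 : evB to2 (2 * n) 1.
  apply: evB_small; first by apply: (evB_mul (@evB_nat 2 _) evB_V); lia.
  by nia.
have n24 : (16 * (n * n) + 8 * n) * n = 16 * (n * n * n) + 8 * (n * n) by lia.
have n16 : 16 * (n * n) * n = 16 * (n * n * n) by lia.
have n8 : 8 * n * n = 8 * (n * n) by lia.
have Sa : evB (tsel (yfield 1) tha tV) (num (B ^ (8 * n)) n (fun k => v (ra k) * B ^ n))
    (2 * n + (8 * n * n).+2).
  apply: evB_sel; rewrite -?yf1; [exact: evB_field|done|exact: evB_V|lia|rewrite /L; lia|nia|].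
  by move=> k /hrow /and5P[].
have Sb : evB (tsel (yfield 2) thb tV) (num (B ^ (16 * (n * n))) n (fun k => v (rb k) * B ^ n))
    (2 * n + (16 * (n * n) * n).+2).
  apply: evB_sel; rewrite -?yf2; [exact: evB_field|done|exact: evB_V|lia|rewrite /L; lia|nia|].
  by move=> k /hrow /and5P[].
have Sk j (r : nat -> nat) : j < 64 -> yf j = code n (16 * (n * n) + 8 * n) (2 * n) r ->
    (forall k, k < n -> r k <= n) ->
    evB (tsel (yfield j) thk to2)
      (num (B ^ (16 * (n * n) + 8 * n)) n (fun k => v (r k) * B ^ (2 * n)))
      (2 * n + ((16 * (n * n) + 8 * n) * n).+2).
  move=> lj ej hr; apply: evB_sel; rewrite -?ej; [exact: evB_field|done|done|lia|rewrite /L; lia|nia|].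
  by move=> k /hr; lia.
have Sc := Sk 3 _ isT yf3 (fun k lt => let: And5 _ _ h _ _ := and5P (hrow k lt) in h).
have Sd := Sk 4 _ isT yf4 (fun k lt => let: And5 _ _ _ h _ := and5P (hrow k lt) in h).
have Se := Sk 5 _ isT yf5 (fun k lt => let: And5 _ _ _ _ h := and5P (hrow k lt) in h).
have Bk : B ^ (16 * (n * n) + 8 * n) = 2 ^ (be * (16 * (n * n) + 8 * n)) by rewrite expnM.
have fl z : z < B -> z * B ^ (2 * n) < B ^ (16 * (n * n) + 8 * n).
  move=> hz; apply: (@leq_trans (B ^ (2 * n).+1)); last by rewrite leq_exp2l //; lia.
  by rewrite expnS ltn_pmul2r ?expn_gt0 ?B0.
have le1 : 2 * n + (8 * n * n).+2 + (2 * n + (16 * (n * n) * n).+2) <= L by rewrite /L; lia.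
have p1 : 0 < 16 * (n * n) + 8 * n by lia.
have p2 : (16 * (n * n) + 8 * n) * n + 2 * n + 5 < L by rewrite /L; lia.
have p3 : 16 * (n * n) + 8 * n <= be by nia.
have hmul := evB_cap (evB_mul Sa Sb le1) (evB_mask h24 h2 p1 p2 p3).
have hcap := evB_cap Sc Sd.
rewrite diagE // -/B in hmul; [|lia|lia|lia].
rewrite Bk land_num in hcap; last 3 first.
- by nia.
- by move=> k _; rewrite -Bk; apply: fl.
- by move=> k _; rewrite -Bk; apply: fl.
rewrite -Bk (@eq_num _ _ _ (fun k => land (v (rc k)) (v (rd k)) * B ^ (2 * n))) in hcap; last first.
  by move=> k _; rewrite BexpE land_mulX.
rewrite /tcheck ev_tdiff //.
have vlt i j k l : v i * v j + land (v k) (v l) < B.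
  have := ab i j; have := leq_ltn_trans (land_le (v k) (v l)) (hv k).
  have : 2 ^ (be %/ 4) <= B %/ 2.
    by rewrite Bh mulnK // leq_exp2l //; have := divn_eq be 4; lia.
  lia.
have [] := evB_addlt (g := (16 * (n * n) + 8 * n) * n) hmul hcap.
- rewrite numD (expnM B (16 * (n * n) + 8 * n) n); apply: num_lt => k _; rewrite -mulnDl; exact: fl.
- by rewrite /L; lia.
move=> -> _ _; case: Se => -> _ _; rewrite numD.
apply/eqP/forallP => [e k|h].
  have := num_inj _ _ e (ltn_ord k); rewrite -mulnDl => /(_ _ _)/eqP.
  rewrite eqn_pmul2r ?expn_gt0 ?B0 //; apply; move=> j _; last exact: fl.
  by rewrite -mulnDl; apply: fl.
by apply: eq_num => k lt; rewrite -mulnDl (eqP (h (Ordinal lt))).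
Qed.

End Small_x.

Lemma ev_Funiv : (ev D env Funiv == 0) = (ev D env tcheck == 0) &&
  (land x (num B n (fun=> 2 ^ (be %/ 4) - 1)) == x).
Proof.
rewrite -ev_in_range; have -> t u : ev D env (B2 Max t u) = maxn (ev D env t) (ev D env u) by [].
by rewrite -!leqn0 geq_max.
Qed.

End Fix_x.

(** Since the mask has only [n] digits, equality with the masked word also bounds the length of
    [x]. *)
Lemma in_rangeP x : reflect (x < B ^ n /\ forall k, k < n -> (x %/ B ^ k) %% B < 2 ^ (be %/ 4))
  (land x (num B n (fun=> 2 ^ (be %/ 4) - 1)) == x).
Proof.
have q k : k < n -> 2 ^ (be %/ 4) - 1 < B.
  by move=> _; apply: (@leq_trans (2 ^ (be %/ 4))); rewrite ?leq_exp2l ?leq_div // subn1 prednK ?expn_gt0.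
have dB k : k < n -> (x %/ B ^ k) %% B < B by rewrite ltn_mod B0.
have key : x < B ^ n -> land x (num B n (fun=> 2 ^ (be %/ 4) - 1))
   = num B n (fun k => (x %/ B ^ k) %% B %% 2 ^ (be %/ 4)).
  move=> h; rewrite -{1}(num_digs h) land_num //.
  by apply: eq_num => k _; rewrite land_mask.
apply: (iffP eqP) => [e|[h1 h2]].
  have lt : x < B ^ n by rewrite -e landC; apply: leq_ltn_trans (land_le _ _) (num_lt q).
  split=> // k lk; have := key lt; rewrite e -{1}(num_digs lt) => e'.
  rewrite (num_inj dB _ e' lk) ?ltn_mod ?expn_gt0 // => i li.
  by apply: leq_ltn_trans (leq_mod _ _) (dB _ li).
rewrite key // -[RHS](num_digs h1); apply: eq_num => k lt.
by rewrite modn_small // h2.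
Qed.

(** A solution [x] yields the assignment given by the digits of [packX x]; conversely
    [v 64, v 65, ...] are packed into [x]. Rows mention only indices up to [n], and the digits up to
    [n + 63] agree with [v], so all rows are preserved. *)
Theorem Funiv_spec : (exists2 x, x < 2 ^ 2 ^ D & ev D [:: x; y] Funiv = 0) <->
  exists v : nat -> nat, [/\ forall j, j < 64 -> v j = yf j,
    forall i, v i < 2 ^ (be %/ 4) &
    forall k, k < n -> v (ra k) * v (rb k) + land (v (rc k)) (v (rd k)) = v (re k)].
Proof.
have le64 : 64 <= n + 64 by lia.
pose xp x := packX x; pose digit X i := (X %/ B ^ i) %% B.
have dig_lo x j : j < 64 -> digit (xp x) j = yf j.
  move=> lt; rewrite /digit /xp /packX -(@digit_mod _ _ _ 64) // modnMDl.
  rewrite (modn_small (num_lt _)) ?num_dig // => k lk; exact: yf_ltB.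
have dig_hi x j : digit (xp x) (64 + j) = (x %/ B ^ j) %% B.
  rewrite /digit expnD divnMA /xp /packX divnMDl ?expn_gt0 ?B0 //.
  by rewrite (divn_small (num_lt _)) ?addn0 // => k lk; apply: yf_ltB.
split=> [[x hx /eqP]|[v [hv hlt hrow]]].
  rewrite ev_Funiv // => /andP[hc /in_rangeP[h1 h2]].
  have hall i : digit (xp x) i < 2 ^ (be %/ 4).
    case: (ltnP i 64) => [lt|le]; first by rewrite dig_lo // yf_lt.
    rewrite -(subnKC le) dig_hi; case: (ltnP (i - 64) n) => [/h2//|le'].
    rewrite divn_small ?mod0n ?expn_gt0 //.
    by apply: leq_trans h1 _; rewrite leq_exp2l.
  exists (digit (xp x)); split=> [j lt|//|k lt]; first exact: dig_lo.
  have := ev_tcheck hx h1 (erefl _) hall; rewrite (eqP hc) eqxx => /esym/forallP.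
  by move/(_ (Ordinal lt))/eqP.
pose x := num B n (fun i => v (64 + i)).
have vB i : v i < B by apply: leq_trans (hlt i) _; rewrite leq_exp2l // leq_div.
have h1 : x < B ^ n by apply: num_lt.
have hx : x < 2 ^ 2 ^ D by rewrite BL; apply: leq_trans h1 _; rewrite leq_exp2l // /L; nia.
have xd k : k < n -> (x %/ B ^ k) %% B = v (64 + k) by move=> lt; rewrite num_dig.
have dv i : i < n + 64 -> digit (xp x) i = v i.
  move=> lt; case: (ltnP i 64) => [l|le]; first by rewrite dig_lo // hv.
  by rewrite -(subnKC le) dig_hi xd //; lia.
have hall i : digit (xp x) i < 2 ^ (be %/ 4).
  case: (ltnP i (n + 64)) => [lt|le]; first by rewrite dv.
  have -> : i = 64 + (i - 64) by lia.
  rewrite dig_hi divn_small ?mod0n ?expn_gt0 //.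
  by apply: leq_trans h1 _; rewrite leq_exp2l //; lia.
exists x => //; apply/eqP; rewrite ev_Funiv //.
rewrite (ev_tcheck hx h1 (erefl _) hall); apply/andP; split; last first.
  by apply/in_rangeP; split=> // k lt; rewrite xd.
apply/forallP => k; have /and5P[] := rows_lt (ltn_ord k) => *.
by rewrite -!/(digit _ _) !dv ?hrow //; lia.
Qed.

End Universal.

(** * Compiling terms to systems of equations *)

(* The row [(a, b, c, d, e)] is the equation [v_a v_b + (v_c AND v_d) = v_e]. *)
Definition row := (nat * nat * nat * nat * nat)%type.
Definition holds (v : nat -> nat) (r : row) :=
  let: (a, b, c, d, e) := r in v a * v b + land (v c) (v d) == v e.
Arguments holds : simpl never.
Definition row_lt m (r : row) :=
  let: (a, b, c, d, e) := r in [&& a < m, b < m, c < m, d < m & e < m].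

(* Variables 6 and 7 are reserved for the constants 0 and 1. *)
Definition radd a b c : row := (a, 7, b, b, c).
Definition rmul a b c : row := (a, b, 6, 6, c).
Definition rand a b c : row := (6, 6, a, b, c).

Section Rows.
Variable v : nat -> nat.
Hypotheses (v6 : v 6 = 0) (v7 : v 7 = 1).
Lemma holds_add a b c : holds v (radd a b c) = (v a + v b == v c).
Proof. by rewrite /holds /= v7 muln1 landxx. Qed.
Lemma holds_mul a b c : holds v (rmul a b c) = (v a * v b == v c).
Proof. by rewrite /holds /= v6 landxx addn0. Qed.
Lemma holds_and a b c : holds v (rand a b c) = (land (v a) (v b) == v c).
Proof. by rewrite /holds /= v6. Qed.
End Rows.

Section Compile.
Variables (D d : nat).
Hypotheses (D6 : 6 <= D) (dD : d <= D).

(** From 64 on the variables hold constants: [cidx j] the number [2^(2^j)], [widx j] the number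
    [2^j], [Midx] and [Uidx] the largest elements of levels [D] and [d]. The system generates them
    by repeated squaring and doubling, so they cost no space in [y]. *)
Definition cidx j := 64 + j.
Definition widx j := 65 + D + j.
Definition Qidx := cidx D.
Definition Midx := 66 + 2 * D.
Definition Uidx := 67 + 2 * D.
Definition base := 68 + 2 * D.

Definition base_rows : seq row :=
  [:: radd 7 7 (cidx 0); radd 7 6 (widx 0); radd Midx 7 Qidx; radd Uidx 7 (cidx d)]
  ++ flatten [seq [:: rmul (cidx j) (cidx j) (cidx j.+1); radd (widx j) (widx j) (widx j.+1)]
             | j <- iota 0 D].

Definition base_val i :=
  if i < 65 + D then 2 ^ 2 ^ (i - 64) else
  if i < 66 + 2 * D then 2 ^ (i - (65 + D)) else
  if i == Midx then 2 ^ 2 ^ D - 1 else 2 ^ 2 ^ d - 1.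

Definition based (v : nat -> nat) :=
  [/\ v 6 = 0, v 7 = 1 & forall i, 64 <= i -> i < base -> v i = base_val i].

Lemma all_flatten_iota (P : pred row) (f : nat -> seq row) n :
  reflect (forall j, j < n -> all P (f j)) (all P (flatten [seq f j | j <- iota 0 n])).
Proof.
apply: (iffP allP) => [h j lt|h r /flattenP[s /mapP[j]]].
  apply/allP => r hr; apply: h; apply/flattenP; exists (f j) => //.
  by apply: map_f; rewrite mem_iota.
by rewrite mem_iota => /h/allP h' -> /h'.
Qed.

Lemma size_flatten_iota c (f : nat -> seq row) m n : (forall j, size (f j) = c) ->
  size (flatten [seq f j | j <- iota m n]) = n * c.
Proof. by move=> h; elim: n m => //= n IH m; rewrite size_cat h IH. Qed.

Lemma base_sound v : v 6 = 0 -> v 7 = 1 -> all (holds v) base_rows -> based v.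
Proof.
move=> v6 v7; rewrite all_cat => /andP[/=]; rewrite !holds_add // v6 v7.
case/and5P=> /eqP h0 /eqP h1 /eqP hM /eqP hU _ /all_flatten_iota h.
have hc j : j <= D -> v (cidx j) = 2 ^ 2 ^ j.
  elim: j => [|j IH] le; first by rewrite -h0.
  have := h _ le; rewrite /= holds_mul // => /andP[/eqP<- _].
  by rewrite IH ?(ltnW le) // -expnD addnn -muln2 -expnSr.
have hw j : j <= D -> v (widx j) = 2 ^ j.
  elim: j => [|j IH] le; first by rewrite -h1.
  have := h _ le; rewrite /= holds_add // => /and3P[_ /eqP<- _].
  by rewrite IH ?(ltnW le) // expnS mul2n addnn.
split=> // i i1 i2; rewrite /base_val.
case: ltnP => [l1|g1]; first by rewrite -hc /cidx ?subnKC //; lia.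
case: ltnP => [l2|g2]; first by rewrite -hw /widx ?subnKC //; lia.
case: eqP => [->|ne]; first by rewrite -hc // -/Qidx -hM addnK.
have -> : i = Uidx by rewrite /Uidx /Midx /base in i2 ne *; lia.
by rewrite -(hc _ dD) -hU addnK.
Qed.

Lemma base_complete v : based v -> all (holds v) base_rows.
Proof.
move=> [v6 v7 h].
have hc j : j <= D -> v (cidx j) = 2 ^ 2 ^ j.
  move=> le; rewrite h /base_val /cidx /base; [|lia|lia].
  by rewrite ltnS -addSn leq_add2l le addKn.
have hw j : j <= D -> v (widx j) = 2 ^ j.
  move=> le; rewrite h /base_val /widx /base; [|lia|lia].
  have -> : 65 + D + j < 65 + D = false by lia.
  have -> : 65 + D + j < 66 + 2 * D by lia.
  by rewrite addKn.
have hM : v Midx = 2 ^ 2 ^ D - 1.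
  rewrite h /base_val /Midx /base ?eqxx; [|lia|lia].
  have -> : 66 + 2 * D < 65 + D = false by lia.
  by have -> : 66 + 2 * D < 66 + 2 * D = false by lia.
have hU : v Uidx = 2 ^ 2 ^ d - 1.
  rewrite h /base_val /Uidx /Midx /base; [|lia|lia].
  have -> : 67 + 2 * D < 65 + D = false by lia.
  have -> : 67 + 2 * D < 66 + 2 * D = false by lia.
  by have -> : (67 + 2 * D == 66 + 2 * D) = false by lia.
rewrite all_cat /= !holds_add // hc // hw // v6 v7 hM hU /Qidx !hc // !subnK ?expn_gt0 // !eqxx /=.
apply/all_flatten_iota => j lt; rewrite /= holds_mul // holds_add // (hc j) 1?ltnW // (hc j.+1) // (hw j) 1?ltnW // (hw j.+1) //.
by rewrite -expnD !addnn -!muln2 -!expnSr !eqxx.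
Qed.

(** Every operation owns nine arrays of [D + 2] auxiliary variables behind the variable [p] of its
    value; [ix p b j] is entry [j] of array [b]. The count nine is dictated by [Pow]. *)
Definition loc_size := 9 * (D + 2) + 2.
Definition ix p b j := p.+1 + b * (D + 2) + j.

(** Rows speak about natural numbers and offer neither order nor cases; these are coded by slack
    variables and by products required to vanish. For [Pow], [X j] is [x / 2^j], [be j] is bit [j]
    of [x], kept in 0 or 1 by [be j * be j = be j], and [f j] is [2^(x mod 2^j)], which gains the
    factor [2^(2^j)] exactly when [be j = 1]. If [X D > 0], then [E 0 = 0] and the value is the
    maximum; if [X D = 0], then [E 1 > 0], so [E 4 = E 5 = 0] and the value is [f D]. *)
Definition unary_rows f x p : seq row := match f with
  | Neg => [:: radd x p Midx]
  | Pow =>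
    let X := ix p 0 in let be := ix p 1 in let T := ix p 2 in let f := ix p 3 in
    let g := ix p 4 in let h := ix p 5 in let k := ix p 6 in let s := ix p 7 in
    let E := ix p 8 in
    [:: radd x 6 (X 0); radd 7 6 (f 0);
        radd p (E 0) Midx; rmul (E 0) (X D) 6;
        radd (E 1) (X D) (E 3); radd 7 (E 2) (E 3); rmul (E 1) (X D) 6;
        radd p (E 4) (E 6); radd (f D) (E 5) (E 6);
        rmul (E 1) (E 4) 6; rmul (E 1) (E 5) 6]
    ++ flatten [seq [:: rmul (be j) (be j) (be j); radd (X j.+1) (X j.+1) (T j);
          radd (T j) (be j) (X j); rmul (f j) (cidx j) (g j); rmul (be j) (g j) (h j);
          rmul (be j) (f j) (k j); radd (f j) (h j) (s j); radd (f j.+1) (k j) (s j)]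
       | j <- iota 0 D]
  end.

Definition unary_val f x b j := match f with
  | Neg => 0
  | Pow =>
    let z := uop D Pow x in let F i := 2 ^ (x %% 2 ^ i) in
    let be i := (x %/ 2 ^ i) %% 2 in let hi := x %/ 2 ^ D in
    match b with
    | 0 => x %/ 2 ^ j
    | 1 => be j
    | 2 => x %/ 2 ^ j.+1 + x %/ 2 ^ j.+1
    | 3 => F j
    | 4 => F j * 2 ^ 2 ^ j
    | 5 => be j * (F j * 2 ^ 2 ^ j)
    | 6 => be j * F j
    | 7 => F j + be j * (F j * 2 ^ 2 ^ j)
    | _ => match j with
           | 0 => 2 ^ 2 ^ D - 1 - z
           | 1 => (hi == 0)
           | 2 => hi.-1
           | 3 => (hi == 0) + hi
           | 4 => F D - z
           | 5 => z - F D
           | _ => maxn z (F D)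
           end
    end
  end.

(** For [Div], [t 4] is the remainder and [t 6] witnesses that it is below [y]. Both [t 5] and [t 7]
    vanish when [y] is nonzero; when [y = 0] the rows make [t 7] positive, and the last one forces
    the value 0. For [Max] and [Min] the two slacks are the distances of the arguments from the
    value, and one of them vanishes. *)
Definition binary_rows f x y p : seq row :=
  let t := ix p 0 in
  match f with
  | Add => [:: radd x y (t 0); rmul (t 1) Qidx (t 2); radd p (t 2) (t 0); radd p (t 3) Midx]
  | Mul => [:: rmul x y (t 0); rmul (t 1) Qidx (t 2); radd p (t 2) (t 0); radd p (t 3) Midx]
  | Div => [:: rmul p y (t 0); radd (t 0) (t 4) (t 1); radd (t 1) (t 5) x; rmul (t 5) y 6;
               radd (t 4) (t 6) (t 2); radd (t 2) 7 (t 3); radd y (t 7) (t 3);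
               rmul (t 7) y 6; rmul (t 7) p 6]
  | Max => [:: radd x (t 0) p; radd y (t 1) p; rmul (t 0) (t 1) 6]
  | Min => [:: radd p (t 0) x; radd p (t 1) y; rmul (t 0) (t 1) 6]
  | Cap => [:: rand x y p]
  end.

Definition binary_val f x y j :=
  let Q := 2 ^ 2 ^ D in
  match f with
  | Add => nth 0 [:: x + y; (x + y) %/ Q; (x + y) %/ Q * Q; Q - 1 - (x + y) %% Q] j
  | Mul => nth 0 [:: x * y; (x * y) %/ Q; (x * y) %/ Q * Q; Q - 1 - (x * y) %% Q] j
  | Div => if y == 0 then nth 0 [:: 0; 0; 0; 1; 0; x; 0; 1] j
           else nth 0 [:: x %/ y * y; x; y.-1; y; x %% y; 0; y.-1 - x %% y; 0] j
  | Max => nth 0 [:: y - x; x - y] j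
  | Min => nth 0 [:: x - y; y - x] j
  | Cap => 0
  end.

Lemma div_mod_step x i : (x %/ 2 ^ i.+1) + (x %/ 2 ^ i.+1) + (x %/ 2 ^ i) %% 2 = x %/ 2 ^ i.
Proof. by rewrite expnSr divnMA addnn -muln2 -divn_eq. Qed.

Lemma mod_step x i : x %% 2 ^ i.+1 = x %% 2 ^ i + (x %/ 2 ^ i) %% 2 * 2 ^ i.
Proof.
have := divn_eq x (2 ^ i.+1); have := divn_eq x (2 ^ i).
have := div_mod_step x i; rewrite expnS mul2n -addnn.
move: (x %/ (2 ^ i + 2 ^ i)) (x %% (2 ^ i + 2 ^ i)) => a b.
move: (x %/ 2 ^ i) (x %% 2 ^ i) (2 ^ i) => c e f; move: (c %% 2) => g.
by nia.
Qed.

Section Sound.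
Variable v : nat -> nat.
Hypothesis bv : based v.
Let v6 : v 6 = 0. Proof. by case: bv. Qed.
Let v7 : v 7 = 1. Proof. by case: bv. Qed.

Lemma v_cidx j : j <= D -> v (cidx j) = 2 ^ 2 ^ j.
Proof.
move=> le; case: bv => _ _ ->; rewrite /cidx /base /base_val; [|lia|lia].
by rewrite ltnS -addSn leq_add2l le addKn.
Qed.

Lemma v_M : v Midx = 2 ^ 2 ^ D - 1.
Proof.
case: bv => _ _ ->; rewrite /Midx /base /base_val ?eqxx; [|lia|lia].
have -> : 66 + 2 * D < 65 + D = false by lia.
by have -> : 66 + 2 * D < 66 + 2 * D = false by lia.
Qed.

Lemma v_U : v Uidx = 2 ^ 2 ^ d - 1.
Proof.
case: bv => _ _ ->; rewrite /Uidx /Midx /base /base_val; [|lia|lia].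
have -> : 67 + 2 * D < 65 + D = false by lia.
have -> : 67 + 2 * D < 66 + 2 * D = false by lia.
by have -> : (67 + 2 * D == 66 + 2 * D) = false by lia.
Qed.

Lemma v_w : v (widx D) = 2 ^ D.
Proof.
case: bv => _ _ ->; rewrite /widx /base /base_val; [|lia|lia].
have -> : 65 + D + D < 65 + D = false by lia.
have -> : 65 + D + D < 66 + 2 * D by lia.
by rewrite addKn.
Qed.

Lemma unary_sound f x p : v x < 2 ^ 2 ^ D -> all (holds v) (unary_rows f x p) ->
  v p = uop D f (v x).
Proof.
move=> hx; case: f => /=.
  by rewrite holds_add // v_M andbT => /eqP<-; rewrite addKn.
rewrite !holds_add // !holds_mul // v6 v7 v_M addn0.
case/andP=> /eqP X0 /andP[/eqP f0 /andP[/eqP E0 /andP[E0X]]].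
case/andP=> /eqP E13 /andP[/eqP E23 /andP[E1X /andP[/eqP E46]]].
case/andP=> /eqP E56 /andP[E14 /andP[E15 /all_flatten_iota h]].
have hX j : j <= D -> v (ix p 0 j) = v x %/ 2 ^ j.
  elim: j => [|j IH] le; first by rewrite -X0 divn1.
  have := h _ le; rewrite /= !holds_mul // !holds_add //.
  case/and4P=> /eqP hb /eqP hT /eqP hs _.
  have {IH} := IH (ltnW le); rewrite -hs -hT expnSr divnMA => <-.
  have : v (ix p 1 j) < 2 by nia.
  by rewrite addnn -muln2 => lt; rewrite divnMDl // divn_small ?addn0.
have hb j : j < D -> v (ix p 1 j) = (v x %/ 2 ^ j) %% 2.
  move=> lt; have := h _ lt; rewrite /= !holds_mul // !holds_add //.
  case/and4P=> /eqP hb /eqP hT /eqP hs _.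
  rewrite -hX 1?ltnW // -hs -hT addnn -muln2 modnMDl modn_small //; nia.
have hf j : j <= D -> v (ix p 3 j) = 2 ^ (v x %% 2 ^ j).
  elim: j => [|j IH] le; first by rewrite -f0 modn1.
  have := h _ le; rewrite /= !holds_mul // !holds_add //.
  case/and5P=> _ _ _ /eqP hg /and5P[/eqP hh /eqP hk /eqP hs /eqP hs' _].
  have {IH} IH := IH (ltnW le).
  rewrite mod_step expnD -(hb _ le); move: hs'; rewrite -hs -hk -hh -hg IH v_cidx 1?ltnW //.
  have : v (ix p 1 j) < 2 by rewrite hb // ltn_mod.
  by case: (v (ix p 1 j)) => [|[|//]] _; rewrite ?mul0n ?mul1n ?muln1 ?addn0; lia.
rewrite hX // in E0X E13 E1X; rewrite hf // in E56.
have [hi|hi] := posnP (v x %/ 2 ^ D).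
  have lt : v x < 2 ^ D by rewrite ltnNge -divn_gt0 ?expn_gt0 // hi.
  rewrite modn_small // in E56; rewrite (minn_idPl _); last first.
    have : 2 ^ v x < 2 ^ 2 ^ D by rewrite ltn_exp2l. lia.
  have : 0 < v (ix p 8 1) by lia.
  by move: E14 E15; rewrite !muln_eq0; nia.
have le : 2 ^ D <= v x by rewrite leqNgt; apply/negP => lt; rewrite divn_small in hi.
rewrite (minn_idPr _); last first.
  have : 2 ^ 2 ^ D <= 2 ^ v x by rewrite leq_exp2l. lia.
by move: E0X; rewrite muln_eq0; lia.
Qed.

Lemma binary_sound f x y p : v x < 2 ^ 2 ^ D -> v y < 2 ^ 2 ^ D ->
  all (holds v) (binary_rows f x y p) -> v p = bop D f (v x) (v y).
Proof.
have Q0 : 0 < 2 ^ 2 ^ D by rewrite expn_gt0.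
 have hM := v_M; have hQ : v Qidx = 2 ^ 2 ^ D by apply: v_cidx.
have modP z t0 t1 t2 t3 : z + t2 = t0 -> t1 * 2 ^ 2 ^ D = t2 -> z + t3 = 2 ^ 2 ^ D - 1 ->
    z = t0 %% 2 ^ 2 ^ D.
  by move=> <- <- h; rewrite addnC modnMDl modn_small //; lia.
move=> hx hy; case: f; rewrite /= ?holds_and // ?(holds_add, holds_mul) // ?v6 ?v7 ?hM ?hQ ?andbT.
- by case/and4P=> /eqP-> /eqP h1 /eqP h2 /eqP h3; apply: modP h2 h1 h3.
- by case/and4P=> /eqP-> /eqP h1 /eqP h2 /eqP h3; apply: modP h2 h1 h3.
- case/and5P=> /eqP h0 /eqP h1 /eqP h2 h3 /and5P[/eqP h4 /eqP h5 /eqP h6 h7 h8].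
  move: h3 h7 h8; rewrite !muln_eq0.
  have [y0|y0] := posnP (v y).
    by rewrite y0 divn0 !orbT => _ _; lia.
  rewrite !orbF => /eqP e5 /eqP e7 _.
  rewrite -h2 -h1 -h0 e5 addn0 divnMDl // divn_small ?addn0 //; lia.
- by case/and3P=> /eqP h0 /eqP h1; rewrite muln_eq0; lia.
- by case/and3P=> /eqP h0 /eqP h1; rewrite muln_eq0; lia.
- by move/eqP.
Qed.

Lemma unary_complete f x p : v x < 2 ^ 2 ^ D -> v p = uop D f (v x) ->
  (forall b j, b < 9 -> j < D + 2 -> v (ix p b j) = unary_val f (v x) b j) ->
  all (holds v) (unary_rows f x p).
Proof.
move=> hx hp h; case: f hp h => hp h /=.
  by rewrite holds_add // hp v_M andbT subnKC //; lia.
have h' b j : b < 9 -> j <= D.+1 -> v (ix p b j) = unary_val Pow (v x) b j.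
  by move=> lb lj; apply: h => //; lia.
have z_le : uop D Pow (v x) <= 2 ^ 2 ^ D - 1 by apply: geq_minr.
rewrite !holds_add // !holds_mul // !h' //; try lia.
rewrite v6 v7 hp v_M /= -/(uop D Pow (v x)) divn1 modn1 !addn0 !eqxx subnKC // eqxx /=.
set hi := v x %/ 2 ^ D; set z := minn _ _; set F := 2 ^ (_ %% _).
have zE : hi = 0 -> z = F.
  move=> e; have lt : v x < 2 ^ D.
    by rewrite ltnNge -divn_gt0 ?expn_gt0 // -/hi e.
  rewrite /z /F modn_small //; apply/minn_idPl.
  have : 2 ^ v x < 2 ^ 2 ^ D by rewrite ltn_exp2l. lia.
have zM : 0 < hi -> z = 2 ^ 2 ^ D - 1.
  move=> e; have le : 2 ^ D <= v x by rewrite leqNgt; apply/negP => lt; rewrite /hi divn_small in e.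
  apply/minn_idPr; have : 2 ^ 2 ^ D <= 2 ^ v x by rewrite leq_exp2l. lia.
apply/and5P; split; last (apply/and4P; split).
- by rewrite muln_eq0; case: (posnP hi) => [_|/zM->]; rewrite ?orbT // subnn.
- by case: (posnP hi) => [->|]; lia.
- by case: (hi).
- by lia.
- by lia.
- by case: (posnP hi) => [e|]; [rewrite zE // subnn muln0|case: (hi)].
- by case: (posnP hi) => [e|]; [rewrite zE // subnn muln0|case: (hi)].
apply/all_flatten_iota => j lt; rewrite /= !holds_mul // !holds_add //.
rewrite !h' //; try lia.
rewrite v_cidx 1?ltnW //= div_mod_step !eqxx mod_step expnD /=.
by have := ltn_pmod (v x %/ 2 ^ j) (isT : 0 < 2); case: (_ %% 2) => [|[|//]] _; rewrite ?mul0n ?mul1n ?muln1 ?addn0 ?eqxx //=; apply/eqP; lia.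
Qed.

Lemma binary_complete f x y p : v x < 2 ^ 2 ^ D -> v y < 2 ^ 2 ^ D ->
  v p = bop D f (v x) (v y) ->
  (forall j, j < 8 -> v (ix p 0 j) = binary_val f (v x) (v y) j) ->
  all (holds v) (binary_rows f x y p).
Proof.
have Q0 : 0 < 2 ^ 2 ^ D by rewrite expn_gt0.
 have hM := v_M; have hQ : v Qidx = 2 ^ 2 ^ D by apply: v_cidx.
have hm z : z %% 2 ^ 2 ^ D + (2 ^ 2 ^ D - 1 - z %% 2 ^ 2 ^ D) = 2 ^ 2 ^ D - 1.
  by rewrite subnKC // -ltnS subn1 prednK // ltn_mod.
move=> hx hy hp h; case: f hp h => hp h;
  rewrite /= ?holds_and // ?(holds_add, holds_mul) // ?h // ?hp ?v6 ?v7 ?hM ?hQ ?andbT /=.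
- by rewrite !eqxx /= addnC -divn_eq eqxx hm eqxx.
- by rewrite !eqxx /= addnC -divn_eq eqxx hm eqxx.
- have [y0|y0] := eqVneq (v y) 0; rewrite /= ?y0 ?divn0 ?muln0 ?eqxx //=.
  rewrite -divn_eq !eqxx /= addn0 !eqxx.
  by have := ltn_mod (v x) (v y); lia.
- by rewrite /= muln_eq0; lia.
- by rewrite /= muln_eq0; lia.
- by [].
Qed.

End Sound.

(** * Systems attached to whole terms *)

Definition cst_idx c := match c with
  | Zero => 6 | One => 7 | MinusOne => Midx | En => widx D end.

Lemma v_cst v c : based v -> v (cst_idx c) = cst D c.
Proof. by move=> bv; case: c => /=; [case: bv|case: bv|exact: v_M|exact: v_w]. Qed.

Fixpoint sz t := match t with
  | V _ | C _ => 1
  | U1 _ u => loc_size + sz u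
  | B2 _ u w => loc_size + sz u + sz w end.

(** The variables from [p] to [p + sz t - 1] belong to [t]: first its value, then the auxiliary
    arrays, then the variables of the arguments. *)
Fixpoint tcomp (e : nat -> nat) t p : seq row := match t with
  | V i => [:: radd (e i) 6 p]
  | C c => [:: radd (cst_idx c) 6 p]
  | U1 f u => unary_rows f (p + loc_size) p ++ tcomp e u (p + loc_size)
  | B2 f u w => binary_rows f (p + loc_size) (p + (loc_size + sz u)) p
      ++ tcomp e u (p + loc_size) ++ tcomp e w (p + (loc_size + sz u)) end.

Fixpoint asg env t p i := match t with
  | V _ | C _ => ev D env t
  | U1 f u => if i < p + loc_size then
      if i == p then ev D env t
      else unary_val f (ev D env u) ((i - p).-1 %/ (D + 2)) ((i - p).-1 %% (D + 2))
    else asg env u (p + loc_size) i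
  | B2 f u w => if i < p + loc_size then
      if i == p then ev D env t
      else binary_val f (ev D env u) (ev D env w) (i - p).-1
    else if i < p + (loc_size + sz u) then asg env u (p + loc_size) i
    else asg env w (p + (loc_size + sz u)) i end.

Lemma sz_gt0 t : 0 < sz t.
Proof. by case: t => //= *; rewrite /loc_size; lia. Qed.

Lemma comp_sound v e env t p : based v -> bounded (2 ^ 2 ^ D) env ->
  (forall i, v (e i) = nth 0 env i) -> all (holds v) (tcomp e t p) -> v p = ev D env t.
Proof.
move=> bv henv he; have [v6 v7 _] := bv.
elim: t p => [i|c|f u IH|f u IHu w IHw] p /=.
- by rewrite andbT holds_add // he v6 addn0 => /eqP.
- by rewrite andbT holds_add // v_cst // v6 addn0 => /eqP.
- rewrite all_cat => /andP[h /IH e1]; rewrite -e1; apply: unary_sound => //.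
  by rewrite e1; apply: ev_lt.
- rewrite !all_cat => /and3P[h /IHu e1 /IHw e2]; rewrite -e1 -e2; apply: binary_sound => //.
    by rewrite e1; apply: ev_lt.
  by rewrite e2; apply: ev_lt.
Qed.

Lemma asg_root env t p : asg env t p p = ev D env t.
Proof.
have L0 : 0 < loc_size by rewrite /loc_size; lia.
by case: t => //= *; rewrite -{1}(addn0 p) ltn_add2l L0 eqxx.
Qed.

Lemma comp_complete v e env t p : based v -> bounded (2 ^ 2 ^ D) env ->
  (forall i, v (e i) = nth 0 env i) ->
  (forall i, p <= i -> i < p + sz t -> v i = asg env t p i) -> all (holds v) (tcomp e t p).
Proof.
move=> bv henv he; have [v6 v7 _] := bv.
have root t' q : (forall i, q <= i -> i < q + sz t' -> v i = asg env t' q i) -> v q = ev D env t'.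
  by move=> h; rewrite h ?asg_root //; have := sz_gt0 t'; lia.
elim: t p => [i|c|f u IH|f u IHu w IHw] p h.
- by have := root _ _ h; rewrite /= andbT holds_add // he v6 addn0 => ->.
- by have := root _ _ h; rewrite /= andbT holds_add // v_cst // v6 addn0 => ->.
- have h1 i : p + loc_size <= i -> i < p + loc_size + sz u -> v i = asg env u (p + loc_size) i.
    by move=> l1 l2; rewrite h /= ?ltnNge ?l1 //; lia.
  have e1 := root _ _ h1; rewrite /= all_cat IH // andbT; apply: unary_complete => //.
  + by rewrite e1; apply: ev_lt.
  + by rewrite e1; apply: root h.
  move=> b j hb hj; have lt : b * (D + 2) + j < 9 * (D + 2).
    by apply: (@leq_trans (b.+1 * (D + 2))); [rewrite mulSn; lia|rewrite leq_mul2r hb orbT].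
  rewrite h /ix /= /loc_size; [|lia|lia].
  have -> : p.+1 + b * (D + 2) + j < p + (9 * (D + 2) + 2) by lia.
  have -> : (p.+1 + b * (D + 2) + j == p) = false by lia.
  have -> : (p.+1 + b * (D + 2) + j - p).-1 = b * (D + 2) + j by lia.
  by rewrite divnMDl ?modnMDl ?divn_small ?modn_small ?addn0 ?e1 //; lia.
- have h1 i : p + loc_size <= i -> i < p + loc_size + sz u -> v i = asg env u (p + loc_size) i.
    move=> l1 l2; rewrite h /= ?ltnNge ?l1 //=; [|lia|lia].
    by have -> : (p + (loc_size + sz u) <= i) = false by lia.
  have h2 i : p + (loc_size + sz u) <= i -> i < p + (loc_size + sz u) + sz w ->
      v i = asg env w (p + (loc_size + sz u)) i.
    move=> l1 l2; rewrite h /=; [|lia|lia].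
    have -> : (i < p + loc_size) = false by lia.
    by have -> : (i < p + (loc_size + sz u)) = false by lia.
  have e1 := root _ _ h1; have e2 := root _ _ h2.
  rewrite /= !all_cat IHu // IHw // !andbT; apply: binary_complete => //.
  + by rewrite e1; apply: ev_lt.
  + by rewrite e2; apply: ev_lt.
  + by rewrite e1 e2; apply: root h.
  move=> j hj; rewrite h /ix /= /loc_size; [|lia|lia].
  have -> : p.+1 + 0 * (D + 2) + j < p + (9 * (D + 2) + 2) by lia.
  have -> : (p.+1 + 0 * (D + 2) + j == p) = false by lia.
  have -> : (p.+1 + 0 * (D + 2) + j - p).-1 = j by lia.
  by rewrite e1 e2.
Qed.

(** The bound is [2^(be / 4)] for the digit width [be = 64 * 2^D] of the next level, so the intended
    values are within the range that [Funiv] admits. *)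
Lemma asg_lt env t p i : bounded (2 ^ 2 ^ D) env -> p <= i -> asg env t p i < 2 ^ (16 * 2 ^ D).
Proof.
move=> henv; set K := 2 ^ (16 * 2 ^ D).
have Qle : 2 ^ 2 ^ D <= 2 ^ (2 * 2 ^ D) by rewrite leq_exp2l //; lia.
have Qle2 : 2 ^ (4 * 2 ^ D) * 4 <= K.
  by rewrite -(expnD 2 _ 2) leq_exp2l //; have := expn_gt0 2 D; lia.
have Qle3 : 2 ^ (2 * 2 ^ D) <= 2 ^ (4 * 2 ^ D) by rewrite leq_exp2l //; lia.
have QK : 2 ^ 2 ^ D < K by rewrite ltn_exp2l //; have := expn_gt0 2 D; lia.
have hev t' : ev D env t' < K by apply: ltn_trans (ev_lt _ henv) QK.
elim: t p => [j|c|f u IH|f u IHu w IHw] p le; rewrite /asg -/asg; try exact: hev.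
- case: (ltnP i (p + loc_size)) => [_|l]; last exact: IH.
  case: eqP => _; first exact: hev.
  have := ltn_mod ((i - p).-1) (D + 2); rewrite addn2 /= => hj.
  move: (_ %% _) hj (_ %/ _) => j hj b.
  have hx := ev_lt u henv; move: (ev D env u) hx => x hx.
  have K0 : 0 < K by rewrite expn_gt0.
  case: f => //=.
  have xd m : x %/ m < K by apply: leq_ltn_trans (leq_div _ _) (ltn_trans hx QK).
  have hF m : m < D.+2 -> 2 ^ (x %% 2 ^ m) < 2 ^ (2 * 2 ^ D).
    move=> hm; rewrite ltn_exp2l //; apply: (@leq_trans (2 ^ m)); first by rewrite ltn_mod expn_gt0.
    by rewrite -expnS leq_exp2l.
  have h2 : 2 ^ 2 ^ j <= 2 ^ (2 * 2 ^ D) by rewrite leq_exp2l // -expnS leq_exp2l.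
  have hFg : 2 ^ (x %% 2 ^ j) * 2 ^ 2 ^ j < 2 ^ (4 * 2 ^ D).
    have -> : 4 * 2 ^ D = 2 * 2 ^ D + 2 * 2 ^ D by lia.
    rewrite expnD; apply: (@leq_trans ((2 ^ (x %% 2 ^ j)).+1 * 2 ^ 2 ^ j)).
      by rewrite ltn_pmul2r ?expn_gt0.
    by apply: leq_mul => //; apply: hF.
  have hb m : (x %/ m) %% 2 < 2 by rewrite ltn_mod.
  have hF' := hF _ hj; have hFD := hF D (ltnW (leqnn _)).
  have hz := leq_ltn_trans (geq_minr (2 ^ x) (2 ^ 2 ^ D - 1)) (_ : _ < K); move/(_ _): hz => hz.
  have hzK : minn (2 ^ x) (2 ^ 2 ^ D - 1) < K by apply: hz; apply: leq_ltn_trans (leq_subr _ _) QK.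
  case: b => [|[|[|[|[|[|[|[|b]]]]]]]] //.
  + by apply: leq_trans (hb _) _; lia.
  + have : x %/ 2 ^ j.+1 <= x by apply: leq_div. lia.
  + by lia.
  + by lia.
  + by have := hb (2 ^ j); case: (_ %% 2) => [|[|//]] _; rewrite ?mul0n ?mul1n; lia.
  + by have := hb (2 ^ j); case: (_ %% 2) => [|[|//]] _; rewrite ?mul0n ?mul1n; lia.
  + by have := hb (2 ^ j); case: (_ %% 2) => [|[|//]] _; rewrite ?mul0n ?mul1n; lia.
  have := xd (2 ^ D); have : x %/ 2 ^ D <= x by apply: leq_div.
  by case: j {hj hF' h2 hFg} => [|[|[|[|[|[|j]]]]]]; rewrite ?gtn_max; lia.
- case: (ltnP i (p + loc_size)) => [_|l]; last first.
    by case: (ltnP i (p + _)) => l2; [exact: IHu|exact: IHw].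
  case: eqP => _; first exact: hev.
  have hx := ev_lt u henv; have hy := ev_lt w henv.
  move: (ev D env u) (ev D env w) hx hy ((i - p).-1) => x y hx hy j.
  have K0 : 0 < K by rewrite expn_gt0.
  have nthK s : all (fun z => z < K) s -> nth 0 s j < K.
    by move=> h; apply: (@bounded_nth K s).
  have xy : x * y < 2 ^ (2 * 2 ^ D) by rewrite mul2n -addnn expnD; apply: ltn_mul.
  have xyd m : m %/ 2 ^ 2 ^ D * 2 ^ 2 ^ D <= m by apply: leq_divM.
  have xyd' m : m %/ 2 ^ 2 ^ D <= m by apply: leq_div.
  have dy : x %/ y * y <= x by apply: leq_divM.
  have my : x %% y <= x by apply: leq_mod.
  case: f; rewrite /binary_val //; try case: ifP => _; apply: nthK; rewrite /= ?andbT.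
  + by have := xyd (x + y); have := xyd' (x + y); lia.
  + by have := xyd (x * y); have := xyd' (x * y); lia.
  + by lia.
  + by lia.
  + by lia.
  + by lia.
Qed.

Lemma row_lt_comp e t p m : (forall i, e i < m) -> base <= m -> p + sz t <= m ->
  all (row_lt m) (tcomp e t p).
Proof.
move=> he hb; elim: t p => [i|c|f u IH|f u IHu w IHw] p /= hp.
- by rewrite he /= /base in hb *; lia.
- by case: c; rewrite /= /base /Midx /widx in hb *; lia.
- rewrite all_cat IH ?andbT; last by lia.
  have := sz_gt0 u; case: f => u0; rewrite /= /ix /Midx /base /loc_size in hb hp *; first by lia.
  rewrite /loc_size in hp u0 *; do 11! (apply/andP; split; first by lia).
  by apply/all_flatten_iota => j lt /=; rewrite /cidx; lia.
- rewrite !all_cat IHu ?IHw ?andbT; [|lia|lia].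
  have := sz_gt0 u; have := sz_gt0 w.
  by case: f; rewrite /= /ix /Qidx /cidx /Midx /base /loc_size in hb hp *; lia.
Qed.

Lemma size_comp e t p : size (tcomp e t p) <= sz t.
Proof.
elim: t p => [i|c|f u IH|f u IHu w IHw] p //=.
- rewrite size_cat leq_add //; case: f => //=; first by rewrite /loc_size; lia.
  by rewrite (@size_flatten_iota 8) // /loc_size; lia.
- rewrite !size_cat addnA !leq_add //; case: f => //=; rewrite /loc_size; lia.
Qed.

(** With [loc_size] added, the size at a binary node is the sum of those of its arguments, hence at
    most doubles with each unit of depth. *)
Lemma sz_le t : sz t + loc_size <= 2 ^ (tdepth t).+1 * loc_size.
Proof.
have L1 : 1 <= loc_size by rewrite /loc_size; lia.
elim: t => [i|c|f u IH|f u IHu w IHw] /=; try by rewrite expn1; lia.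
  by rewrite expnS; lia.
rewrite expnS; have hu : 2 ^ (tdepth u).+1 <= 2 ^ (maxn (tdepth u) (tdepth w)).+1.
  by rewrite leq_exp2l // ltnS leq_maxl.
have hw : 2 ^ (tdepth w).+1 <= 2 ^ (maxn (tdepth u) (tdepth w)).+1.
  by rewrite leq_exp2l // ltnS leq_maxr.
by nia.
Qed.

Lemma row_lt_base m : base <= m -> all (row_lt m) base_rows.
Proof.
move=> h; rewrite all_cat; apply/andP; split.
  by rewrite /= /cidx /widx /Midx /Qidx /Uidx /cidx /base in h *; lia.
by apply/all_flatten_iota => j lt; rewrite /= /cidx /widx /base in h *; lia.
Qed.

Lemma size_base_rows : size base_rows = 4 + 2 * D.
Proof.
by rewrite size_cat (@size_flatten_iota 2) //= mulnC.
Qed.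

End Compile.

(** * Eliminating one quantifier *)

(** Injective because [a] is smaller than the gap between the squares of [a + b] and [a + b + 1].
    Three rows express it, and they recover both components. *)
Definition npair a b := (a + b) * (a + b) + a.

Lemma npair_inj a b a' b' : npair a b = npair a' b' -> a = a' /\ b = b'.
Proof.
rewrite /npair => h; suff e : a + b = a' + b' by rewrite e in h; lia.
by case: (ltngtP (a + b) (a' + b')) => //; nia.
Qed.

(** The space for one of the five codes, of which the longest has [(16 n^2 + 8 n) n] bits. *)
Definition tlam := tnat 32 *t (V 1 *t V 1 *t V 1).
(** Variable 0 of the new term is the advice, 1 to 12 are the constants, the arguments start at 13.
    From these the fields of the word [y] for [Funiv] are assembled: the advice supplies the five
    codes and, in field 8, the pair of the advices of the two old terms. *)
Definition pack_field j :=
  if j == 0 then V 1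
  else if j <= 5 then (V 0 /t U1 Pow (tnat j.-1 *t tlam)) %t U1 Pow tlam
  else if j == 6 then C Zero else if j == 7 then C One
  else if j == 8 then V 0 /t U1 Pow (tnat 5 *t tlam)
  else V (j - 8).
Fixpoint pack_sum k :=
  if k is m.+1 then pack_sum m +t pack_field m *t U1 Pow (tnat m *t (C En /t tnat 64))
  else C Zero.
Definition tpack := pack_sum 64.

Section Collapse.
Variables (G : nat -> tm) (d nu t K : nat) (cs : seq nat).
Let n := 2 ^ nu.
(** [2^cost = (64 n^3) * 64]: the first factor is the number of digits in the layout of [Funiv], the
    second makes a digit [64 * 2^D] bits wide, so that a quarter of it holds every auxiliary
    value. *)
Definition cost := 3 * nu + 12.
Definition level i := d + i * cost.
Definition T0 := t + tdepth tpack.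
Definition lam := 32 * (n * n * n).
(** Pairing the two old advices doubles the length, which is therefore exponential in the number of
    levels; [kbitsK] asks that it still fit into an element of the small structure. *)
Fixpoint kbits i := if i is j.+1 then 2 * kbits j + (5 * lam + 3) else 0.
Let U := 2 ^ 2 ^ d.

Hypothesis d6 : 6 <= d.
Hypothesis nu_d : 3 * nu + 6 <= d.
Hypothesis nu6 : 6 <= nu.
Hypothesis size_cs : size cs = 12.
Hypothesis cs_lt : bounded U cs.
Hypothesis cs0 : nth 0 cs 0 = n.
Hypothesis kbitsK : kbits K <= 2 ^ d.
Hypothesis depth_G : forall i, i < K -> tdepth (G (level i.+1)) <= t.
Hypothesis G_spec : forall i y, i < K -> y < 2 ^ 2 ^ level i.+1 ->
  ev (level i.+1) [:: y] (G (level i.+1)) = 0 <->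
  exists2 x, x < 2 ^ 2 ^ level i.+1 & ev (level i.+1) [:: x; y] Funiv = 0.
Hypothesis n_big : forall i, i < K ->
  100 + 2 * level i + 2 ^ T0.+2 * loc_size (level i) <= n.

(* [P] is expressed by a shallow term over level [i]; the parameter [kappa] plays the role of advice. *)
Definition decided i a (P : seq nat -> bool) := exists kappa tau,
  [/\ kappa < 2 ^ kbits i, tdepth tau <= T0 &
   forall rho, size rho = a -> bounded U rho ->
     (ev (level i) (kappa :: cs ++ rho) tau == 0) = P rho].

Lemma kbits_le i : i <= K -> kbits i <= 2 ^ d.
Proof.
move=> le; apply: leq_trans kbitsK; rewrite -(subnK le); elim: (K - i) => //= m IH.
by lia.
Qed.

Lemma U_le i : U <= 2 ^ 2 ^ level i.
Proof. by rewrite leq_exp2l // leq_exp2l // leq_addr. Qed.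

Lemma bounded_le b b' s : b <= b' -> bounded b s -> bounded b' s.
Proof. by move=> le /allP h; apply/allP => x /h lt; apply: leq_trans lt le. Qed.

Section Step.
Variables (i a : nat).
Hypotheses (iK : i < K) (a39 : a <= 39).
Let D := level i.
Let D' := level i.+1.
Let be := 64 * 2 ^ D.
Let D6 : 6 <= D. Proof. by rewrite /D /level; lia. Qed.
Let dD : d <= D. Proof. by rewrite /D /level; lia. Qed.

Lemma level_be : 2 ^ D' = 64 * (n * n * n) * be.
Proof.
have -> : D' = nu + nu + nu + 12 + D by rewrite /D' /D /level /cost; lia.
rewrite (expnD 2 _ D) (expnD 2 _ 12) (expnD 2 (nu + nu)) (expnD 2 nu nu) /be -/n.
by rewrite (_ : 2 ^ 12 = 64 * 64) //; move: (2 ^ D) n => p q; nia.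
Qed.

Lemma lam_be : 64 * (n * n * n) <= be.
Proof. by rewrite /be leq_mul2l /n -!expnD leq_exp2l //; lia. Qed.

Lemma n64 : 64 <= n.
Proof. by rewrite -[64]/(2 ^ 6) leq_exp2l. Qed.

Variables (k1 k2 : nat) (t1 t2 : tm).
Hypotheses (hk1 : k1 < 2 ^ kbits i) (hk2 : k2 < 2 ^ kbits i).
Hypotheses (ht1 : tdepth t1 <= T0) (ht2 : tdepth t2 <= T0).

Let b0 := base D.
Let p1 := b0 + 9.
Let p2 := p1 + sz D t1.
Let m := p2 + sz D t2.

(** Where the system finds variable [j] of an old term: its advice in [k], the constants in fields 9
    to 20, the guessed element in [b0 + 4], the remaining arguments in fields 21 to 59. Any other
    variable is read from field 6, that is as 0, the default of [nth]. *)
Definition eidx k j := if j == 0 then k else if j <= 12 then 8 + j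
  else if j == 13 then b0 + 4 else if j <= 52 then 7 + j else 6.

(** Variables [b0] and [b0 + 1] are the old advices, recovered from field 8. The row with [Uidx D]
    confines the guessed element to the small structure. With [z = v (b0 + 6)] the last rows say
    [z + v p1 >= 1] and [v p2 * z = 0]: if the first term vanishes, so does the second. *)
Definition srows : seq row :=
  base_rows D d ++
  [:: radd b0 (b0 + 1) (b0 + 2); rmul (b0 + 2) (b0 + 2) (b0 + 3); radd (b0 + 3) b0 8;
      radd (b0 + 4) (b0 + 5) (Uidx D); radd (b0 + 6) p1 (b0 + 7); radd 7 (b0 + 8) (b0 + 7);
      rmul p2 (b0 + 6) 6]
  ++ tcomp D (eidx b0) t1 p1 ++ tcomp D (eidx (b0 + 1)) t2 p2.

(** The default row reads [0 * 0 + (0 AND 0) = 0]; it pads the system to [n] rows. *)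
Definition srow k := nth (6, 6, 6, 6, 6) srows k.
Let ra k := (srow k).1.1.1.1.
Let rb k := (srow k).1.1.1.2.
Let rc k := (srow k).1.1.2.
Let rd k := (srow k).1.2.
Let re k := (srow k).2.

Lemma sz_m : m <= n /\ size srows <= n.
Proof.
have h := n_big iK; have h1 := sz_le D6 dD t1; have h2 := sz_le D6 dD t2.
have e1 : 2 ^ (tdepth t1).+1 <= 2 ^ T0.+1 by rewrite leq_exp2l.
have e2 : 2 ^ (tdepth t2).+1 <= 2 ^ T0.+1 by rewrite leq_exp2l.
have L1 := leq_mul e1 (leqnn (loc_size D)); have L2 := leq_mul e2 (leqnn (loc_size D)).
have s1 := size_comp D6 dD (eidx b0) t1 p1; have s2 := size_comp D6 dD (eidx (b0 + 1)) t2 p2.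
rewrite -/D (expnS 2 T0.+1) -mulnA in h.
have {h1 L1} h1 := leq_trans h1 L1; have {h2 L2} h2 := leq_trans h2 L2.
rewrite /srows size_cat (size_base_rows D d) !size_cat /=.
move: (size (tcomp D (eidx b0) t1 p1)) s1 (size (tcomp D (eidx (b0 + 1)) t2 p2)) s2.
move=> S1 s1 S2 s2; rewrite /m /p2 /p1 /b0 /base.
by move: (2 ^ _ * _) h h1 h2 => X h h1 h2; split; lia.
Qed.

Lemma srow_le k : k < n -> [&& ra k <= n, rb k <= n, rc k <= n, rd k <= n & re k <= n].
Proof.
have [hm _] := sz_m; have s1 := sz_gt0 D6 dD t1; have s2 := sz_gt0 D6 dD t2.
have hb1 : b0 < m by rewrite /m /p2 /p1; lia.
have hb2 : b0 + 1 < m by rewrite /m /p2 /p1; lia.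
have he k' : k' < m -> forall j : nat, eidx k' j < m.
  by move=> hk j; rewrite /eidx /m /p2 /p1 /b0 /base in hk *; do !case: ifP => ?; lia.
have : all (row_lt m) srows.
  rewrite !all_cat -all_cat -/(base_rows D d) (row_lt_base D6 dD) ?(row_lt_comp D6 dD (he _ hb1)) ?(row_lt_comp D6 dD (he _ hb2)) //=.
  - by rewrite /Uidx andbT; have := (erefl b0 : b0 = 68 + 2 * D); lia.
  all: try first [exact: (ltnW hb1)|exact: leqnn|exact: (leq_addr (sz D t2) p2)].
move/allP => h _; rewrite /ra /rb /rc /rd /re /srow.
have n6 := n64; case: (ltnP k (size srows)) => [lt|le]; last by rewrite nth_default //=; lia.
by have := h _ (mem_nth (6, 6, 6, 6, 6) lt); case: (nth _ _ _) => [[[[x1 x2] x3] x4] x5] /=; lia.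
Qed.

Lemma srows_holds (v : nat -> nat) : v 6 = 0 ->
  (forall k, k < n -> v (ra k) * v (rb k) + land (v (rc k)) (v (rd k)) = v (re k))
  <-> all (holds v) srows.
Proof.
move=> v6; have [_ hs] := sz_m; rewrite /ra /rb /rc /rd /re.
have E k : (v (srow k).1.1.1.1 * v (srow k).1.1.1.2 +
    land (v (srow k).1.1.2) (v (srow k).1.2) = v (srow k).2) <-> holds v (srow k).
  by rewrite /holds; case: (srow k) => [[[[x1 x2] x3] x4] x5] /=; split => /eqP.
split=> [h|/allP h k _].
  apply/(all_nthP (6, 6, 6, 6, 6)) => k lt; apply/E/h; exact: leq_trans lt hs.
apply/E; rewrite /srow; case: (ltnP k (size srows)) => [lt|le]; first by apply: h; apply: mem_nth.
by rewrite nth_default // /holds v6 landxx.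
Qed.

Definition code_a := code n (8 * n) n ra.
Definition code_b := code n (16 * (n * n)) n rb.
Definition code_c := code n (16 * (n * n) + 8 * n) (2 * n) rc.
Definition code_d := code n (16 * (n * n) + 8 * n) (2 * n) rd.
Definition code_e := code n (16 * (n * n) + 8 * n) (2 * n) re.
Definition codes := [:: code_a; code_b; code_c; code_d; code_e].
Definition kappa := num (2 ^ lam) 5 (fun j => nth 0 codes j) + 2 ^ (5 * lam) * npair k1 k2.

Lemma code_bits m' o r' : o < m' -> m' * n <= lam -> code n m' o r' < 2 ^ lam.
Proof. by move=> h le; apply: leq_trans (code_lt n r' h) _; rewrite leq_exp2l. Qed.

Lemma codes_lt j : nth 0 codes j < 2 ^ lam.
Proof.
have n1 := n64; apply: (@bounded_nth _ codes); first by rewrite expn_gt0.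
rewrite /bounded /= /lam -/n; apply/and5P; split; rewrite ?andbT; apply: code_bits; rewrite /lam -/n; nia.
Qed.

Lemma npair_lt : npair k1 k2 < 2 ^ (2 * kbits i + 2).
Proof.
have -> : 2 * kbits i + 2 = (kbits i).+1 + (kbits i).+1 by lia.
rewrite expnD expnS; move: (2 ^ kbits i) hk1 hk2 => X h1 h2; rewrite /npair.
by nia.
Qed.

Lemma kappa_lt : kappa < 2 ^ kbits i.+1.
Proof.
have h := npair_lt; have hc : num (2 ^ lam) 5 (fun j => nth 0 codes j) < 2 ^ (5 * lam).
  by rewrite mulnC expnM; apply: num_lt => j _; apply: codes_lt.
rewrite /kappa; apply: (@leq_trans (2 ^ (5 * lam) * 2 ^ (2 * kbits i + 2))).
  apply: (@leq_trans (2 ^ (5 * lam) * (npair k1 k2).+1)); first by rewrite mulnS ltn_add2r.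
  by rewrite leq_mul2l h orbT.
by rewrite -expnD leq_exp2l //=; lia.
Qed.

Section Input.
Variable rho : seq nat.
Hypotheses (srho : size rho = a) (hrho : bounded U rho).
Definition yf j := nth 0 (n :: codes ++ [:: 0; 1; npair k1 k2] ++ cs ++ rho) j.

Let env k x := k :: cs ++ x :: rho.
Let kU k : k < 2 ^ kbits i -> k < 2 ^ 2 ^ D.
Proof.
move=> lt; apply: leq_trans lt _; rewrite leq_exp2l //.
by apply: leq_trans (kbits_le (ltnW iK)) _; rewrite leq_exp2l.
Qed.
Let envb k x : k < 2 ^ kbits i -> x < U -> bounded (2 ^ 2 ^ D) (env k x).
Proof.
move=> hk hx; rewrite /bounded /= kU //= all_cat; apply/andP; split.
  exact: bounded_le (U_le i) cs_lt.
by rewrite /= (leq_trans hx (U_le i)); exact: bounded_le (U_le i) hrho.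
Qed.

Lemma yf_cs j : j < 12 -> yf (9 + j) = nth 0 cs j.
Proof. by move=> lt; rewrite /yf /= nth_cat size_cs lt. Qed.

Lemma yf_rho j : yf (21 + j) = nth 0 rho j.
Proof. by rewrite /yf /= nth_cat size_cs /= subSS; congr nth; lia. Qed.

Lemma eidx_env (v : nat -> nat) k kk x : (forall j, j < 64 -> v j = yf j) ->
  v k = kk -> v (b0 + 4) = x -> forall j, v (eidx k j) = nth 0 (env kk x) j.
Proof.
move=> hv hk hx j; rewrite /eidx /env; case: j => [|j] //=.
case: ltnP => [lt|ge].
  rewrite nth_cat size_cs lt hv; last by lia.
  by rewrite (_ : 8 + j.+1 = 9 + j) ?yf_cs //; lia.
rewrite nth_cat size_cs (ltnNge j 12) ge /=.
case: eqP => [[->]|ne]; first by rewrite hx.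
have -> : j - 12 = (j - 13).+1 by lia.
case: (ltnP j 52) => [le|gt] /=; last by rewrite nth_default ?srho; [rewrite hv|lia].
rewrite hv; last by lia.
by rewrite (_ : 7 + j.+1 = 21 + (j - 13)) ?yf_rho //; lia.
Qed.

Lemma step_sound v : (forall j, j < 64 -> v j = yf j) -> all (holds v) srows ->
  exists2 x, x < U & (ev D (env k1 x) t1 == 0) ==> (ev D (env k2 x) t2 == 0).
Proof.
move=> hv; have v6 : v 6 = 0 by rewrite hv. have v7 : v 7 = 1 by rewrite hv.
rewrite /srows all_cat => /andP[/(base_sound D6 dD v6 v7) bv].
rewrite all_cat => /andP[hl]; rewrite all_cat => /andP[hc1 hc2]; move: hl => /=.
rewrite !(holds_add, holds_mul) // v6 v7 (v_U D6 dD bv) (hv 8) // => /and5P[/eqP e1 /eqP e2 /eqP e3 /eqP e4].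
case/and4P=> /eqP e5 /eqP e6 e7 _.
have [ek1 ek2] : v b0 = k1 /\ v (b0 + 1) = k2.
  by apply: npair_inj; rewrite /npair e1 e2 e3.
have hx : v (b0 + 4) < U by have := expn_gt0 2 (2 ^ d); rewrite -/U in e4 *; lia.
exists (v (b0 + 4)) => //.
have r1 := comp_sound D6 dD bv (envb hk1 hx) (eidx_env hv ek1 erefl) hc1.
have r2 := comp_sound D6 dD bv (envb hk2 hx) (eidx_env hv ek2 erefl) hc2.
rewrite -r1 -r2; move: e7; rewrite muln_eq0 => e7; apply/implyP => /eqP z.
by rewrite z addn0 in e5; move: e7; rewrite e5 -e6 addn_eq0 andFb orbF.
Qed.

Lemma step_complete x : x < U -> (forall j, j < 64 -> yf j < 2 ^ (16 * 2 ^ D)) ->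
  (ev D (env k1 x) t1 == 0) ==> (ev D (env k2 x) t2 == 0) ->
  exists v : nat -> nat, [/\ forall j, j < 64 -> v j = yf j,
    forall j, v j < 2 ^ (16 * 2 ^ D) & all (holds v) srows].
Proof.
move=> hx hy; set r1 := ev D _ t1; set r2 := ev D _ t2 => himp.
have q0 := expn_gt0 2 D.
pose z : nat := r1 == 0.
pose loc := [:: k1; k2; k1 + k2; (k1 + k2) * (k1 + k2); x; U - 1 - x; z; z + r1; z + r1 - 1].
pose v j := if j < 64 then yf j else if j < b0 then base_val D d j
  else if j < b0 + 9 then nth 0 loc (j - b0)
  else if j < p2 then asg D (env k1 x) t1 p1 j else asg D (env k2 x) t2 p2 j.
have hv j : j < 64 -> v j = yf j by rewrite /v => ->.
have v6 : v 6 = 0 by rewrite hv. have v7 : v 7 = 1 by rewrite hv.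
have b64 : 64 <= b0 by rewrite /b0 /base.
have bv : based D d v.
  by split=> // j j1 j2; rewrite /v ltnNge j1 /= j2.
have vl j : j < 9 -> v (b0 + j) = nth 0 loc j.
  move=> lt; rewrite /v; have -> : (b0 + j < 64) = false by lia.
  have -> : (b0 + j < b0) = false by lia.
  by rewrite ltn_add2l lt addKn.
have v1 j : p1 <= j -> j < p1 + sz D t1 -> v j = asg D (env k1 x) t1 p1 j.
  move=> l1 l2; rewrite /v; have -> : (j < 64) = false by rewrite /p1 in l1; lia.
  have -> : (j < b0) = false by rewrite /p1 in l1; lia.
  have -> : (j < b0 + 9) = false by rewrite /p1 in l1; lia.
  by rewrite l2.
have v2 j : p2 <= j -> j < p2 + sz D t2 -> v j = asg D (env k2 x) t2 p2 j.
  move=> l1 l2; rewrite /v; have -> : (j < 64) = false by rewrite /p2 /p1 in l1; lia.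
  have -> : (j < b0) = false by rewrite /p2 /p1 in l1; lia.
  have -> : (j < b0 + 9) = false by rewrite /p2 /p1 in l1; lia.
  by rewrite ltnNge l1.
have vb0 : v b0 = k1 by rewrite -(addn0 b0) vl.
exists v; split=> //.
  have big e : e <= 8 * 2 ^ D -> 2 ^ e < 2 ^ (16 * 2 ^ D) by move=> le; rewrite ltn_exp2l //; lia.
  have Qb := big (2 ^ D) ltac:(lia); have Ub : U <= 2 ^ 2 ^ D := U_le i.
  have Q4 : 2 ^ (4 * 2 ^ D) < 2 ^ (16 * 2 ^ D) by apply: big; lia.
  have r1lt : r1 < 2 ^ 2 ^ D by apply: ev_lt; apply: envb.
  have kk : (k1 + k2) * (k1 + k2) < 2 ^ (4 * 2 ^ D).
    have -> : 4 * 2 ^ D = 2 * 2 ^ D + 2 * 2 ^ D by lia.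
    rewrite expnD; have lt : k1 + k2 < 2 ^ (2 * 2 ^ D).
      have := kU hk1; have := kU hk2; have : 2 ^ 2 ^ D * 2 <= 2 ^ (2 * 2 ^ D).
        by rewrite -expnSr leq_exp2l //; lia.
      lia.
    exact: ltn_mul.
  have Q2 : 2 ^ 2 ^ D * 2 < 2 ^ (16 * 2 ^ D) by rewrite -expnSr ltn_exp2l //; lia.
  have zle : z <= 1 by rewrite /z; case: eqP.
  move=> j; rewrite /v; case: (ltnP j 64) => [|_]; first exact: hy.
  case: (ltnP j b0) => [lt|ge].
    rewrite /base_val; case: ifP => l1.
      by rewrite ltn_exp2l //; apply: (@leq_ltn_trans (2 ^ D)); [rewrite leq_exp2l //; lia|lia].
    case: ifP => l2.
      rewrite ltn_exp2l //; have := ltn_expl D (isT : 1 < 2); lia.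
    by case: ifP => _; apply: leq_ltn_trans (leq_subr _ _) _; rewrite ?(leq_ltn_trans Ub).
  case: (ltnP j (b0 + 9)) => [lt|ge2].
    apply: (@bounded_nth _ loc); first by rewrite expn_gt0.
    by have := kU hk1; have := kU hk2; rewrite /bounded /=; lia.
  case: (ltnP j p2) => ge3; apply: (asg_lt D6 dD) => //; exact: envb.
have e1 := eidx_env hv vb0 (vl 4 isT); have e2 := eidx_env hv (vl 1 isT) (vl 4 isT).
rewrite /srows all_cat (base_complete D6 dD bv) all_cat all_cat; apply/and4P; split.
- by [].
- have vp1 : v p1 = r1 by rewrite v1 ?(asg_root D6 dD) //; have := sz_gt0 D6 dD t1; lia.
  have vp2 : v p2 = r2 by rewrite v2 ?(asg_root D6 dD) //; have := sz_gt0 D6 dD t2; lia.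
  rewrite /= !(holds_add, holds_mul) // vb0 vp1 vp2 v6 v7 (v_U D6 dD bv) (hv 8) // !vl //=.
  have zr : 0 < z + r1 by rewrite /z; case: (posnP r1).
  have r2z : r2 * z = 0.
    by rewrite /z; move: himp; case: (r1 == 0) => /=; rewrite ?muln0 // => /eqP->.
  by rewrite r2z !eqxx /= -/U; lia.
- exact: (comp_complete D6 dD bv (envb hk1 hx) e1 v1).
- exact: (comp_complete D6 dD bv (envb hk2 hx) e2 v2).
Qed.

Let W := n * n * n * be.
Let WD : 64 * W = 2 ^ D'. Proof. by rewrite level_be /W; lia. Qed.
Let penv := kappa :: cs ++ rho.

Lemma penv_bounded : bounded (2 ^ 2 ^ D') penv.
Proof.
rewrite /bounded /= all_cat; apply/and3P; split.
- apply: leq_trans kappa_lt _; rewrite leq_exp2l //; apply: leq_trans (kbits_le iK) _.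
  by rewrite leq_exp2l // leq_addr.
- exact: bounded_le (U_le _) cs_lt.
- exact: bounded_le (U_le _) hrho.
Qed.

Let ltD' k : k < 2 ^ D' -> k < 2 ^ 2 ^ D'.
Proof. by move=> lt; apply: ltn_trans lt (ltn_expl _ _). Qed.

Lemma ev_mulsmall u w a' b' : ev D' penv u = a' -> ev D' penv w = b' -> a' * b' < 2 ^ D' ->
  ev D' penv (u *t w) = a' * b'.
Proof. by move=> /= -> -> h; rewrite modn_small // ltD'. Qed.

Lemma ev_powsmall u k : ev D' penv u = k -> k < 2 ^ D' -> ev D' penv (U1 Pow u) = 2 ^ k.
Proof.
move=> /= -> lt; apply/minn_idPl; have : 2 ^ k < 2 ^ 2 ^ D' by rewrite ltn_exp2l.
lia.
Qed.

Lemma lam_D' j : j <= 5 -> j * lam < 2 ^ D'.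
Proof.
move=> le; rewrite level_be /lam -/n; have h1 := n64; have h2 := lam_be.
have p0 : 64 <= n * n * n by nia.
by nia.
Qed.

Lemma nth_penv1 : nth 0 penv 1 = n.
Proof. by rewrite /penv /= nth_cat size_cs /= cs0. Qed.

Lemma ev_tlam : ev D' penv tlam = lam.
Proof.
have h := lam_D' (isT : 1 <= 5); rewrite mul1n /lam -/n in h.
have h1 := n64; have e1 : ev D' penv (V 1) = n := nth_penv1.
have e2 := ev_mulsmall e1 e1; have {}e2 : ev D' penv (V 1 *t V 1) = n * n by apply: e2; nia.
have {}e2 : ev D' penv (V 1 *t V 1 *t V 1) = n * n * n by apply: ev_mulsmall; [..|nia].
apply: ev_mulsmall e2 h; apply: ev_tnat; apply: ltD'; nia.
Qed.

Lemma ev_jlam j : j <= 5 -> ev D' penv (U1 Pow (tnat j *t tlam)) = 2 ^ (j * lam).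
Proof.
move=> le; have h := lam_D' le; apply: ev_powsmall => //; apply: ev_mulsmall ev_tlam h.
by apply: ev_tnat; apply: ltD'; have := n64; have := lam_D' (isT : 5 <= 5); rewrite /lam -/n; nia.
Qed.

Lemma ev_pack_field j : j < 64 -> ev D' penv (pack_field j) = yf j.
Proof.
move=> lt; rewrite /pack_field; case: eqP => [->|/eqP j0]; first exact: nth_penv1.
case: leqP => [le5|gt5].
  have -> : yf j = nth 0 codes j.-1.
    by case: j j0 le5 {lt} => [|[|[|[|[|[|]]]]]].
  rewrite ev_tmod ?penv_bounded // (ev_powsmall ev_tlam); last by rewrite -(mul1n lam) lam_D'.
  have -> u : ev D' penv (V 0 /t u) = kappa %/ ev D' penv u by [].
  rewrite ev_jlam; last by lia.
  have j5 : j.-1 < 5 by lia.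
  rewrite mulnC expnM -(@digit_mod _ _ _ 5) ?expn_gt0 // /kappa mulnC [5 * lam]mulnC expnM addnC modnMDl.
  rewrite (modn_small (num_lt _)) => [|k _]; last exact: codes_lt.
  by rewrite num_dig // => k _; apply: codes_lt.
do 2! (case: eqP => [->|/eqP ?]; first by []).
case: eqP => [->|/eqP ?].
  have -> u : ev D' penv (V 0 /t u) = kappa %/ ev D' penv u by [].
  rewrite ev_jlam // /kappa addnC [2 ^ _ * _]mulnC divnMDl ?expn_gt0 // divn_small ?addn0 //.
  by rewrite mulnC expnM; apply: num_lt => k _; apply: codes_lt.
have -> : j = 9 + (j - 9) by lia.
have -> // : ev D' penv (V (9 + (j - 9) - 8)) = nth 0 penv (j - 9).+1.
by rewrite /=; congr nth; lia.
Qed.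

Lemma be4 : be %/ 4 = 16 * 2 ^ D.
Proof. by rewrite /be (_ : 64 = 16 * 4) // -mulnA mulnCA mulKn. Qed.

Lemma yf_lt j : j < 64 -> yf j < 2 ^ (16 * 2 ^ D).
Proof.
move=> _; have h1 := n64; have h2 := lam_be.
have lam2 : lam <= 2 ^ D.
  have : n * n * n * 2 ^ 6 <= 2 ^ D by rewrite /n -!expnD leq_exp2l //; lia.
  by rewrite /lam -/n (_ : 2 ^ 6 = 64) //; lia.
have big e : e <= 16 * 2 ^ D -> 2 ^ e <= 2 ^ (16 * 2 ^ D) by move=> le; rewrite leq_exp2l.
have Dle : 2 ^ D <= 16 * 2 ^ D by lia.
have Q2 : 1 < 2 ^ (16 * 2 ^ D).
  by rewrite -{1}(expn0 2) ltn_exp2l //; have := expn_gt0 2 D; lia.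
have Ub : U <= 2 ^ (16 * 2 ^ D) by apply: leq_trans (U_le i) (big _ Dle).
apply: bounded_nth; first by rewrite expn_gt0.
rewrite /bounded /= !all_cat -/(bounded _ cs) -/(bounded _ rho).
rewrite (bounded_le Ub cs_lt) (bounded_le Ub hrho) !andbT.
have hc j' : nth 0 codes j' < 2 ^ (16 * 2 ^ D).
  by apply: leq_trans (codes_lt j') (big _ _); lia.
have -> : n < 2 ^ (16 * 2 ^ D).
  apply: leq_trans (ltn_expl n (isT : 1 < 2)) (big _ _); rewrite /lam -/n in lam2; nia.
rewrite (hc 0) (hc 1) (hc 2) (hc 3) (hc 4) expn_gt0 Q2 /=.
apply: leq_trans npair_lt (big _ _).
have := kbits_le (ltnW iK); have : 2 ^ d <= 2 ^ D by rewrite leq_exp2l.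
have : 0 < 2 ^ D by rewrite expn_gt0.
lia.
Qed.

Lemma ev_tpack : ev D' penv tpack = num (2 ^ W) 64 yf.
Proof.
have h1 := n64; have h2 := lam_be.
have beW : 16 * 2 ^ D <= W by rewrite /W -be4; have := leq_div be 4; nia.
have yW j : j < 64 -> yf j < 2 ^ W.
  by move=> lt; apply: leq_trans (yf_lt lt) _; rewrite leq_exp2l.
have W0 : 0 < W by have := expn_gt0 2 D; lia.
have e64 : ev D' penv (C En /t tnat 64) = W.
  have -> : ev D' penv (C En /t tnat 64) = 2 ^ D' %/ ev D' penv (tnat 64) by [].
  have -> : ev D' penv (tnat 64) = 64 by apply: ev_tnat; apply: ltD'; rewrite -WD; nia.
  by rewrite -WD mulKn.
suff h k : k <= 64 -> ev D' penv (pack_sum k) = num (2 ^ W) k yf by apply: h.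
elim: k => [|k IH] le; first by rewrite num0.
have ek : ev D' penv (U1 Pow (tnat k *t (C En /t tnat 64))) = 2 ^ (k * W).
  apply: ev_powsmall; last by rewrite -WD ltn_pmul2r.
  apply: ev_mulsmall e64 _; last by rewrite -WD ltn_pmul2r.
  by apply: ev_tnat; apply: ltD'; rewrite -WD; nia.
have lt : num (2 ^ W) k.+1 yf < 2 ^ 2 ^ D'.
  apply: leq_trans (num_lt _) _; first by move=> j lt; apply: yW; lia.
  by rewrite -expnM leq_exp2l // -WD mulnC leq_mul2r le orbT.
have E u w : ev D' penv (u +t w) = (ev D' penv u + ev D' penv w) %% 2 ^ 2 ^ D' by [].
have E2 u w : ev D' penv (u *t w) = (ev D' penv u * ev D' penv w) %% 2 ^ 2 ^ D' by [].
rewrite numSr -expnM [W * k]mulnC in lt *.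
by rewrite [pack_sum _]/= E E2 ek ev_pack_field // (IH (ltnW le)) modnDmr modn_small.
Qed.

Definition step_tm := tsub (fun j => if j == 0 then tpack else C Zero) (G D').

Lemma ev_step_tm : (ev D' penv step_tm == 0) =
  [exists x : 'I_U, (ev D (env k1 x) t1 == 0) ==> (ev D (env k2 x) t2 == 0)].
Proof.
have -> : ev D' penv step_tm = ev D' [:: num (2 ^ W) 64 yf] (G D').
  by apply: ev_tsub => -[|[|j]]; [exact: ev_tpack|by []|by []].
have yl : num (2 ^ W) 64 yf < 2 ^ 2 ^ D' by rewrite -ev_tpack; apply: ev_lt; exact: penv_bounded.
have hlt j : j < 64 -> yf j < 2 ^ (be %/ 4) by rewrite be4; apply: yf_lt.
have S := Funiv_spec n64 level_be lam_be hlt erefl erefl erefl erefl erefl erefl srow_le.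
have Gs := G_spec iK yl.
apply/eqP/existsP => [/Gs/S[v [hv _ /(srows_holds (hv 6 isT)) h]]|[x hx]].
  by have [x lx hx] := step_sound hv h; exists (Ordinal lx).
apply/Gs/S; have [v [hv hb h]] := step_complete (ltn_ord x) yf_lt hx.
by exists v; split=> //; [rewrite be4|apply/srows_holds; rewrite ?hv].
Qed.

End Input.
End Step.

(** [t1] and [t2] occur only inside the advice, so the depth bound is restored at each step. Having
    an implication under the quantifier lets the same step deal with Boolean connectives. *)
Theorem decided_step i a P1 P2 : i < K -> a <= 39 ->
  decided i a.+1 P1 -> decided i a.+1 P2 ->
  decided i.+1 a (fun rho => [exists x : 'I_U, P1 (val x :: rho) ==> P2 (val x :: rho)]).
Proof.
move=> iK a39 [k1 [t1 [hk1 ht1 h1]]] [k2 [t2 [hk2 ht2 h2]]].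
exists (kappa i k1 k2 t1 t2), (step_tm i); split.
- apply: (@kappa_lt i a) => //.
- have hs j : tdepth (if j == 0 then tpack else C Zero) <= tdepth tpack by case: ifP.
  by apply: leq_trans (tdepth_tsub (G (level i.+1)) hs) _; rewrite leq_add2r depth_G.
move=> rho srho hrho; rewrite (ev_step_tm iK a39 hk1 hk2 ht1 ht2 srho hrho).
apply: eq_existsb => x; have bx : bounded U (val x :: rho) by rewrite /bounded /= ltn_ord.
have sx : size (val x :: rho) = a.+1 by rewrite /= srho.
by rewrite -(h1 _ sx bx) -(h2 _ sx bx).
Qed.

End Collapse.

(** * Bounded formulas over the small structure *)

(** [ImpEx p q] means that some [x] satisfies [p -> q]. Together with renaming it yields all
    connectives and quantifiers, a dummy [x] serving for the connectives, and it is the only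
    constructor that raises the level. *)
Inductive form :=
| Atom of tm
| Orc
| ImpEx of form & form
| Ren of seq nat & form.

(* [sO] is an oracle of arity 4; the constants [scs] are available to all atoms. *)
Record setting := Setting { sd : nat; scs : seq nat; sO : seq nat -> bool }.
Definition sU S := 2 ^ 2 ^ sd S.

Fixpoint sem S phi (rho : seq nat) : bool := match phi with
  | Atom t => ev (sd S) (scs S ++ rho) t == 0
  | Orc => sO S rho
  | ImpEx p q => [exists x : 'I_(sU S), sem S p (val x :: rho) ==> sem S q (val x :: rho)]
  | Ren s p => sem S p [seq nth 0 rho i | i <- s] end.

(** The bounds 38 and 39 keep all arguments, the quantified one included, within the 64 fields of
    [y]. *)
Fixpoint wf a phi := match phi with
  | Atom _ => true
  | Orc => a == 4
  | ImpEx p q => [&& a <= 38, wf a.+1 p & wf a.+1 q]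
  | Ren s p => (size s <= 39) && wf (size s) p end.

Fixpoint rk phi := match phi with
  | Atom _ | Orc => 0
  | ImpEx p q => (maxn (rk p) (rk q)).+1
  | Ren _ p => rk p end.

Fixpoint adepth phi := match phi with
  | Atom t => tdepth t
  | Orc => 0
  | ImpEx p q => maxn (adepth p) (adepth q)
  | Ren _ p => adepth p end.

Section CollapseForm.
Variables (G : nat -> tm) (d nu t K : nat) (cs : seq nat).
Hypothesis d6 : 6 <= d.
Hypothesis nu_d : 3 * nu + 6 <= d.
Hypothesis nu6 : 6 <= nu.
Hypothesis size_cs : size cs = 12.
Hypothesis cs_lt : bounded (2 ^ 2 ^ d) cs.
Hypothesis cs0 : nth 0 cs 0 = 2 ^ nu.
Hypothesis kbitsK : kbits nu K <= 2 ^ d.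
Hypothesis depth_G : forall i, i < K -> tdepth (G (level d nu i.+1)) <= t.
Hypothesis G_spec : forall i y, i < K -> y < 2 ^ 2 ^ level d nu i.+1 ->
  ev (level d nu i.+1) [:: y] (G (level d nu i.+1)) = 0 <->
  exists2 x, x < 2 ^ 2 ^ level d nu i.+1 & ev (level d nu i.+1) [:: x; y] Funiv = 0.
Hypothesis n_big : forall i, i < K ->
  100 + 2 * level d nu i + 2 ^ (T0 t).+2 * loc_size (level d nu i) <= 2 ^ nu.
Let dec := decided d nu t cs.
Let U := 2 ^ 2 ^ d.
Let U0 : 0 < U. Proof. by rewrite expn_gt0. Qed.

Lemma decided_ext i a P Q : (forall rho, size rho = a -> bounded U rho -> P rho = Q rho) ->
  dec i a P -> dec i a Q.
Proof.
move=> e [k [u [h1 h2 h3]]]; exists k, u; split=> // rho s b.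
by rewrite -e // h3.
Qed.

Lemma decided_ren i a s P : dec i (size s) P -> dec i a (fun rho => P [seq nth 0 rho j | j <- s]).
Proof.
move=> [k [u [h1 h2 h3]]].
pose f j := if j <= 12 then V j else if j - 13 < size s then V (13 + nth 0 s (j - 13)) else C Zero.
exists k, (tsub f u); split=> //.
  have hf j : tdepth (f j) <= 0 by rewrite /f; case: ifP => // _; case: ifP.
  by apply: leq_trans (tdepth_tsub u hf) _; rewrite addn0.
move=> rho sz b; rewrite -h3 ?size_map //; last first.
  by apply/allP => x /mapP[j _ ->]; apply: bounded_nth.
congr (_ == _); apply: ev_tsub => j; rewrite /f.
case: j => [|j] //=; case: ltnP => [lt|ge] /=; first by rewrite !nth_cat size_cs lt.
rewrite subSS [in RHS]nth_cat size_cs (ltnNge j 12) ge /=.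
case: ltnP => [lt|ge'] /=; last by rewrite nth_default ?size_map.
by rewrite (nth_map 0) // nth_cat size_cs ltnNge leq_addr /= addKn.
Qed.

Lemma decided_true i a : dec i a (fun=> true).
Proof. by exists 0, (C Zero); split=> //; rewrite expn_gt0. Qed.

Lemma behead_iota a (rho : seq nat) : size rho = a.+1 ->
  [seq nth 0 rho j | j <- iota 1 a] = behead rho.
Proof.
case: rho => // x rho [<-]; rewrite -[RHS](mkseq_nth 0) /mkseq.
by rewrite -(addn0 1) iotaDl -map_comp.
Qed.

(** A dummy quantifier raises the level, which brings formulas of different rank to a common level
    before they are joined. *)
Lemma decided_S i a P : i < K -> a <= 39 -> dec i a P -> dec i.+1 a P.
Proof.
move=> iK a39 h; pose s := iota 1 a.
have h' : dec i a.+1 (fun rho => P [seq nth 0 rho j | j <- s]).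
  by apply: decided_ren; rewrite size_iota.
have := decided_step d6 nu_d nu6 size_cs cs_lt cs0 kbitsK depth_G G_spec n_big iK a39
  (decided_true i a.+1) h'.
apply: decided_ext => rho sr b; apply/existsP/idP => [[x /=]|hP].
  by rewrite behead_iota //= sr.
by exists (Ordinal U0); rewrite /= behead_iota //= sr.
Qed.

Lemma decided_le i j a P : i <= j -> j <= K -> a <= 39 -> dec i a P -> dec j a P.
Proof.
move=> le; rewrite -(subnK le); elim: (j - i) => // m IH hK a39 h.
by apply: decided_S => //; apply: IH => //; apply: ltnW.
Qed.

Variable O : seq nat -> bool.
Let S := Setting d cs O.

(** The oracle may itself have been decided at some level [i], and only the rank of [phi] is then
    added: this is how the result of one stage enters the next. *)
Theorem collapse phi a i : dec i 4 O -> wf a phi -> a <= 39 -> adepth phi <= T0 t ->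
  i + rk phi <= K -> dec (i + rk phi) a (sem S phi).
Proof.
move=> hO; elim: phi a => [u|| p IHp q IHq|s p IH] a /=.
- move=> _ a39 hd hi; apply: (@decided_le 0) => //.
  exists 0, (tsub (fun j => V j.+1) u); split=> //.
    by apply: leq_trans (tdepth_tsub (m := 0) u _) _; rewrite ?addn0.
  move=> rho sr b; rewrite /level mul0n addn0; congr (_ == _).
  by apply: ev_tsub => j.
- by move=> /eqP-> _ _; rewrite addn0.
- case/and3P=> a39' w1 w2 a39; rewrite geq_max => /andP[d1 d2] hK.
  set m := maxn _ _ in hK *; rewrite addnS in hK *.
  have lift r : rk r <= m -> dec (i + rk r) a.+1 (sem S r) -> dec (i + m) a.+1 (sem S r).
    by move=> le; apply: decided_le; [rewrite leq_add2l|exact: ltnW|].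
  have lp : rk p <= m by apply: leq_maxl.
  have lq : rk q <= m by apply: leq_maxr.
  have hp : dec (i + m) a.+1 (sem S p) by apply: lift => //; apply: IHp => //; lia.
  have hq : dec (i + m) a.+1 (sem S q) by apply: lift => //; apply: IHq => //; lia.
  exact: (decided_step d6 nu_d nu6 size_cs cs_lt cs0 kbitsK depth_G G_spec n_big hK a39 hp hq).
- by case/andP=> s39 w a39 hd hK; apply: decided_ren; apply: IH.
Qed.
End CollapseForm.

(** * Uniformly definable predicates and functions *)

Definition sfw S := nth 0 (scs S) 1.
Definition srs S := nth 0 (scs S) 2.

Definition sN S := nth 0 (scs S) 3.
Definition sD S := nth 0 (scs S) 4.
Definition sw S := nth 0 (scs S) 5.
Definition sM S := nth 0 (scs S) 6.
Definition sr S := nth 0 (scs S) 7.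
Definition sF S := nth 0 (scs S) 8.
Definition sT S := nth 0 (scs S) 9.
Definition sJ S := nth 0 (scs S) 10.
Definition sg S := nth 0 (scs S) 11.

(* [sD] and [sN] are the exponent and the word size of the large structure that is simulated;
   the remaining constants are the parameters of the Chinese remainder division. *)
Definition params S := exists e v, [/\ 20 <= e, v <= e, sd S = 16 * e, sfw S = 2 ^ (15 * e - 1) &
  srs S = 2 ^ e] /\ [/\ sN S = 2 ^ (16 * e + v), sD S = 16 * e + v, sw S = 2 ^ (15 * e - 3),
  sM S = 2 ^ (e + v + 5) & sr S = 2 ^ (e + v + 8)] /\
  [/\ sF S = (sJ S)`!, sT S = 4 * sN S, sJ S = sr S * sM S & sg S = 2 ^ (15 * e - 4)].

(** A word of the small structure holds [srs + 1] states of [sfw] bits each. Loops will run for up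
    to [srs^20] steps, and [srs^21 < sU] keeps their indices from wrapping around. *)
Definition okS S := [/\ 7 <= sd S /\ params S, size (scs S) = 12, bounded (sU S) (scs S),
  (srs S).+1 * sfw S <= 2 ^ sd S & (0 < sfw S) && (1 < srs S) && (srs S ^ 21 < sU S)].

Definition pred_t := setting -> seq nat -> bool.
Definition fun_t := setting -> seq nat -> nat.

(** A single formula for all settings: its rank does not depend on [d], and so neither does the
    number of levels that its elimination takes. *)
Definition UDef a (P : pred_t) := exists2 phi, wf a phi &
  forall S, okS S -> forall rho, size rho = a -> bounded (sU S) rho -> sem S phi rho = P S rho.

Lemma sU_gt0 S : 0 < sU S. Proof. by rewrite expn_gt0. Qed.

Lemma UDef_ext a P Q : (forall S, okS S -> forall rho, size rho = a -> bounded (sU S) rho ->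
  P S rho = Q S rho) -> UDef a P -> UDef a Q.
Proof. by move=> e [phi w h]; exists phi => // S ok rho sr b; rewrite h // e. Qed.

Lemma UDef_atom a t : UDef a (fun S rho => ev (sd S) (scs S ++ rho) t == 0).
Proof. by exists (Atom t). Qed.

Lemma UDef_orc : UDef 4 (fun S rho => sO S rho).
Proof. by exists Orc. Qed.

Lemma UDef_impex a P Q : a <= 38 -> UDef a.+1 P -> UDef a.+1 Q ->
  UDef a (fun S rho => [exists x : 'I_(sU S), P S (val x :: rho) ==> Q S (val x :: rho)]).
Proof.
move=> le [p wp hp] [q wq hq]; exists (ImpEx p q); first by rewrite /= le wp.
move=> S ok rho sr b /=; apply: eq_existsb => x.
have bx : bounded (sU S) (val x :: rho) by rewrite /bounded /= ltn_ord.
by rewrite hp ?hq //= sr.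
Qed.

Lemma UDef_ren a s P : size s <= 39 -> UDef (size s) P ->
  UDef a (fun S rho => P S [seq nth 0 rho i | i <- s]).
Proof.
move=> le [p wp hp]; exists (Ren s p); first by rewrite /= le.
move=> S ok rho sr b /=; rewrite hp ?size_map //.
by apply/allP => x /mapP[j _ ->]; apply: bounded_nth => //; exact: sU_gt0.
Qed.

Lemma UDef_const a b : UDef a (fun _ _ => b).
Proof. by exists (Atom (if b then C Zero else C One)) => // S _ rho _ _; case: b. Qed.

Lemma map_nth_iota (rho : seq nat) m k : m + k <= size rho ->
  [seq nth 0 rho j | j <- iota m k] = take k (drop m rho).
Proof.
move=> le; apply: (@eq_from_nth _ 0).
  by rewrite size_map size_iota size_take_min size_drop; lia.
rewrite size_map size_iota => i lt.
by rewrite (nth_map 0) ?size_iota // nth_iota // nth_take // nth_drop.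
Qed.

Lemma UDef_drop m a P : a <= 39 -> UDef a P -> UDef (m + a) (fun S rho => P S (drop m rho)).
Proof.
move=> le h; apply: (@UDef_ext _ (fun S rho => P S [seq nth 0 rho i | i <- iota m a])).
  by move=> S ok rho sr _; rewrite map_nth_iota ?sr // take_oversize // size_drop sr; lia.
by apply: UDef_ren; rewrite size_iota.
Qed.

Lemma UDef_imp a P Q : a <= 38 -> UDef a P -> UDef a Q ->
  UDef a (fun S rho => P S rho ==> Q S rho).
Proof.
move=> le hP hQ; have := UDef_impex le (UDef_drop 1 (leqW le) hP) (UDef_drop 1 (leqW le) hQ).
apply: UDef_ext => S ok rho sr b /=; rewrite drop0; apply/existsP/idP => [[]//|h].
by exists (Ordinal (sU_gt0 S)).
Qed.

Lemma UDef_not a P : a <= 38 -> UDef a P -> UDef a (fun S rho => ~~ P S rho).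
Proof.
move=> le h; have := UDef_imp le h (UDef_const a false).
by apply: UDef_ext => S ok rho _ _; rewrite implybF.
Qed.

Lemma UDef_and a P Q : a <= 38 -> UDef a P -> UDef a Q ->
  UDef a (fun S rho => P S rho && Q S rho).
Proof.
move=> le hP hQ; have := UDef_not le (UDef_imp le hP (UDef_not le hQ)).
by apply: UDef_ext => S ok rho _ _; case: (P _ _); case: (Q _ _).
Qed.

Lemma UDef_or a P Q : a <= 38 -> UDef a P -> UDef a Q ->
  UDef a (fun S rho => P S rho || Q S rho).
Proof.
move=> le hP hQ; have := UDef_imp le (UDef_not le hP) hQ.
by apply: UDef_ext => S ok rho _ _; case: (P _ _); case: (Q _ _).
Qed.

Lemma UDef_ex a P : a <= 38 -> UDef a.+1 P ->
  UDef a (fun S rho => [exists x : 'I_(sU S), P S (val x :: rho)]).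
Proof. by move=> le h; apply: UDef_ext (UDef_impex le (UDef_const _ true) h). Qed.

Lemma UDef_all a P : a <= 37 -> UDef a.+1 P ->
  UDef a (fun S rho => [forall x : 'I_(sU S), P S (val x :: rho)]).
Proof.
move=> le h; have := UDef_not (leqW le) (UDef_ex (leqW le) (UDef_not (le : a.+1 <= 38) h)).
by apply: UDef_ext => S ok rho _ _; rewrite negb_exists; apply: eq_forallb => x; rewrite negbK.
Qed.

(** The graph is definable and the small structure is closed under the function, so a value can be
    introduced by an existential quantifier. *)
Definition UDefF a (f : fun_t) :=
  (forall S, okS S -> forall rho, size rho = a -> bounded (sU S) rho -> f S rho < sU S) /\
  UDef a.+1 (fun S rho => head 0 rho == f S (behead rho)).

Lemma UDefF_ext a f g : (forall S, okS S -> forall rho, size rho = a -> bounded (sU S) rho ->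
  f S rho = g S rho) -> UDefF a f -> UDefF a g.
Proof.
move=> e [h1 h2]; split=> [S ok rho sr b|]; first by rewrite -e // h1.
apply: UDef_ext h2 => S ok [|x rho] //= [sr] /andP[_ b]; by rewrite e.
Qed.

Lemma UDefF_tm a t : UDefF a (fun S rho => ev (sd S) (scs S ++ rho) t).
Proof.
have bnd S rho : okS S -> bounded (sU S) rho -> bounded (sU S) (scs S ++ rho).
  by case=> _ _ h _ _ h'; rewrite /bounded all_cat; apply/andP.
split=> [S ok rho sr b|]; first by apply: ev_lt; apply: bnd.
apply: UDef_ext (UDef_atom _ (tdiff (V 12) (tsub (fun j => if j < 12 then V j else V j.+1) t))).
move=> S ok [|x rho] // [sr] b; have [_ cs12 _ _ _] := ok.
rewrite ev_tdiff ?bnd //; congr (_ == _); first by rewrite /= nth_cat cs12.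
apply: ev_tsub => j; case: ltnP => [lt|ge] /=; first by rewrite !nth_cat cs12 lt.
by rewrite !nth_cat cs12 (ltnNge j 12) (ltnNge j.+1 12) ge leqW //= subSn.
Qed.

Lemma UDefF_drop m a f : a <= 38 -> UDefF a f -> UDefF (m + a) (fun S rho => f S (drop m rho)).
Proof.
move=> le [h1 h2]; split=> [S ok rho sr b|].
  apply: h1 => //; first by rewrite size_drop sr addKn.
  by apply/allP => x /mem_drop; apply: (allP b).
pose s := 0 :: iota m.+1 a.
have hs := @UDef_ren (m + a).+1 s (fun S rho => head 0 rho == f S (behead rho)).
rewrite /= size_iota in hs; have {}hs := hs le h2.
apply: UDef_ext hs => S ok [|x rho] // [sr] b; rewrite /= -[m.+1]addn1 addnC iotaDl -map_comp.
rewrite (eq_map (_ : _ =1 nth 0 rho)) // map_nth_iota ?sr // take_oversize // size_drop sr; lia.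
Qed.

Lemma UDef_let a f P : a <= 36 -> UDefF a f -> UDef a.+1 P ->
  UDef a (fun S rho => P S (f S rho :: rho)).
Proof.
move=> le [h1 h2] hP; have le' : a <= 38 by lia.
have le2 : a.+1 <= 38 by lia.
apply: UDef_ext (UDef_ex le' (UDef_and le2 h2 hP)).
move=> S ok rho sr b /=; apply/existsP/idP => [[x /andP[/eqP<-]]//|h].
by exists (Ordinal (h1 S ok rho sr b)); rewrite /= eqxx.
Qed.

Fixpoint allU a (fs : seq fun_t) :=
  if fs is f :: fs' then UDefF a f /\ allU a fs' else True.

Lemma UDef_lets fs a Q : size fs + a <= 36 -> allU a fs -> UDef (size fs + a) Q ->
  UDef a (fun S rho => Q S ([seq f S rho | f <- fs] ++ rho)).
Proof.
elim: fs Q => [|f fs IH] Q /= le; first by move=> _; apply: UDef_ext.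
case=> hf hfs hQ.
have hf' : UDefF (size fs + a) (fun S rho => f S (drop (size fs) rho)) by apply: UDefF_drop => //; lia.
have le1 : size fs + a <= 36 by lia.
apply: UDef_ext (IH _ le1 hfs (UDef_let le1 hf' hQ)).
by move=> S ok rho sr b; rewrite drop_size_cat ?size_map.
Qed.

Lemma UDef_comp fs a P : size fs + a <= 36 -> allU a fs -> UDef (size fs) P ->
  UDef a (fun S rho => P S [seq f S rho | f <- fs]).
Proof.
move=> le hfs hP; pose s := iota 0 (size fs).
have h : UDef (size fs + a) (fun S rho => P S [seq nth 0 rho i | i <- s]).
  by apply: UDef_ren; rewrite size_iota //; lia.
have := UDef_lets le hfs h; apply: UDef_ext => S ok rho sr b; congr (P S _).
by rewrite map_nth_iota ?drop0 ?take_size_cat ?size_cat ?size_map ?leq_addr.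
Qed.

Lemma allU_drop1 a fs : a <= 38 -> allU a fs ->
  allU a.+1 [seq (fun S rho => (f : fun_t) S (behead rho)) | f <- fs].
Proof.
move=> le; elim: fs => //= f fs IH [h /IH hs]; split=> //.
by have := UDefF_drop 1 le h; apply: UDefF_ext => S ok rho _ _; rewrite drop1.
Qed.

Lemma UDefF_head a : UDefF a.+1 (fun S rho => head 0 rho).
Proof.
have := UDefF_tm a.+1 (V 12); apply: UDefF_ext => S [_ cs12 _ _ _] [|x rho] // _ _.
by rewrite /= nth_cat cs12.
Qed.

Lemma UDefF_comp fs a h : size fs + a <= 34 -> allU a fs -> UDefF (size fs) h ->
  UDefF a (fun S rho => h S [seq f S rho | f <- fs]).
Proof.
move=> le hfs [h1 h2]; have bnd S rho : okS S -> size rho = a -> bounded (sU S) rho ->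
    bounded (sU S) [seq f S rho | f <- fs].
  move=> ok sr b; elim: fs hfs {le h1 h2} => //= f fs IH [[hf _] hfs].
  by apply/andP; split; [apply: hf|apply: IH].
split=> [S ok rho sr b|]; first by apply: h1 => //; rewrite ?size_map //; apply: bnd.
pose gs := (fun S rho => head 0 rho) :: [seq (fun S rho => (f : fun_t) S (behead rho)) | f <- fs].
have := @UDef_comp gs a.+1 (fun S rho => head 0 rho == h S (behead rho)).
rewrite /= size_map => H; apply: UDef_ext (H _ _ h2) => //; last 2 first.
- by lia.
- by split; [exact: UDefF_head|apply: allU_drop1 => //; lia].
by move=> S ok rho _ _ /=; rewrite -map_comp.
Qed.

(** * Definable arithmetic on elements of the small structure *)

Section Operations.
Variables (a : nat) (f g : fun_t).
Hypotheses (a30 : a <= 30) (hf : UDefF a f) (hg : UDefF a g).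
Let fs := [:: f; g].
Let hfs : allU a fs. Proof. by []. Qed.
Let le2 : size fs + a <= 34. Proof. by rewrite /=; lia. Qed.
Let le2' : size fs + a <= 36. Proof. by rewrite /=; lia. Qed.

Lemma UDefF_op2 (t : tm) (h : setting -> nat -> nat -> nat) :
  (forall S x y, okS S -> x < sU S -> y < sU S ->
     ev (sd S) (scs S ++ [:: x; y]) t = h S x y) ->
  UDefF a (fun S rho => h S (f S rho) (g S rho)).
Proof.
move=> e; apply: UDefF_ext (UDefF_comp le2 hfs (UDefF_tm _ t)) => S ok rho sr b /=.
by apply: e => //; [case: hf => h1 _; apply: h1|case: hg => h1 _; apply: h1].
Qed.

Lemma UDef_op2 (t : tm) (h : setting -> nat -> nat -> bool) :
  (forall S x y, okS S -> x < sU S -> y < sU S ->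
     (ev (sd S) (scs S ++ [:: x; y]) t == 0) = h S x y) ->
  UDef a (fun S rho => h S (f S rho) (g S rho)).
Proof.
move=> e; apply: UDef_ext (UDef_comp le2' hfs (UDef_atom _ t)) => S ok rho sr b /=.
by apply: e => //; [case: hf => h1 _; apply: h1|case: hg => h1 _; apply: h1].
Qed.

Let var0 S x y : okS S -> nth 0 (scs S ++ [:: x; y]) 12 = x.
Proof. by case=> _ cs12 _ _ _; rewrite nth_cat cs12. Qed.
Let var1 S x y : okS S -> nth 0 (scs S ++ [:: x; y]) 13 = y.
Proof. by case=> _ cs12 _ _ _; rewrite nth_cat cs12. Qed.
Let bnd S x y : okS S -> x < sU S -> y < sU S -> bounded (sU S) (scs S ++ [:: x; y]).
Proof. by case=> _ _ b _ _ hx hy; rewrite /bounded all_cat /= hx hy !andbT. Qed.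

Lemma UDefF_add : UDefF a (fun S rho => (f S rho + g S rho) %% sU S).
Proof.
apply: (@UDefF_op2 (V 12 +t V 13) (fun S x y => (x + y) %% sU S)) => S x y ok hx hy.
by rewrite /= var0 ?var1.
Qed.

Lemma UDefF_mul : UDefF a (fun S rho => (f S rho * g S rho) %% sU S).
Proof.
apply: (@UDefF_op2 (V 12 *t V 13) (fun S x y => (x * y) %% sU S)) => S x y ok hx hy.
by rewrite /= var0 ?var1.
Qed.

Lemma UDefF_div : UDefF a (fun S rho => f S rho %/ g S rho).
Proof.
apply: (@UDefF_op2 (V 12 /t V 13) (fun S x y => x %/ y)) => S x y ok hx hy.
by rewrite /= var0 ?var1.
Qed.

Lemma UDefF_mod : UDefF a (fun S rho => f S rho %% g S rho).
Proof.
apply: (@UDefF_op2 (V 12 %t V 13) (fun S x y => x %% y)) => S x y ok hx hy.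
by rewrite ev_tmod ?bnd //= var0 ?var1.
Qed.

Lemma UDefF_sub : UDefF a (fun S rho => f S rho - g S rho).
Proof.
apply: (@UDefF_op2 (B2 Max (V 12) (V 13) -t V 13) (fun S x y => x - y)) => S x y ok hx hy.
by rewrite ev_tsubt ?bnd //= ?var0 ?var1 ?leq_maxr //; lia.
Qed.

Lemma UDefF_min : UDefF a (fun S rho => minn (f S rho) (g S rho)).
Proof.
apply: (@UDefF_op2 (B2 Min (V 12) (V 13)) (fun S x y => minn x y)) => S x y ok hx hy.
by rewrite /= var0 ?var1.
Qed.

Lemma UDefF_pow : UDefF a (fun S rho => minn (2 ^ f S rho) (sU S - 1)).
Proof.
apply: (@UDefF_op2 (U1 Pow (V 12)) (fun S x y => minn (2 ^ x) (sU S - 1))) => S x y ok hx hy.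
by rewrite /= var0.
Qed.

Lemma UDef_eq : UDef a (fun S rho => f S rho == g S rho).
Proof.
apply: (@UDef_op2 (tdiff (V 12) (V 13)) (fun S x y => x == y)) => S x y ok hx hy.
by rewrite ev_tdiff ?bnd //= var0 ?var1.
Qed.

Lemma UDef_leq : UDef a (fun S rho => f S rho <= g S rho).
Proof.
apply: (@UDef_op2 (B2 Max (V 12) (V 13) -t V 13) (fun S x y => x <= y)) => S x y ok hx hy.
by rewrite ev_tsubt ?bnd //= ?var0 ?var1 ?leq_maxr //; lia.
Qed.

Lemma UDef_lt : UDef a (fun S rho => f S rho < g S rho).
Proof.
apply: (@UDef_op2 (C One -t (B2 Min (C One) (B2 Max (V 12) (V 13) -t V 12))) (fun S x y => x < y)) => S x y ok hx hy.
have E : ev (sd S) (scs S ++ [:: x; y]) (B2 Max (V 12) (V 13) -t V 12) = maxn x y - x.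
  by rewrite ev_tsubt ?bnd //= ?var0 ?var1 ?leq_maxl.
have E2 : ev (sd S) (scs S ++ [:: x; y]) (B2 Min (C One) (B2 Max (V 12) (V 13) -t V 12))
    = minn 1 (maxn x y - x) by rewrite -E.
by rewrite ev_tsubt ?bnd // E2 /=; lia.
Qed.

End Operations.

Lemma UDefF_var a j : UDefF a (fun S rho => nth 0 rho j).
Proof.
apply: UDefF_ext (UDefF_tm a (V (12 + j))) => S [_ cs12 _ _ _] rho _ _ /=.
by rewrite nth_cat cs12 ltnNge leq_addr /= addKn.
Qed.

Lemma UDefF_cs a j : j < 12 -> UDefF a (fun S rho => nth 0 (scs S) j).
Proof.
move=> lt; apply: UDefF_ext (UDefF_tm a (V j)) => S [_ cs12 _ _ _] rho _ _ /=.
by rewrite nth_cat cs12 lt.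
Qed.

Lemma okS_U100 S : okS S -> 100 < sU S.
Proof.
case=> [[d7 _] _ _ _ _]; apply: (@leq_trans (2 ^ 7)) => //; rewrite leq_exp2l //.
by apply: leq_trans (ltnW (ltn_expl 7 (isT : 1 < 2))) _; rewrite leq_exp2l.
Qed.

Lemma UDefF_nat a k : k <= 100 -> UDefF a (fun S rho => k).
Proof.
move=> le; apply: UDefF_ext (UDefF_tm a (tnat k)) => S ok rho _ b.
apply: ev_tnat; last exact: leq_ltn_trans le (okS_U100 ok).
Qed.

Lemma UDefF_width a : UDefF a (fun S rho => 2 ^ sd S).
Proof. by apply: UDefF_ext (UDefF_tm a (C En)). Qed.

Lemma UDefF_graph a f R : UDef a.+1 R ->
  (forall S, okS S -> forall rho, size rho = a -> bounded (sU S) rho ->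
    f S rho < sU S /\ forall z, z < sU S -> R S (z :: rho) = (z == f S rho)) -> UDefF a f.
Proof.
move=> hR h; split=> [S ok rho sr b|]; first by case: (h S ok rho sr b).
apply: UDef_ext hR => S ok [|z rho] // [sr] /andP[hz b].
by case: (h S ok rho sr b) => _ ->.
Qed.

Lemma UDefF_if a b f g : a <= 30 -> UDef a b -> UDefF a f -> UDefF a g ->
  UDefF a (fun S rho => if b S rho then f S rho else g S rho).
Proof.
move=> le hb hf hg; have le1 : a.+1 <= 38 by lia.
have hb' : UDef a.+1 (fun S rho => b S (drop 1 rho)) by apply: (UDef_drop 1) => //; lia.
apply: (@UDefF_graph _ _ (fun S rho =>
  (b S (drop 1 rho) ==> (head 0 rho == f S (behead rho))) &&
  (~~ b S (drop 1 rho) ==> (head 0 rho == g S (behead rho))))).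
  apply: UDef_and => //; apply: UDef_imp => //; try exact: UDef_not.
    by case: hf.
  by case: hg.
move=> S ok rho sr bd; split=> [|z hz].
  by case: ifP => _; [case: hf => h _|case: hg => h _]; apply: h.
by rewrite /= drop0; case: (b S rho); rewrite /= ?andbT.
Qed.

Lemma UDefF_bool a b : a <= 30 -> UDef a b -> UDefF a (fun S rho => b S rho : nat).
Proof.
move=> le hb; have h1 : UDefF a (fun S rho => 1) by apply: UDefF_nat.
have h0 : UDefF a (fun S rho => 0) by apply: UDefF_nat.
by apply: UDefF_ext (UDefF_if le hb h1 h0) => S _ rho _ _; case: (b S rho).
Qed.

(** [Pow] saturates, so the position is first cut down to [2^sd - 1], where the power of 2 is exact;
    at larger positions every element has bit 0. *)
Lemma UDef_bit a f g : a <= 30 -> UDefF a f -> UDefF a g ->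
  UDef a (fun S rho => bit (f S rho) (g S rho)).
Proof.
move=> le hf hg.
have hm : UDef a (fun S rho => bit (f S rho) (minn (g S rho) (2 ^ sd S - 1))).
  have t1 : UDefF a (fun S rho => minn (g S rho) (2 ^ sd S - 1)).
    apply: UDefF_min => //; apply: UDefF_sub => //; first exact: UDefF_width.
    exact: UDefF_nat.
  have t2 : UDefF a (fun S rho => (f S rho %/ minn (2 ^ minn (g S rho) (2 ^ sd S - 1)) (sU S - 1)) %% 2).
    apply: UDefF_mod => //; last exact: UDefF_nat.
    apply: UDefF_div => //; exact: (UDefF_pow le t1 t1).
  apply: UDef_ext (UDef_eq le t2 (@UDefF_nat a 1 isT)) => S ok rho sr b.
  rewrite /bit modn2; set m := minn (g S rho) (_ - 1).
  have lt : m < 2 ^ sd S by rewrite /m; have := expn_gt0 2 (sd S); lia.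
  rewrite (minn_idPl _) ?eqb1 //; have : 2 ^ m < sU S by rewrite ltn_exp2l.
  by lia.
apply: UDef_ext (UDef_and _ (UDef_lt le hg (UDefF_width a)) hm) => [S ok rho sr b|]; last by lia.
case: ltnP => [lt|ge] /=; first by rewrite (minn_idPl _) //; lia.
by rewrite (@bit_out _ (2 ^ sd S)) //; case: hf => h _; apply: h.
Qed.

(** * Iteration with small states *)

Definition sSm S := 2 ^ sfw S.

Lemma iteri_ext T n (f g : nat -> T -> T) x :
  (forall j, j < n -> f j =1 g j) -> iteri n f x = iteri n g x.
Proof. by elim: n => //= n IH h; rewrite IH ?h // => j lt; apply: h; apply: ltnW. Qed.

Lemma iteriD T m n (f : nat -> T -> T) x :
  iteri (m + n) f x = iteri n (fun j => f (m + j)) (iteri m f x).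
Proof. by elim: n => [|n IH]; rewrite ?addn0 // addnS /= IH. Qed.

Lemma iteri_mul T m n (f : nat -> T -> T) x :
  iteri (m * n) f x = iteri m (fun k => iteri n (fun j => f (k * n + j))) x.
Proof. by elim: m => // m IH; rewrite mulSn addnC iteriD IH. Qed.

Lemma UDefF_comp2 m a f g h : m + a <= 33 -> UDefF (m + a) f -> UDefF (m + a) g ->
  UDefF a.+2 h -> UDefF (m + a) (fun S rho => h S (f S rho :: g S rho :: drop m rho)).
Proof.
move=> le hf hg [h1 h2]; split=> [S ok rho sr b|].
  apply: h1 => //; first by rewrite /= size_drop sr addKn.
  apply/and3P; split; [by case: hf => h' _; apply: h'|by case: hg => h' _; apply: h'|].
  by apply/allP => x /mem_drop; apply: (allP b).
pose fs := [:: fun S rho => f S (behead rho); fun S rho => g S (behead rho)].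
have le1 : m + a <= 38 by lia.
have hfs : allU (m + a).+1 fs := @allU_drop1 (m + a) [:: f; g] le1 (conj hf (conj hg I)).
pose s := 2 :: 0 :: 1 :: iota m.+3 a.
have hs := @UDef_ren (m + a).+3 s (fun S rho => head 0 rho == h S (behead rho)).
rewrite /= size_iota in hs; have l3 : a.+2 < 39 by lia.
have l4 : size fs + (m + a).+1 <= 36 by rewrite /=; lia.
have := UDef_lets l4 hfs (hs l3 h2); apply: UDef_ext => S ok [|x rho] // [sr] b.
rewrite /= -[m.+3]addn3 addnC iotaDl -map_comp (eq_map (_ : _ =1 nth 0 rho)) //.
have E : [seq nth 0 rho i | i <- iota m a] = drop m rho.
  by rewrite map_nth_iota ?take_oversize ?size_drop ?sr ?addKn.
by rewrite E.
Qed.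

Lemma sSm_pow S : okS S -> minn (2 ^ sfw S) (sU S - 1) = sSm S.
Proof.
case=> _ _ _ h1 /andP[/andP[fw0 rs1] _]; apply/minn_idPl.
have : 2 ^ sfw S < sU S by rewrite ltn_exp2l //; nia.
by rewrite /sSm; lia.
Qed.

Lemma UDefF_Sm b : b <= 30 -> UDefF b (fun S rho => sSm S).
Proof.
move=> le; have h : UDefF b (fun S rho => sfw S) by apply: UDefF_cs.
by apply: UDefF_ext (UDefF_pow le h h) => S ok rho _ _; apply: sSm_pow.
Qed.

Lemma UDefF_rspow b c : b <= 30 -> UDefF b (fun S rho => srs S ^ c %% sU S).
Proof.
move=> le; elim: c => [|c IH].
  apply: UDefF_ext (@UDefF_nat b 1 isT) => S ok rho _ _; rewrite modn_small //.
  exact: ltn_trans (okS_U100 ok).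
apply: UDefF_ext (UDefF_mul le (UDefF_cs b (isT : 2 < 12)) IH) => S ok rho _ _.
by rewrite modnMmr expnS.
Qed.

(* The [k]-th state recorded in the word [y]. *)
Definition fld S y k := (y %/ minn (2 ^ ((k * sfw S) %% sU S)) (sU S - 1)) %% sSm S.

Lemma fldE S y k : okS S -> k <= srs S -> fld S y k = (y %/ sSm S ^ k) %% sSm S.
Proof.
case=> _ _ _ h1 /andP[/andP[fw0 rs1] _] le; have lt : k * sfw S < 2 ^ sd S by nia.
rewrite /fld (modn_small (m := k * _)); last by apply: ltn_trans lt _; apply: ltn_expl.
rewrite (minn_idPl _); first by rewrite /sSm -expnM mulnC.
have : 2 ^ (k * sfw S) < sU S by rewrite ltn_exp2l. by lia.
Qed.

Lemma UDefF_fld b g h : b <= 30 -> UDefF b g -> UDefF b h ->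
  UDefF b (fun S rho => fld S (g S rho) (h S rho)).
Proof.
move=> le hg hh; apply: UDefF_mod => //; last exact: UDefF_Sm.
apply: UDefF_div => //; have := UDefF_mul le hh (UDefF_cs b (isT : 1 < 12)).
by move=> h1; exact: (UDefF_pow le h1 h1).
Qed.

Section Savitch.
Variables (a : nat) (f : fun_t).
Hypotheses (a20 : a <= 22) (hf : UDefF a.+2 f).

(* [block c] iterates [f] over [srs ^ c] consecutive indices; each level of the recursion guesses one
   word holding the [srs + 1] intermediate states, so [c] levels cost a bounded quantifier depth. *)
Fixpoint block c (S : setting) (j0 s : nat) rho := if c is c'.+1 then
    iteri (srs S) (fun k s => block c' S ((j0 + (k * (srs S ^ c' %% sU S)) %% sU S) %% sU S) s rho) (s %% sSm S)
  else f S (j0 :: s :: rho) %% sSm S.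

Lemma block_lt c S j0 s rho : block c S j0 s rho < sSm S.
Proof.
have Sm0 : 0 < sSm S by rewrite expn_gt0.
case: c => [|c] /=; first by rewrite ltn_mod.
elim: (srs S) => [|n] /=; first by rewrite ltn_mod.
by move=> _; elim: c {n} (iteri _ _ _) (_ %% sU S) => [|c IH] s' j /=; rewrite ?ltn_mod //;
  elim: (srs S) => [|m IHm] /=; rewrite ?ltn_mod.
Qed.

Lemma UDefF_block c : UDefF a.+2 (fun S rho =>
  block c S (nth 0 rho 0) (nth 0 rho 1) (drop 2 rho)).
Proof.
elim: c => [|c IH].
  apply: UDefF_ext (UDefF_mod _ hf (UDefF_Sm _)); try lia.
  by move=> S ok [|x [|y rho]] //= _ _; rewrite drop0.
pose var j := (fun S rho => nth 0 rho j) : fun_t.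
have hvar b j : UDefF b (var j) by apply: UDefF_var.
have l5 : a.+1.+4 <= 30 by lia.
have l4 : a.+4 <= 30 by lia.
have l38 : a.+1.+4 <= 38 by lia.
(* environment: k, y, z, j0, s, rho *)
pose nxt := (fun S rho => fld S (var 1 S rho) ((var 0 S rho + 1) %% sU S)) : fun_t.
pose cur := (fun S rho => fld S (var 1 S rho) (var 0 S rho)) : fun_t.
pose idx := (fun S rho => (var 3 S rho + (var 0 S rho * (srs S ^ c %% sU S)) %% sU S) %% sU S) : fun_t.
have hnxt : UDefF a.+1.+4 nxt.
  by apply: UDefF_fld => //; apply: UDefF_add => //; apply: UDefF_nat.
have hcur : UDefF a.+1.+4 cur by apply: UDefF_fld.
have hidx : UDefF a.+1.+4 idx.
  by apply: UDefF_add => //; apply: UDefF_mul => //; apply: UDefF_rspow.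
have hcomp : UDefF a.+1.+4 (fun S rho => block c S (idx S rho) (cur S rho) (drop 5 rho)).
  have l33 : 5 + a <= 33 by lia.
  have := UDefF_comp2 l33 hidx hcur IH; apply: UDefF_ext => S ok rho _ _ /=.
  by rewrite drop0.
have hall : UDef a.+4 (fun S rho => [forall k : 'I_(sU S), (val k < srs S) ==>
    (nxt S (val k :: rho) == block c S (idx S (val k :: rho)) (cur S (val k :: rho)) (drop 4 rho))]).
  have l37 : a.+4 <= 37 by lia.
  have hlt := UDef_lt l5 (hvar _ 0) (UDefF_cs _ (isT : 2 < 12)).
  exact: (UDef_all l37 (UDef_imp l38 hlt (UDef_eq l5 hnxt hcomp))).
have h0 : UDef a.+4 (fun S rho => fld S (nth 0 rho 0) 0 == nth 0 rho 3 %% sSm S).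
  apply: (UDef_eq l4); first by apply: UDefF_fld => //; [exact: hvar|exact: UDefF_nat].
  by apply: UDefF_mod => //; [exact: hvar|apply: UDefF_Sm].
have h1 : UDef a.+4 (fun S rho => fld S (nth 0 rho 0) (srs S) == nth 0 rho 1).
  apply: (UDef_eq l4); last exact: hvar.
  by apply: UDefF_fld => //; [exact: hvar|exact: UDefF_cs].
have l438 : a.+4 <= 38 by lia.
have l338 : a.+3 <= 38 by lia.
have hR := UDef_ex l338 (UDef_and l438 (UDef_and l438 h0 h1) hall).
apply: (UDefF_graph hR) => S ok [|j0 [|s rho]] //= [sr] bd; rewrite drop0.
have Sm0 : 0 < sSm S by rewrite expn_gt0.
have [_ _ _ hrs /andP[/andP[fw0 rs1] rsU]] := ok.
set st := fun k s => block c S ((j0 + (k * (srs S ^ c %% sU S)) %% sU S) %% sU S) s rho.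
have stl k s' : st k s' < sSm S by apply: block_lt.
have il k : iteri k st (s %% sSm S) < sSm S by case: k => [|k] /=; rewrite ?ltn_mod.
have SmU : sSm S ^ (srs S).+1 <= sU S by rewrite -expnM mulnC leq_exp2l.
have SmU' : sSm S <= sU S.
  by apply: leq_trans SmU; rewrite -{1}(expn1 (sSm S)) leq_exp2l // /sSm -{1}(expn0 2) ltn_exp2l.
have rslt : (srs S).+1 < sU S.
  by apply: leq_ltn_trans rsU; rewrite expnS; have := ltn_expl 20 rs1; nia.
split=> [|z hz]; first exact: leq_trans (il _) SmU'.
have simp z' y k : k < srs S -> nxt S [:: k, y, z', j0, s & rho] = fld S y k.+1.
  by move=> lt; rewrite /nxt /var /= addn1 modn_small //; apply: ltn_trans rslt.
apply/existsP/eqP => [[y /andP[/andP[/eqP e0 /eqP e1] /forallP h]]|->].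
  have hk k : k <= srs S -> fld S y k = iteri k st (s %% sSm S).
    elim: k => [|k IHk] le; first exact: e0.
    have kU : k < sU S by apply: leq_trans (ltnW rslt); rewrite ltnS ltnW.
    have /implyP/(_ le)/eqP := h (Ordinal kU); rewrite /= simp // => ->.
    by rewrite /cur /idx /var /= (IHk (ltnW le)).
  by rewrite -hk.
pose y := num (sSm S) (srs S).+1 (fun k => iteri k st (s %% sSm S)).
have yU : y < sU S by apply: leq_trans (num_lt _) SmU.
have fy k : k <= srs S -> fld S y k = iteri k st (s %% sSm S).
  by move=> le; rewrite fldE // num_dig.
exists (Ordinal yU); rewrite /= !fy //= !eqxx /=; apply/forallP => k; apply/implyP => lt.
by rewrite simp // fy // /cur /idx /var /= fy ?drop0 //; exact: ltnW.
Qed.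

(** The reductions modulo [sU] in [block] have no effect, as all indices stay below [srs^20 < sU];
    what remains is that [srs] runs of [srs^c] steps make one run of [srs^(c + 1)] steps. *)
Lemma blockE c S j0 s rho : okS S -> j0 + srs S ^ c <= srs S ^ 20 -> c <= 20 -> s < sSm S ->
  block c S j0 s rho = iteri (srs S ^ c) (fun j s => f S (j0 + j :: s :: rho) %% sSm S) s.
Proof.
move=> ok; have [_ _ _ hrs /andP[/andP[fw0 rs1] rsU]] := ok.
have Sm0 : 0 < sSm S by rewrite expn_gt0.
have U20 : srs S ^ 20 < sU S by apply: leq_ltn_trans rsU; rewrite leq_exp2l.
elim: c j0 s => [|c IH] j0 s le lec ls; first by rewrite /= addn0.
rewrite [block _ _ _ _ _]/= (modn_small ls) (expnS (srs S) c) iteri_mul.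
have inv k : iteri k (fun k => iteri (srs S ^ c) (fun j s =>
    f S (j0 + (k * srs S ^ c + j) :: s :: rho) %% sSm S)) s < sSm S.
  elim: k => [//|k IHk] /=; move: (iteri k _ _) IHk => s1.
  by case: (srs S ^ c) => [//|m] _ /=; rewrite ltn_mod.
suff H m : m <= srs S -> iteri m (fun k s => block c S ((j0 + (k * (srs S ^ c %% sU S)) %% sU S) %% sU S) s rho) s =
    iteri m (fun k => iteri (srs S ^ c) (fun j s => f S (j0 + (k * srs S ^ c + j) :: s :: rho) %% sSm S)) s.
  exact: H.
elim: m => [//|k IHk] lek; rewrite [LHS]/= IHk; last exact: ltnW.
have lk : k.+1 * srs S ^ c <= srs S ^ c.+1 by rewrite expnS leq_mul2r lek orbT.
rewrite mulSn in lk; have c20 : srs S ^ c <= srs S ^ 20 by rewrite leq_exp2l //; lia.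
have hW : j0 + k * srs S ^ c + srs S ^ c <= srs S ^ 20.
  by move: (srs S ^ 20) le => W; lia.
move: (srs S ^ 20) le c20 U20 hW IH => W le c20 U20 hW IH.
rewrite (modn_small (leq_ltn_trans c20 U20)) (modn_small (m := k * _)); last by lia.
rewrite modn_small; last by lia.
rewrite (IH _ _ hW (ltnW lec)) //.
by rewrite [RHS]/=; apply: iteri_ext => j _ s'; rewrite addnA.
Qed.

End Savitch.

(** Capping the length and reducing the states makes this definable for arbitrary arguments;
    [SF_iter] gives conditions under which neither changes anything. *)
Definition loop S L (f : nat -> nat -> nat) s0 :=
  iteri (minn L (srs S ^ 20)) (fun j s => f j s %% sSm S) (s0 %% sSm S).

(** A block of 20 levels always makes [srs^20] steps; from step [L] on, [g] leaves the state
    unchanged. *)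
Theorem UDefF_loop a f L s0 : a <= 22 -> UDefF a.+2 f -> UDefF a L -> UDefF a s0 ->
  UDefF a (fun S rho => loop S (L S rho) (fun j s => f S (j :: s :: rho)) (s0 S rho)).
Proof.
move=> le hf hL hs.
pose g := (fun S rho => if nth 0 rho 0 < L S (drop 2 rho) then f S rho else nth 0 rho 1) : fun_t.
have l2 : a.+2 <= 30 by lia.
have hg : UDefF a.+2 g.
  apply: UDefF_if => //; last exact: UDefF_var.
  apply: UDef_lt => //; first exact: UDefF_var.
  by apply: (UDefF_drop 2) => //; lia.
have hb := UDefF_block le hg 20.
have h0 : UDefF a (fun S rho => 0) by apply: UDefF_nat.
have hs' : UDefF a (fun S rho => s0 S rho %% sSm S).
  have l30 : a <= 30 by lia.
  exact: (UDefF_mod l30 hs (UDefF_Sm l30)).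
have l33 : 0 + a <= 33 by lia.
have := UDefF_comp2 l33 h0 hs' hb; apply: UDefF_ext => S ok rho sr b.
have Sm0 : 0 < sSm S by rewrite expn_gt0.
rewrite (_ : nth _ _ 0 = 0) // (_ : nth _ _ 1 = s0 S rho %% sSm S) //.
have E : drop 2 [:: 0, s0 S rho %% sSm S & drop 0 rho] = rho by rewrite /= !drop0.
rewrite E (blockE _ le) ?ltn_mod // /loop => {E}.
have [lt|ge] := leqP (L S rho) (srs S ^ 20).
  rewrite -{1}(subnKC lt) iteriD.
  rewrite (@iteri_ext _ (L S rho) _ (fun j s => f S [:: j, s & rho] %% sSm S)); last first.
    by move=> j lj s; rewrite /g /= drop0 lj.
  have xl : iteri (L S rho) (fun j s => f S [:: j, s & rho] %% sSm S) (s0 S rho %% sSm S) < sSm S.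
    by case: (L S rho) => [|m] /=; rewrite ltn_mod.
  move: (iteri (L S rho) _ _) xl => y yl; elim: (_ - _) => //= m ->.
  by rewrite /g /= drop0 ltnNge leq_addr /= modn_small.
apply: iteri_ext => j lj s.
by rewrite /g /= drop0 (ltn_trans lj ge).
Qed.

(** * Division by Chinese remaindering *)

Lemma eq_mod_prod (n : nat) (p : nat -> nat) x y :
  (forall i j, i < n -> j < n -> i != j -> coprime (p i) (p j)) ->
  (forall j, j < n -> x = y %[mod p j]) -> x = y %[mod \prod_(j < n) p j].
Proof.
elim: n => [|n IH] cop h; first by rewrite big_ord0 !modn1.
rewrite big_ord_recr /=; apply/eqP; rewrite chinese_remainder.
  apply/andP; split; apply/eqP; last exact: h.
  by apply: IH => [i j li lj|j lj]; [apply: cop; apply: ltnW|apply: h; apply: ltnW].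
elim/big_rec: _ => [|i m _ IHm]; first exact: coprime1n.
rewrite coprimeMl IHm andbT; apply: cop => //; last by rewrite ltn_eqF.
by rewrite ltnS ltnW.
Qed.

(** The estimate [(1 + B/W)^m <= 1 + 2 m B / W], cleared of denominators; the induction needs
    [B (2 m B) <= B W]. *)
Lemma exp_add_le W B m : 2 * m * B <= W -> (W + B) ^ m * W <= W ^ m * (W + 2 * m * B).
Proof.
elim: m => [|m IH] le; first by rewrite !expn0 muln0 mul0n addn0.
have le' : 2 * m * B <= W by nia.
rewrite !expnS; apply: leq_trans (_ : (W + B) * (W ^ m * (W + 2 * m * B)) <= _).
  by rewrite -mulnA leq_mul2l IH // orbT.
rewrite mulnCA [W * W ^ m]mulnC -[leqRHS]mulnA leq_mul2l; apply/orP; right.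
have : B * (2 * m * B) <= B * W by rewrite leq_mul2l le' orbT.
nia.
Qed.

(* [V] approximates [2 q (S / P)], where [S / P] is [x / (2 y)] up to integers and a small error. *)
Section RoundedQuotient.
Variables (P S A E x y z c q J V m1 m2 : nat).
Hypotheses (P0 : 0 < P) (y0 : 0 < y) (cy : c < y) (xE : x = z * y + c).
Hypotheses (V_ge : 2 * q * S + P <= P * V) (V_le : P * V <= 2 * q * S + J.+1 * P).
Hypotheses (SA : S + m1 * P = A + m2 * P) (AE : A * (2 * y) + x * E = x * P).
Hypotheses (E_small : q * x * E <= y * P) (J_small : J.+1 * y < q).

(** [S / P] is known only up to integers, but it approximates [x / (2 y)], so doubling it gives
    [x / y] up to even integers and the parity of the quotient survives. From below, the summand [P]
    in [V_ge] compensates the deficit [q x E / (y P) <= 1]; from above, the fractional part of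
    [x / y] is at most [1 - 1 / y], and [J_small] keeps the excess [(J + 1) / q] below [1 / y]. *)
Lemma rounded_quotient : odd (V %/ q) = odd z.
Proof.
have q0 : 0 < q by apply: leq_ltn_trans J_small.
have yP : 0 < y * P by rewrite muln_gt0 y0.
have AE' : q * (A * (2 * y)) + q * x * E = q * x * P by rewrite -mulnA -mulnDr AE mulnA.
have SA' : 2 * q * y * S + 2 * q * y * (m1 * P) = 2 * q * y * A + 2 * q * y * (m2 * P).
  by rewrite -!mulnDr SA.
have lo : q * (z + 2 * m2) <= V + 2 * q * m1.
  rewrite -(leq_pmul2l yP).
  have h : y * (2 * q * S + P) <= y * (P * V) by rewrite leq_mul2l V_ge orbT.
  have : q * (z * y) * P <= q * x * P by rewrite leq_mul2r leq_mul2l xE leq_addr !orbT.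
  have -> : y * P * (q * (z + 2 * m2)) = q * (z * y) * P + 2 * q * y * (m2 * P) by lia.
  have -> : y * P * (V + 2 * q * m1) = y * (P * V) + 2 * q * y * (m1 * P) by lia.
  by move: h AE' SA'; rewrite mulnDr; move: E_small; lia.
have hi : V + 2 * q * m1 < q * (z + 2 * m2).+1.
  rewrite -(ltn_pmul2l yP).
  have h : y * (P * V) <= y * (2 * q * S + J.+1 * P) by rewrite leq_mul2l V_le orbT.
  have xP : q * x * P = q * (z * y) * P + q * c * P by rewrite xE; lia.
  have cP : (q * c + J.+1 * y) * P < q * y * P.
    rewrite ltn_mul2r P0 /=; apply: leq_trans (_ : q * c.+1 <= _).
      by rewrite mulnS; lia.
    by rewrite leq_mul2l cy orbT.
  have -> : y * P * (q * (z + 2 * m2).+1) = q * (z * y) * P + q * y * P + 2 * q * y * (m2 * P) by lia.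
  have -> : y * P * (V + 2 * q * m1) = y * (P * V) + 2 * q * y * (m1 * P) by lia.
  by move: h cP AE' SA'; rewrite mulnDr mulnDl; lia.
have : (V + 2 * q * m1) %/ q = z + 2 * m2.
  apply/eqP; rewrite eqn_leq leq_divRL // [(z + _) * q]mulnC lo andbT -ltnS ltn_divLR //.
  by rewrite [(z + _).+1 * q]mulnC.
rewrite -mulnA mulnCA [q * _]mulnC divnDMl // => e.
by have := congr1 odd e; rewrite !mul2n !oddD !odd_double !addbF.
Qed.

End RoundedQuotient.

Lemma prod_const_ord n c : \prod_(i < n) c = c ^ n.
Proof. by rewrite big_const_ord iter_muln_1. Qed.

(** * Bits of a quotient from residues *)

Section MulDiv.
Variables (N w gg M r F : nat).
Let J := r * M.
(* Pairwise coprime for [j < J] because every difference [i - j] divides [F]; all are close to [2 ^ w]. *)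
Definition modulus j := F * (2 ^ w %/ F + 1 + j) + 1.
Local Notation p := modulus.
Hypotheses (F0 : 0 < F) (F_dvd : forall i, 0 < i -> i < J -> i %| F).
Hypotheses (Mw : M * w = 4 * N) (gg2 : 1 < gg).
Hypotheses (w_big : 2 * M * (F * J + 1) * 2 ^ gg <= 2 ^ w).
Hypotheses (r_big : 2 * r + 6 * N <= gg * r) (J_small : J.+1 < 2 ^ (2 * N)) (ggN : gg + 1 <= 2 * N).

Lemma modulus_gt j : 2 ^ w < p j.
Proof.
have := ltn_pmod (2 ^ w) F0; rewrite /p => h.
by rewrite {1}(divn_eq (2 ^ w) F) !mulnDr muln1 [F * (_ %/ _)]mulnC; lia.
Qed.

Lemma modulus_le j : j < J -> p j <= 2 ^ w + (F * J + 1).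
Proof.
move=> lt; have := leq_trunc_div (2 ^ w) F; rewrite /p => h.
have : F * j.+1 <= F * J by rewrite leq_mul2l lt orbT.
by rewrite !mulnDr muln1 mulnS [F * (_ %/ _)]mulnC; lia.
Qed.

Lemma modulus_gt0 j : 0 < p j. Proof. by rewrite /p addn1. Qed.

(** A common prime divides [F (j - i)], hence [F] by [F_dvd]; but every modulus is 1 modulo [F]. *)
Lemma modulus_coprime i j : i < J -> j < J -> i != j -> coprime (p i) (p j).
Proof.
wlog lt : i j / i < j.
  move=> h li lj ne; case: (ltngtP i j) ne => // lt _; first by apply: h => //; rewrite neq_ltn lt.
  by rewrite coprime_sym; apply: h => //; rewrite neq_ltn lt.
move=> li lj _; rewrite /coprime; apply/negPn/negP => ne.
have g0 : 1 < gcdn (p i) (p j).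
  by have := gcdn_gt0 (p i) (p j); rewrite modulus_gt0 /=; move: ne; case: gcdn => [|[]].
have [q qp] := pdivP g0; rewrite dvdn_gcd => /andP[qi qj].
have pF : p j = p i + F * (j - i) by rewrite /p -(subnKC (ltnW lt)) addKn; lia.
have : q %| F * (j - i) by rewrite -(dvdn_addr _ qi) -pF.
rewrite Euclid_dvdM // => /orP h.
have qF : q %| F.
  case: h => // h; apply: dvdn_trans h (F_dvd _ _); first by rewrite subn_gt0.
  exact: leq_ltn_trans (leq_subr _ _) lj.
have : q %| 1 by rewrite -(dvdn_addr (m := F * (2 ^ w %/ F + 1 + i))) // dvdn_mulr.
by rewrite dvdn1 => /eqP q1; rewrite q1 in qp.
Qed.

(** The product of a group of [M] moduli. Each is just above [2^w] and [M w = 4 N], so the product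
    exceeds [2^(4 N)] by a relative error of at most [2^-gg]. *)
Definition Dprod i := \prod_(l < M) p (i * M + l).
Definition Pprod := \prod_(j < J) p j.

Lemma prod_nat_mul s m (f : nat -> nat) :
  \prod_(j < s * m) f j = \prod_(i < s) \prod_(l < m) f (i * m + l).
Proof.
elim: s => [|s IH]; first by rewrite mul0n !big_ord0.
rewrite big_ord_recr /= -IH -!(big_mkord xpredT f) mulSn addnC.
rewrite (@big_cat_nat _ _ _ (s * m)) ?leq_addr //=; congr (_ * _).
by rewrite -{1}[s * m]add0n big_addn addKn big_mkord; apply: eq_bigr => l _; rewrite addnC.
Qed.

Lemma PprodE : Pprod = \prod_(i < r) Dprod i. Proof. exact: prod_nat_mul. Qed.

Lemma Pprod_gt0 : 0 < Pprod.
Proof. by apply: prodn_gt0 => j; apply: modulus_gt0. Qed.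

Lemma Dprod_ge i : 2 ^ (4 * N) <= Dprod i.
Proof.
rewrite -Mw mulnC expnM -prod_const_ord; apply: leq_prod => j _.
by apply: ltnW; apply: modulus_gt.
Qed.

Lemma Dprod_le i : i < r -> Dprod i * 2 ^ gg <= 2 ^ (4 * N) * (2 ^ gg + 1).
Proof.
move=> lt; set W := 2 ^ w; set B := F * J + 1; have W0 : 0 < W by rewrite expn_gt0.
have h1 : Dprod i <= (W + B) ^ M.
  rewrite -prod_const_ord; apply: leq_prod => l _; apply: modulus_le.
  apply: leq_trans (_ : i.+1 * M <= _); first by rewrite mulSn addnC ltn_add2r ltn_ord.
  by rewrite leq_mul2r lt orbT.
have G0 : 0 < 2 ^ gg by rewrite expn_gt0.
have h2 : 2 * M * B <= W by apply: leq_trans w_big; rewrite leq_pmulr.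
have h3 := exp_add_le h2; rewrite -Mw mulnC [M * w]mulnC expnM -/W.
rewrite -(leq_pmul2r W0); apply: leq_trans (_ : 2 ^ gg * ((W + B) ^ M * W) <= _).
  by rewrite -mulnA leq_mul2l leq_mul2r h1 !orbT.
apply: leq_trans (_ : 2 ^ gg * (W ^ M * (W + 2 * M * B)) <= _).
  by rewrite leq_mul2l h3 orbT.
rewrite mulnCA -[leqRHS]mulnA leq_mul2l; apply/orP; right.
by move: w_big; rewrite -/W -/B; lia.
Qed.

Variables (X1 X2 Y k lam : nat).
Hypotheses (X1_lt : X1 < 2 ^ N) (X2_lt : X2 < 2 ^ N) (Y_lt : Y < 2 ^ lam) (Y_ge : 2 ^ lam <= 2 * Y).
Hypotheses (lamN : lam <= N) (kN : k < N).
Let Y0 : 0 < Y. Proof. by have := expn_gt0 2 lam; move: Y_ge; lia. Qed.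

(** The leading [gg] bits of [Y] determine [recY], an approximation of [2^(lam + gg) / Y] short
    enough for the small structure. *)
Definition topY := (Y * 2 ^ gg) %/ 2 ^ lam.
Definition recY := 2 ^ (2 * gg) %/ topY.+1.
Let u := recY.
(** A multiple of [2 Y 2^k], see [uuE], that lies just below [2^(4 N)] and hence below every
    [Dprod i]. *)
Definition cE := u * Y * 2 ^ (4 * N - lam - gg).
Definition Eterm i := Dprod i - cE.
Definition uu := u * 2 ^ (4 * N - lam - gg - k - 1).

(* [E_i = D_i] modulo [2 Y 2 ^ k], so [prod D_i - prod E_i = Q * 2 Y 2 ^ k] by telescoping, while [prod E_i] is
   negligible: [Qnum] is a reciprocal whose residues modulo the [p_j] are computable. *)
Fixpoint Qnum i := if i is i'.+1 then Eterm i' * Qnum i' + (\prod_(l < i') Dprod l) * uu else 0.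

Lemma uuE : uu * (2 * (Y * 2 ^ k)) = cE.
Proof.
have e : 4 * N - lam - gg = (4 * N - lam - gg - k - 1) + (k + 1) by lia.
by rewrite /uu /cE {2}e expnD [2 ^ (k + 1)]expnD expn1; lia.
Qed.

(** Dividing by [topY + 1], which overestimates [Y], makes [recY] err only downwards. This puts [cE]
    below every [Dprod i], so that the subtraction in [Eterm] is not truncated. *)
Lemma recY_bounds : u * Y < 2 ^ lam * 2 ^ gg /\ 2 ^ lam * 2 ^ gg <= u * Y + 3 * 2 ^ lam.
Proof.
have L0 : 0 < 2 ^ lam by rewrite expn_gt0.
have G0 : 0 < 2 ^ gg by rewrite expn_gt0.
have t1 : topY * 2 ^ lam <= Y * 2 ^ gg by apply: leq_trunc_div.
have t2 : Y * 2 ^ gg < topY.+1 * 2 ^ lam by apply: ltn_ceil.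
have GG : 2 ^ (2 * gg) = 2 ^ gg * 2 ^ gg by rewrite mul2n -addnn expnD.
have u1 : u * topY.+1 <= 2 ^ gg * 2 ^ gg by rewrite -GG; apply: leq_trunc_div.
have u2 : 2 ^ gg * 2 ^ gg < u.+1 * topY.+1 by rewrite -GG; apply: ltn_ceil.
have t3 : topY < 2 ^ gg by rewrite ltn_divLR // mulnC ltn_mul2l G0.
have t4 : 2 ^ gg <= 2 * topY.+1.
  rewrite -(leq_pmul2r L0); apply: leq_trans (_ : 2 ^ gg * (2 * Y) <= _).
    by rewrite leq_mul2l Y_ge orbT.
  by move: t2; lia.
have u3 : u <= 2 * 2 ^ gg.
  have G1 : 0 < topY.+1 by [].
  rewrite -(leq_pmul2r G1); apply: leq_trans u1 _.
  have : 2 ^ gg * 2 ^ gg <= 2 ^ gg * (2 * topY.+1) by rewrite leq_mul2l t4 orbT.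
  by lia.
split.
  case: (posnP u) => [->|u0]; first by rewrite mul0n muln_gt0 L0.
  rewrite -(ltn_pmul2r G0); apply: leq_trans (_ : u * (topY.+1 * 2 ^ lam) <= _).
    by rewrite -mulnA ltn_mul2l u0.
  by rewrite mulnA -mulnA [leqRHS]mulnC mulnA [_ * 2 ^ gg]mulnC mulnA leq_mul2r u1 orbT.
rewrite -(leq_pmul2r G0).
have h : u * (topY * 2 ^ lam) <= u * (Y * 2 ^ gg) by rewrite leq_mul2l t1 orbT.
have : (2 ^ gg * 2 ^ gg) * 2 ^ lam <= (u * topY + 3 * 2 ^ gg) * 2 ^ lam.
  by rewrite leq_mul2r; apply/orP; right; move: u2 u3 t3; rewrite mulSn mulnS; lia.
by rewrite mulnDl; move: h; lia.
Qed.

Let K0 := 4 * N - lam - gg.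
Let K0E : 2 ^ (4 * N) = 2 ^ lam * 2 ^ gg * 2 ^ K0.
Proof. by rewrite -!expnD /K0; congr (_ ^ _); lia. Qed.

Lemma cE_lt : cE < 2 ^ (4 * N).
Proof. by rewrite K0E /cE ltn_mul2r expn_gt0 /=; case: recY_bounds. Qed.

Lemma Eterm_le i : i < r -> Eterm i * 2 ^ gg <= 4 * Dprod i.
Proof.
move=> lt; have [_ h] := recY_bounds; have D1 := Dprod_ge i; have D2 := Dprod_le lt.
have h1 : 2 ^ (4 * N) * 2 ^ gg <= cE * 2 ^ gg + 3 * 2 ^ (4 * N).
  rewrite K0E /cE -/K0.
  have : 2 ^ lam * 2 ^ gg * (2 ^ gg * 2 ^ K0) <= (u * Y + 3 * 2 ^ lam) * (2 ^ gg * 2 ^ K0).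
    by rewrite leq_mul2r h orbT.
  by rewrite mulnDl; lia.
rewrite /Eterm mulnBl; move: D2; rewrite mulnDr muln1; lia.
Qed.

Lemma QnumE i : i <= r -> Qnum i * (2 * (Y * 2 ^ k)) + \prod_(l < i) Eterm l = \prod_(l < i) Dprod l.
Proof.
elim: i => [|i IH] le; first by rewrite !big_ord0.
rewrite !big_ord_recr /=.
have cD : cE + Eterm i = Dprod i.
  by rewrite /Eterm subnKC //; apply: leq_trans (Dprod_ge i); apply: ltnW; apply: cE_lt.
have := IH (ltnW le); rewrite -cD -uuE.
move: (\prod_(l < i) Eterm l) (\prod_(l < i) Dprod l) (Eterm i) (Qnum i) (2 * _) => e D E Q Z <-.
by lia.
Qed.

Lemma Eprod_le n : n <= r -> (\prod_(i < n) Eterm i) * 2 ^ (gg * n) <= 4 ^ n * \prod_(i < n) Dprod i.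
Proof.
elim: n => [|n IH] le; first by rewrite !big_ord0 muln0.
have := leq_mul (IH (ltnW le)) (Eterm_le le).
by rewrite !big_ord_recr /= mulnS expnD expnS; lia.
Qed.

Let x := X1 * X2.
Definition Anum := x * Qnum r.
Variable h : nat -> nat.
Hypothesis h_lt : forall j, j < J -> h j < p j.
Hypothesis hE : forall j, j < J -> h j * (Pprod %/ p j) = Anum %[mod p j].

(** By [hE] the sum of the [h j * (P / p j)] is [Anum] modulo [P], so the sum of the fractions
    [h j / p j] is [Anum / P] up to an integer. [Vnum] is that sum scaled by [2^(4 N + 1)] with
    every term rounded down; [J + 1] makes up for the roundings and for the error of the
    reciprocal. *)
Definition Vnum := \sum_(j < J) (2 ^ (4 * N).+1 * h j) %/ p j + J.+1.

Lemma dvd_Pprod j : j < J -> p j %| Pprod.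
Proof. by move=> lt; rewrite /Pprod (bigD1 (Ordinal lt)) //= dvdn_mulr. Qed.

Lemma dvd_Pprod_div i j : i < J -> j < J -> i != j -> p i %| Pprod %/ p j.
Proof.
move=> li lj ne; rewrite /Pprod (bigD1 (Ordinal lj)) //= mulKn ?modulus_gt0 //.
by rewrite (bigD1 (Ordinal li)) //= dvdn_mulr.
Qed.

(** An instance of [rounded_quotient] with [q = 2^(4 N)] and divisor [Y 2^k]. Bit [k] of [X1 X2 / Y]
    is the parity of [X1 X2 / (Y 2^k)], so each bit is obtained by itself and the long quotient is
    never stored. *)
Theorem muldiv_correct : odd (Vnum %/ 2 ^ (4 * N)) = odd ((X1 * X2) %/ Y %/ 2 ^ k).
Proof.
set q := 2 ^ (4 * N); pose S := \sum_(j < J) h j * (Pprod %/ p j).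
have P0 := Pprod_gt0.
have SA : S = Anum %[mod Pprod].
  apply: eq_mod_prod => [i j|j lj]; first exact: modulus_coprime.
  rewrite -(hE lj) /S (bigD1 (Ordinal lj)) //= -modnDmr.
  suff -> : (\sum_(i < J | i != Ordinal lj) h i * (Pprod %/ p i)) %% p j = 0 by rewrite addn0.
  apply/eqP; rewrite -/(dvdn _ _); apply: dvdn_sum => i ne; apply: dvdn_mull.
  by apply: dvd_Pprod_div => //; rewrite eq_sym.
have sumP a : \sum_(j < J) a j * Pprod = (\sum_(j < J) a j) * Pprod by rewrite big_distrl.
have V1 : 2 * q * S + Pprod <= Pprod * Vnum.
  have : 2 * q * S <= \sum_(j < J) ((2 ^ (4 * N).+1 * h j) %/ p j + 1) * Pprod.
    rewrite /S big_distrr /=; apply: leq_sum => j _.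
    have {2}<- := divnK (dvd_Pprod (ltn_ord j)).
    rewrite [_ * p j]mulnC !mulnA leq_mul2r -expnS addn1 ltnW ?orbT //.
    exact: ltn_ceil (modulus_gt0 j).
  by rewrite sumP big_split /= sum1_card card_ord /Vnum; move: (\sum_(j < J) _) => Z; lia.
have V2 : Pprod * Vnum <= 2 * q * S + J.+1 * Pprod.
  have : \sum_(j < J) ((2 ^ (4 * N).+1 * h j) %/ p j) * Pprod <= 2 * q * S.
    rewrite /S big_distrr /=; apply: leq_sum => j _.
    have {1}<- := divnK (dvd_Pprod (ltn_ord j)).
    rewrite [_ * p j]mulnC !mulnA leq_mul2r -expnS; apply/orP; right.
    exact: leq_trunc_div.
  by rewrite sumP /Vnum; move: (\sum_(j < J) _ %/ _) => Z; lia.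
have SA' : S + (Anum %/ Pprod) * Pprod = Anum + (S %/ Pprod) * Pprod.
  by rewrite {1}(divn_eq S Pprod) {2}(divn_eq Anum Pprod) SA; lia.
pose y := Y * 2 ^ k; have y0 : 0 < y by rewrite muln_gt0 Y0 expn_gt0.
have AE : Anum * (2 * y) + x * \prod_(i < r) Eterm i = x * Pprod.
  by rewrite PprodE -(QnumE (leqnn r)) /Anum -/y; lia.
have dy : Y * 2 ^ k = y by [].
have N2 : 2 ^ (2 * N) = 2 ^ N * 2 ^ N by rewrite -expnD addnn mul2n.
have x_lt : x < 2 ^ (2 * N) by rewrite N2; apply: ltn_mul.
have y_lt : y < 2 ^ (2 * N).
  rewrite N2; apply: ltn_mul; last by rewrite ltn_exp2l.
  by apply: leq_trans Y_lt _; rewrite leq_exp2l.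
(* Here [q x < 2^(6 N)], while the product of the [r] terms [Eterm i] is at most [2^(2 r - gg r) P];
   [r_big] balances the two. *)
have E_small : q * x * (\prod_(i < r) Eterm i) <= y * Pprod.
  apply: leq_trans (_ : 1 * Pprod <= _); last by rewrite leq_mul2r y0 orbT.
  have R0 : 0 < 4 ^ r by rewrite expn_gt0.
  rewrite mul1n -(leq_pmul2l R0) PprodE; apply: leq_trans (Eprod_le (leqnn r)).
  rewrite mulnA [leqRHS]mulnC leq_mul2r; apply/orP; right.
  apply: leq_trans (_ : 4 ^ r * (q * 2 ^ (2 * N)) <= _).
    by rewrite !leq_mul2l ltnW ?orbT.
  by rewrite (_ : 4 = 2 ^ 2) // -expnM /q -!expnD leq_exp2l //; move: r_big; lia.
have Jy : J.+1 * y < q.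
  have e4 : 4 * N = 2 * N + 2 * N by lia.
  rewrite /q e4 expnD.
  by apply: ltn_mul.
have := rounded_quotient P0 y0 (ltn_pmod x y0) (divn_eq x y) V1 V2 SA' AE E_small Jy.
by rewrite -divnMA dy.
Qed.

End MulDiv.

(** * Parameters *)

Lemma fact_le_exp n : n`! <= n ^ n.
Proof.
elim: n => // n IH; rewrite factS expnS leq_mul2l /=.
by apply: leq_trans IH _; case: n => // n; rewrite leq_exp2r.
Qed.

Lemma exp2_ge5 e : 20 <= e -> 5 * e <= 2 ^ e.
Proof.
elim: e => // e IH le; case: (ltngtP e 19) => [|lt|->]; [lia| |by []].
by rewrite expnS; have := IH lt; lia.
Qed.

(** The index is clipped so that the value is bounded for every argument, as definability
    demands. *)
Definition sp S j := modulus (sw S) (sF S) (minn j (sJ S)).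

Record bigS S : Prop := BigS {
  bT : sT S = 4 * sN S;
  bJ : sJ S = sr S * sM S;
  bF0 : 0 < sF S;
  bFd : forall i, 0 < i -> i < sr S * sM S -> i %| sF S;
  bMw : sM S * sw S = 4 * sN S;
  bw : sw S = 2 * sg S;
  bg : 1 < sg S;
  bwbig : 2 * sM S * (sF S * (sr S * sM S) + 1) * 2 ^ sg S <= 2 ^ sw S;
  brbig : 2 * sr S + 6 * sN S <= sg S * sr S;
  bJsmall : (sr S * sM S).+1 < 2 ^ (2 * sN S);
  bgN : sg S + 1 <= 2 * sN S;
  bfw : sfw S = 4 * sw S;
  bwU : 2 ^ sw S < sU S;
  bM0 : 0 < sM S;
  bTrs : sT S <= srs S ^ 20;
  bJrs : sJ S <= srs S ^ 20;
  bTsm : sT S + 2 < sSm S;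
  bJsm : 2 * sJ S + 2 < sSm S;
  bND : sN S = 2 ^ sD S;
  bSm : sSm S * sSm S < sU S;
  bdD : sd S <= sD S }.

(** In exponents of 2: [sM sw] has [(e + v + 5) + (15 e - 3) = 16 e + v + 2], that is [4 N]; [sg sr]
    has [16 e + v + 4], that is [16 N], enough for [6 N + 2 r]; [sJ] has [2 e + 2 v + 13], so [J!]
    is at most [2^(2^(6 e))], negligible against [2^sg] with [sg = 2^(15 e - 4)]. Finally [v <= e]
    puts the loop length [4 N] below [srs^20 = 2^(20 e)]. *)
Lemma okS_big S : okS S -> bigS S.
Proof.
case=> [[_ [e [v [[e20 ve dE fwE rsE] [[NE DE wE ME rE] [FE TE JE gE]]]]]] _ _ hfw _].
have pw a b c : a + b = c -> 2 ^ a * 2 ^ b = 2 ^ c by rewrite -expnD => ->.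
have JE' : sJ S = 2 ^ (2 * e + 2 * v + 13) by rewrite JE rE ME; apply: pw; clear -e20 ve; lia.
have J0 : 0 < sJ S by rewrite JE' expn_gt0.
have wg : sw S = 2 * sg S by rewrite wE gE -expnS; congr (_ ^ _); clear -e20 ve; lia.
have fw4 : sfw S = 4 * sw S by rewrite fwE wE (_ : 4 = 2 ^ 2) //; symmetry; apply: pw; clear -e20 ve; lia.
have expn_self n : n < 2 ^ n by apply: ltn_expl.
have F0 : 0 < sF S by rewrite FE fact_gt0.
have rs20 : srs S ^ 20 = 2 ^ (20 * e) by rewrite rsE -expnM mulnC.
have N4 : 4 * sN S = 2 ^ (16 * e + v + 2) by rewrite NE (_ : 4 = 2 ^ 2) //; apply: pw; clear -e20 ve; lia.
have bSm' : sSm S * sSm S < sU S.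
  rewrite /sSm -expnD ltn_exp2l // addnn -mul2n; apply: leq_trans hfw.
  have fw0 : 0 < sfw S by rewrite fwE expn_gt0.
  rewrite ltn_mul2r fw0 /=; have : 2 ^ 1 < 2 ^ e by rewrite ltn_exp2l //; clear -e20 ve; lia.
  by rewrite rsE; clear; move: (2 ^ e) => A; lia.
have c15 : 20 * e + 20 <= 2 ^ (15 * e - 1).
  have h : 20 <= 15 * e - 1 by clear -e20; lia.
  by apply: leq_trans (exp2_ge5 h); clear -e20; lia.
have SmB n : n <= 20 * e + 19 -> 2 ^ n < sSm S.
  by move=> le; rewrite /sSm ltn_exp2l // fwE; apply: leq_trans c15; clear -le; lia.
have w_big : 2 * sM S * (sF S * (sr S * sM S) + 1) * 2 ^ sg S <= 2 ^ sw S.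
  have FJ : sF S <= 2 ^ (2 ^ (6 * e)).
    rewrite FE; apply: leq_trans (fact_le_exp _) _; rewrite {1}JE' -expnM leq_exp2l //.
    apply: leq_trans (_ : 2 ^ e * 2 ^ (5 * e) <= _); last by rewrite -expnD leq_exp2l //; clear -e20 ve; lia.
    apply: leq_mul; last by rewrite JE' leq_exp2l //; clear -e20 ve; lia.
    by apply: leq_trans (exp2_ge5 e20); clear -e20 ve; lia.
  rewrite -JE wg [2 * sg S]mul2n -[(sg S).*2]addnn expnD leq_mul2r; apply/orP; right.
  apply: leq_trans (_ : 2 ^ (2 + (3 * e + (2 ^ (6 * e) + 5 * e))) <= _).
    rewrite (expnD _ 2) (expnD _ (3 * e)) (expnD _ (2 ^ (6 * e))); have M3 : sM S <= 2 ^ (3 * e) by rewrite ME leq_exp2l //; clear -e20 ve; lia.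
    have J5 : sJ S <= 2 ^ (5 * e) by rewrite JE' leq_exp2l //; clear -e20 ve; lia.
    have : sF S * sJ S <= 2 ^ 2 ^ (6 * e) * 2 ^ (5 * e) by apply: leq_mul.
    have FJ0 : 0 < sF S * sJ S by rewrite muln_gt0 F0.
    move=> le; apply: (@leq_trans (2 ^ 2 * (2 ^ (3 * e) * (sF S * sJ S)))).
      have : sM S * (sF S * sJ S) <= 2 ^ (3 * e) * (sF S * sJ S) by rewrite leq_mul2r M3 orbT.
      by move: FJ0; clear; move: (_ * sJ S) (2 ^ _) => A B; nia.
    by rewrite !leq_mul2l le !orbT.
  rewrite leq_exp2l // gE.
  have : 2 ^ (6 * e) <= 2 ^ (15 * e - 5) by rewrite leq_exp2l //; clear -e20 ve; lia.
  have : 2 + 8 * e <= 2 ^ (15 * e - 5).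
    by apply: leq_trans (ltnW (expn_self _)); clear -e20; lia.
  have -> : 15 * e - 4 = (15 * e - 5).+1 by clear -e20; lia.
  by rewrite expnS; clear; move: (2 ^ (15 * e - 5)) (2 ^ (6 * e)) => A B; lia.
have b1 : sT S + 2 < sSm S.
  rewrite TE N4; apply: leq_trans (SmB (16 * e + v + 3) _); last by clear -e20 ve; lia.
  have h : 2 ^ (16 * e + v + 3) = 2 ^ (16 * e + v + 2) * 2 by rewrite -expnSr; congr (_ ^ _); clear -e20 ve; lia.
  have : 2 ^ 2 <= 2 ^ (16 * e + v + 2) by rewrite leq_exp2l //; clear -e20 ve; lia.
  by rewrite h; clear; move: (2 ^ (16 * e + v + 2)) => A; lia.
split=> //.
- by move=> i i0; rewrite -JE FE => lt; apply: dvdn_fact; rewrite i0 ltnW.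
- by rewrite ME wE N4; apply: pw; clear -e20 ve; lia.
- by rewrite gE -{1}(expn0 2) ltn_exp2l //; clear -e20 ve; lia.
- rewrite gE rE NE; have -> : 2 ^ (15 * e - 4) * 2 ^ (e + v + 8) = 2 ^ (16 * e + v) * 2 ^ 4.
    by rewrite -!expnD; congr (_ ^ _); clear -e20 ve; lia.
  have : 2 ^ (e + v + 8) <= 2 ^ (16 * e + v) by rewrite leq_exp2l //; clear -e20 ve; lia.
  by clear; move: (2 ^ (e + v + 8)) (2 ^ (16 * e + v)) => A B; lia.
- rewrite -JE JE'; apply: (@leq_trans (2 ^ (2 * e + 2 * v + 14))).
    have -> : 2 * e + 2 * v + 14 = (2 * e + 2 * v + 13).+1 by lia.
    by rewrite expnS; have : 2 ^ 1 <= 2 ^ (2 * e + 2 * v + 13); [rewrite leq_exp2l //; clear -e20 ve; lia|clear; move: (2 ^ (2 * e + 2 * v + 13)) => A; lia].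
  rewrite leq_exp2l // NE; apply: leq_trans (_ : 16 * e + v <= _); first by clear -e20 ve; lia.
  by have := expn_self (16 * e + v); clear; move: (2 ^ _) => A; lia.
- rewrite gE NE; have : 2 ^ (15 * e - 4) <= 2 ^ (16 * e + v) by rewrite leq_exp2l //; clear -e20 ve; lia.
  by have := expn_gt0 2 (16 * e + v); clear; move: (2 ^ (16 * e + v)) (2 ^ _) => A B; lia.
- rewrite ltn_exp2l // wE dE ltn_exp2l //; clear -e20 ve; lia.
- by rewrite ME expn_gt0.
- by rewrite TE N4 rs20 leq_exp2l //; clear -e20 ve; lia.
- by rewrite JE' rs20 leq_exp2l //; clear -e20 ve; lia.
- rewrite JE'; apply: leq_trans (SmB (2 * e + 2 * v + 15) _); last by clear -e20 ve; lia.
  have -> : 2 * e + 2 * v + 15 = (2 * e + 2 * v + 13).+2 by lia.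
  by rewrite !expnS; have : 2 ^ 1 <= 2 ^ (2 * e + 2 * v + 13); [rewrite leq_exp2l //; clear -e20 ve; lia|clear; move: (2 ^ (2 * e + 2 * v + 13)) => A; lia].
- by rewrite NE DE.
- by rewrite dE DE; clear; lia.
Qed.

Lemma sp_gt0 S j : 0 < sp S j. Proof. exact: modulus_gt0. Qed.

Lemma sp_lt S j : okS S -> sp S j < 2 ^ (sw S + 2).
Proof.
move=> ok; have b := okS_big ok; rewrite /sp /modulus.
have h1 := leq_trunc_div (2 ^ sw S) (sF S).
have h2 : sF S * (1 + minn j (sJ S)) + 1 <= 2 * 2 ^ sw S.
  apply: leq_trans (_ : sF S * sJ S + sF S + 1 <= _).
    have : sF S * minn j (sJ S) <= sF S * sJ S by rewrite leq_mul2l geq_minr orbT.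
    by lia.
  have h : 2 * sM S * (sF S * sJ S + 1) <= 2 ^ sw S.
    by rewrite (bJ b); apply: leq_trans (bwbig b); rewrite leq_pmulr // expn_gt0.
  have FJ : sF S * 1 <= sF S * sJ S.
    rewrite leq_mul2l (bJ b) muln_gt0 (bM0 b) andbT; apply/orP; right.
    by have := brbig b; have := bgN b; have := bg b; case: (sr S) => [|//]; lia.
  have : sF S * sJ S + 1 <= sM S * (sF S * sJ S + 1) by rewrite leq_pmull // (bM0 b).
  by lia.
by rewrite expnD mulnDr; move: h2; rewrite mulnDr mulnDr muln1 [sF S * (_ %/ _)]mulnC; lia.
Qed.

Lemma sp_Sm S j : okS S -> sp S j < sSm S.
Proof.
move=> ok; apply: leq_trans (sp_lt j ok) _; have b := okS_big ok.
by rewrite /sSm leq_exp2l // (bfw b) (bw b); have := bg b; lia.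
Qed.

(** * Functions with small values *)

(** Values that can be the state of a loop. As [sSm^2 < sU], sums and products of two of them are
    exact in the small structure. *)
Definition SF a (f : fun_t) := UDefF a f /\
  forall S, okS S -> forall rho, size rho = a -> bounded (sU S) rho -> f S rho < sSm S.

Lemma SF_U a f : SF a f -> UDefF a f. Proof. by case. Qed.

Lemma UDefF_addx a f g : a <= 30 -> SF a f -> SF a g -> UDefF a (fun S rho => f S rho + g S rho).
Proof.
move=> le [f1 f2] [g1 g2]; apply: UDefF_ext (UDefF_add le f1 g1) => S ok rho sr b.
apply: modn_small; have := bSm (okS_big ok); have := f2 S ok rho sr b.
by have := g2 S ok rho sr b; nia.
Qed.

Lemma UDefF_mulx a f g : a <= 30 -> SF a f -> SF a g -> UDefF a (fun S rho => f S rho * g S rho).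
Proof.
move=> le [f1 f2] [g1 g2]; apply: UDefF_ext (UDefF_mul le f1 g1) => S ok rho sr b.
apply: modn_small; apply: leq_trans (ltnW (bSm (okS_big ok))).
by apply: ltn_mul; [apply: f2|apply: g2].
Qed.

Lemma SF_le a f g : UDefF a f -> SF a g ->
  (forall S, okS S -> forall rho, f S rho <= g S rho) -> SF a f.
Proof. by move=> hf [_ hg] le; split=> // S ok rho sr b; apply: leq_ltn_trans (le _ ok _) (hg _ ok _ sr b). Qed.

Lemma SF_mod a f g : a <= 30 -> UDefF a f -> SF a g ->
  (forall S, okS S -> forall rho, 0 < g S rho) -> SF a (fun S rho => f S rho %% g S rho).
Proof.
move=> le hf hg g0; have [g1 g2] := hg; apply: (@SF_le _ _ g) => //; first exact: UDefF_mod.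
by move=> S ok rho; rewrite ltnW // ltn_mod g0.
Qed.

Lemma SF_minr a f g : a <= 30 -> UDefF a f -> SF a g -> SF a (fun S rho => minn (f S rho) (g S rho)).
Proof.
move=> le hf hg; have [g1 g2] := hg; apply: (@SF_le _ _ g) => //; first exact: UDefF_min.
by move=> S ok rho; apply: geq_minr.
Qed.

Lemma SF_sub a f g : a <= 30 -> SF a f -> UDefF a g -> SF a (fun S rho => f S rho - g S rho).
Proof.
move=> le hf hg; have [f1 f2] := hf; apply: (@SF_le _ _ f) => //; first exact: UDefF_sub.
by move=> S ok rho; apply: leq_subr.
Qed.

Lemma SF_div a f g : a <= 30 -> SF a f -> UDefF a g -> SF a (fun S rho => f S rho %/ g S rho).
Proof.
move=> le hf hg; have [f1 f2] := hf; apply: (@SF_le _ _ f) => //; first exact: UDefF_div.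
by move=> S ok rho; apply: leq_div.
Qed.

Lemma SF_if a b f g : a <= 30 -> UDef a b -> SF a f -> SF a g ->
  SF a (fun S rho => if b S rho then f S rho else g S rho).
Proof.
move=> le hb [f1 f2] [g1 g2]; split; first exact: UDefF_if.
by move=> S ok rho sr bd; case: ifP => _; [apply: f2|apply: g2].
Qed.

Lemma SF_nat a k : k <= 100 -> SF a (fun S rho => k).
Proof.
move=> le; split=> [|S ok rho _ _]; first exact: UDefF_nat.
have b := okS_big ok; apply: leq_ltn_trans le _.
have [_ [e [v [[e20 ve dE fwE rsE] _]]]] : 7 <= sd S /\ params S by case: ok.
apply: (@leq_trans (2 ^ 7)) => //; rewrite /sSm leq_exp2l // fwE.
by apply: leq_trans (ltnW (ltn_expl 7 (isT : 1 < 2))) _; rewrite leq_exp2l //; lia.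
Qed.

Lemma SF_bool a b : a <= 30 -> UDef a b -> SF a (fun S rho => b S rho : nat).
Proof.
move=> le h; apply: (@SF_le _ _ (fun _ _ => 1)); [exact: UDefF_bool|exact: SF_nat|].
by move=> S ok rho; case: (b S rho).
Qed.

Lemma SF_cs a k (c : setting -> nat) : k < 12 -> (forall S, c S = nth 0 (scs S) k) ->
  (forall S, bigS S -> c S < sSm S) -> SF a (fun S rho => c S).
Proof.
move=> lt e h; split; last by move=> S ok rho _ _; apply/h/okS_big.
by apply: UDefF_ext (UDefF_cs a lt) => S ok rho _ _; rewrite e.
Qed.

Lemma SF_N a : SF a (fun S rho => sN S).
Proof. by apply: (@SF_cs _ 3) => // S b; have := bT b; have := bTsm b; lia. Qed.

Lemma SF_T a : SF a (fun S rho => sT S).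
Proof. by apply: (@SF_cs _ 9) => // S b; have := bTsm b; lia. Qed.

Lemma SF_J a : SF a (fun S rho => sJ S).
Proof. by apply: (@SF_cs _ 10) => // S b; have := bJsm b; lia. Qed.

Lemma SF_g a : SF a (fun S rho => sg S).
Proof. by apply: (@SF_cs _ 11) => // S b; have := bgN b; have := bT b; have := bTsm b; lia. Qed.

Lemma SF_w a : SF a (fun S rho => sw S).
Proof. by apply: (@SF_cs _ 5) => // S b; have := bw b; have := bgN b; have := bT b; have := bTsm b; lia. Qed.

Lemma sr_gt0 S : bigS S -> 0 < sr S.
Proof. by move=> b; have := brbig b; have := bgN b; have := bg b; case: (sr S) => [|//]; lia. Qed.

Lemma sM_J S : bigS S -> sM S <= sJ S.
Proof. by move=> b; rewrite (bJ b) leq_pmull // sr_gt0. Qed.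

Lemma sr_J S : bigS S -> sr S <= sJ S.
Proof. by move=> b; rewrite (bJ b) leq_pmulr // bM0. Qed.

Lemma SF_M a : SF a (fun S rho => sM S).
Proof. by apply: (@SF_cs _ 6) => // S b; have := sM_J b; have := bJsm b; lia. Qed.

Lemma SF_r a : SF a (fun S rho => sr S).
Proof. by apply: (@SF_cs _ 7) => // S b; have := sr_J b; have := bJsm b; lia. Qed.

Lemma SF_D a : SF a (fun S rho => sD S).
Proof.
apply: (@SF_cs _ 4) => // S b; have := bT b; have := bTsm b; have := bND b.
by have := ltn_expl (sD S) (isT : 1 < 2); lia.
Qed.

Lemma SF_powc a (c : setting -> nat) : a <= 30 -> SF a (fun S rho => c S) ->
  (forall S, bigS S -> c S < sfw S) -> SF a (fun S rho => 2 ^ c S).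
Proof.
move=> le [h _] lt; split; last first.
  by move=> S ok rho _ _; rewrite /sSm ltn_exp2l //; apply/lt/okS_big.
apply: UDefF_ext (UDefF_pow le h h) => S ok rho _ _; apply/minn_idPl.
have b := okS_big ok; have : 2 ^ c S < sSm S by rewrite /sSm ltn_exp2l //; apply: lt.
by have := bSm b; nia.
Qed.

Lemma SF_2g a : a <= 30 -> SF a (fun S rho => 2 ^ sg S).
Proof.
move=> le; apply: SF_powc => //; first exact: SF_g.
by move=> S b; rewrite (bfw b) (bw b); have := bg b; lia.
Qed.

Lemma SF_2w a : a <= 30 -> SF a (fun S rho => 2 ^ sw S).
Proof.
move=> le; apply: SF_powc => //; first exact: SF_w.
by move=> S b; rewrite (bfw b) (bw b); have := bg b; lia.
Qed.

Lemma SF_sp a f : a <= 30 -> UDefF a f -> SF a (fun S rho => sp S (f S rho)).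
Proof.
move=> le hf; split; last by move=> S ok rho _ _; apply: sp_Sm.
have hF : SF a (fun S rho => sF S).
  apply: (@SF_le _ _ (fun S rho => sp S 0)); first exact: (@UDefF_cs a 8).
    split=> [|S ok rho _ _]; last exact: sp_Sm.
    have hF : UDefF a (fun S rho => sF S) := @UDefF_cs a 8 isT.
    have h1 := UDefF_add le (UDefF_div le (SF_U (SF_2w le)) hF) (@UDefF_nat a 1 isT).
    have h2 := UDefF_add le (UDefF_mul le hF h1) (@UDefF_nat a 1 isT).
    apply: UDefF_ext h2 => S ok rho _ _; rewrite /sp min0n /modulus addn0.
    have spU : modulus (sw S) (sF S) 0 < sU S.
      have := sp_Sm 0 ok; rewrite /sp min0n => h; apply: leq_trans h _.
      have := bSm (okS_big ok); have : 0 < sSm S by rewrite expn_gt0.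
      by nia.
    rewrite /modulus addn0 in spU; have F0 := bF0 (okS_big ok).
    set q := _ %/ _ in spU *; rewrite (modn_small (m := q + 1)).
      rewrite (modn_small (m := _ * _)); last by lia.
      by rewrite modn_small.
    by nia.
  move=> S ok rho; rewrite /sp min0n /modulus addn0; move: (_ %/ _) => q; lia.
have hq : SF a (fun S rho => 2 ^ sw S %/ sF S).
  by apply: SF_div => //; [exact: SF_2w|case: hF].
have h1 : UDefF a (fun S rho => 2 ^ sw S %/ sF S + 1) by apply: UDefF_addx => //; apply: SF_nat.
have b1 S : okS S -> forall j, 2 ^ sw S %/ sF S + 1 + minn j (sJ S) < sSm S.
  move=> ok j; have := sp_Sm j ok; rewrite /sp /modulus; have := bF0 (okS_big ok); nia.
have h1' : SF a (fun S rho => 2 ^ sw S %/ sF S + 1).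
  by split=> // S ok rho _ _; have := b1 S ok 0; rewrite min0n addn0.
have h2 : SF a (fun S rho => 2 ^ sw S %/ sF S + 1 + minn (f S rho) (sJ S)).
  split=> [|S ok rho _ _]; last exact: b1.
  by apply: UDefF_addx => //; apply: SF_minr => //; apply: SF_J.
have h3 : SF a (fun S rho => sF S * (2 ^ sw S %/ sF S + 1 + minn (f S rho) (sJ S))).
  split=> [|S ok rho _ _]; first exact: UDefF_mulx.
  by have := sp_Sm (f S rho) ok; rewrite /sp /modulus; lia.
by apply: UDefF_addx => //; apply: SF_nat.
Qed.

Lemma SF_modp a f g : a <= 30 -> UDefF a f -> UDefF a g ->
  SF a (fun S rho => f S rho %% sp S (g S rho)).
Proof. by move=> le hf hg; apply: SF_mod => //; [apply: SF_sp|move=> S _ rho; apply: sp_gt0]. Qed.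

Lemma SF_iter a f L s0 : a <= 22 -> SF a.+2 f -> UDefF a L -> SF a s0 ->
  (forall S, okS S -> forall rho, L S rho <= srs S ^ 20) ->
  SF a (fun S rho => iteri (L S rho) (fun j s => f S (j :: s :: rho)) (s0 S rho)).
Proof.
move=> le [f1 f2] hL [s1 s2] hl.
have lU S : okS S -> srs S ^ 20 < sU S.
  by case=> _ _ _ _ /andP[/andP[_ rs1] h]; apply: leq_ltn_trans h; rewrite leq_exp2l.
have SmU S : okS S -> sSm S <= sU S.
  by move=> ok; have := bSm (okS_big ok); have : 0 < sSm S by [rewrite expn_gt0]; nia.
have bnd S : okS S -> forall rho, size rho = a -> bounded (sU S) rho -> forall n, n <= srs S ^ 20 ->
    iteri n (fun j s => f S (j :: s :: rho)) (s0 S rho) < sSm S.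
  move=> ok rho sr b; elim=> [|n IH] lt /=; first exact: s2.
  apply: f2 => //=; [by rewrite sr|apply/and3P; split=> //].
    exact: leq_trans lt (ltnW (lU _ ok)).
  exact: leq_trans (IH (ltnW lt)) (SmU _ ok).
split; last by move=> S ok rho sr b; apply: bnd => //; apply: hl.
apply: UDefF_ext (UDefF_loop le f1 hL s1) => S ok rho sr b; rewrite /loop.
rewrite (minn_idPl (hl S ok rho)) (modn_small (s2 S ok rho sr b)).
have := hl S ok rho; elim: (L S rho) => [//|n IH] lt /=.
rewrite IH; last exact: ltnW.
by rewrite modn_small //; apply: (bnd _ _ _ _ _ n.+1).
Qed.

Lemma UDef_comp1 m a f P : m + a <= 34 -> UDefF (m + a) f -> UDef a.+1 P ->
  UDef (m + a) (fun S rho => P S (f S rho :: drop m rho)).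
Proof.
move=> le hf hP; pose s := 0 :: iota m.+1 a.
have hs := @UDef_ren (m + a).+1 s P.
rewrite /= size_iota in hs; have l3 : a < 39 by lia.
have l4 : m + a <= 36 by lia.
have := UDef_let l4 hf (hs l3 hP); apply: UDef_ext => S ok rho sr b.
rewrite /= -[m.+1]addn1 addnC iotaDl -map_comp (eq_map (_ : _ =1 nth 0 rho)) //.
have E : [seq nth 0 rho i | i <- iota m a] = drop m rho.
  by rewrite map_nth_iota ?take_oversize ?size_drop ?sr ?addKn.
by rewrite E.
Qed.

(** * Definability of the quotient *)

Lemma div_exp_bit x i : x %/ 2 ^ i = 2 * (x %/ 2 ^ i.+1) + bit x i.
Proof.
rewrite /bit expnSr divnMA; move: (x %/ _) => y.
by rewrite {1}(divn_eq y 2) modn2 mulnC.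
Qed.

Lemma mod_exp_bit x i : x %% 2 ^ i.+1 = x %% 2 ^ i + bit x i * 2 ^ i.
Proof.
have h := divn_eq x (2 ^ i); rewrite div_exp_bit in h.
have h' := divn_eq x (2 ^ i.+1); rewrite !expnS in h h' *.
move: h h'; move: (x %/ _) (x %% 2 ^ i) (x %% (2 * 2 ^ i)) => q r1 r2 h h'.
by lia.
Qed.

(** Addition column by column: a bit of a sum of numbers that are too long to be stored is found by
    a loop whose only state is the carry. *)
Lemma carry_sum J c z t :
  iteri t (fun i s => (s + \sum_(j < J) bit (z j) i) %/ 2) c = (c + \sum_(j < J) z j %% 2 ^ t) %/ 2 ^ t.
Proof.
elim: t => [|t IH] /=.
  by rewrite expn0 divn1 big1 ?addn0 // => j _; rewrite modn1.
have -> : \sum_(j < J) z j %% 2 ^ t.+1 = \sum_(j < J) (z j %% 2 ^ t + bit (z j) t * 2 ^ t).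
  by apply: eq_bigr => j _; rewrite mod_exp_bit.
rewrite IH big_split /= -big_distrl /= addnA expnSr divnMA.
by rewrite [_ + _ * 2 ^ t]addnC divnMDl ?expn_gt0 // addnC.
Qed.

Lemma UDefF_beh2 b f : b <= 30 -> UDefF b f -> UDefF b.+2 (fun S rho => f S (behead (behead rho))).
Proof.
move=> le h; have le' : b <= 38 by lia.
by apply: UDefF_ext (UDefF_drop 2 le' h) => S ok [|x [|y rho]] //= _ _; rewrite drop0.
Qed.

Lemma UDefF_beh1 b f : b <= 30 -> UDefF b f -> UDefF b.+1 (fun S rho => f S (behead rho)).
Proof.
move=> le h; have le' : b <= 38 by lia.
by apply: UDefF_ext (UDefF_drop 1 le' h) => S ok [|x rho] //= _ _; rewrite drop0.
Qed.

Lemma UDef_comp12 m a f P : m + a <= 30 -> UDefF (m + a).+2 f -> UDef a.+1 P ->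
  UDef (m + a).+2 (fun S rho => P S (f S rho :: drop m (behead (behead rho)))).
Proof.
move=> le hf hP; have le' : m.+2 + a <= 34 by lia.
by apply: UDef_ext (UDef_comp1 le' hf hP) => S ok [|x [|y rho]].
Qed.

(** The inner reduction changes nothing on the states that occur; it makes the product exact for
    arbitrary states, on which the step function has to be definable too. The same device recurs in
    the loops below. *)
Definition mpow S e j := iteri (minn e (sT S)) (fun _ s => (2 * (s %% sp S j)) %% sp S j) (1 %% sp S j).

Lemma mpowE S e j : mpow S e j = 2 ^ minn e (sT S) %% sp S j.
Proof. by rewrite /mpow; elim: (minn _ _) => //= n ->; rewrite modn_mod modnMmr expnS. Qed.

Lemma SF_mpow b f g : b <= 20 -> UDefF b f -> UDefF b g ->
  SF b (fun S rho => mpow S (f S rho) (g S rho)).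
Proof.
move=> le hf hg; have l2 : b.+2 <= 30 by lia.
have l : b <= 30 by lia.
have hg2 := UDefF_beh2 l hg.
apply: (@SF_iter b (fun S rho => (2 * (nth 0 rho 1 %% sp S (g S (behead (behead rho))))) %%
  sp S (g S (behead (behead rho)))) (fun S rho => minn (f S rho) (sT S)) (fun S rho => 1 %% sp S (g S rho))).
- by lia.
- apply: SF_modp => //; apply: UDefF_mulx => //; first exact: SF_nat.
  by apply: SF_modp => //; apply: UDefF_var.
- by apply: SF_U; apply: SF_minr => //; apply: SF_T.
- by apply: SF_modp => //; apply: UDefF_nat.
by move=> S ok rho; apply: leq_trans (bTrs (okS_big ok)); apply: geq_minr.
Qed.

Definition mprod S n0 n j := iteri (minn n (sJ S))
  (fun l s => (s %% sp S j * sp S (minn n0 (sJ S) + minn l (sJ S))) %% sp S j) (1 %% sp S j).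

Lemma spE S j : j <= sJ S -> sp S j = modulus (sw S) (sF S) j.
Proof. by move=> le; rewrite /sp (minn_idPl le). Qed.

Lemma mprodE S n0 n j : n0 + n <= sJ S ->
  mprod S n0 n j = (\prod_(l < n) modulus (sw S) (sF S) (n0 + l)) %% sp S j.
Proof.
move=> le; rewrite /mprod (minn_idPl _); last by lia.
elim: n le => [|n IH] le; first by rewrite /= big_ord0.
rewrite /= IH ?big_ord_recr ?modn_mod /=; last by lia.
rewrite modnMml; congr ((_ * _) %% _); rewrite -spE; last by lia.
by congr (sp S _); lia.
Qed.

Lemma SF_mprod b f0 f g : b <= 20 -> UDefF b f0 -> UDefF b f -> UDefF b g ->
  SF b (fun S rho => mprod S (f0 S rho) (f S rho) (g S rho)).
Proof.
move=> le hf0 hf hg; have l2 : b.+2 <= 30 by lia.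
have l : b <= 30 by lia.
have hg2 := UDefF_beh2 l hg; have hf2 := UDefF_beh2 l hf0.
apply: (@SF_iter b (fun S rho => (nth 0 rho 1 %% sp S (g S (behead (behead rho))) *
  sp S (minn (f0 S (behead (behead rho))) (sJ S) + minn (nth 0 rho 0) (sJ S))) %%
  sp S (g S (behead (behead rho)))) (fun S rho => minn (f S rho) (sJ S)) (fun S rho => 1 %% sp S (g S rho))).
- by lia.
- apply: SF_modp => //; apply: UDefF_mulx => //.
    by apply: SF_modp => //; apply: UDefF_var.
  apply: SF_sp => //; apply: UDefF_addx => //; apply: SF_minr => //; try exact: SF_J.
  exact: UDefF_var.
- by apply: SF_U; apply: SF_minr => //; apply: SF_J.
- by apply: SF_modp => //; apply: UDefF_nat.
by move=> S ok rho; apply: leq_trans (bJrs (okS_big ok)); apply: geq_minr.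
Qed.

Definition mcofactor S j := iteri (sJ S)
  (fun l s => if l == j then s %% sp S j else (s %% sp S j * sp S l) %% sp S j) (1 %% sp S j).

Lemma mcofactorE S j : bigS S -> j < sJ S ->
  mcofactor S j = (Pprod (sw S) (sM S) (sr S) (sF S) %/ modulus (sw S) (sF S) j) %% sp S j.
Proof.
move=> b lt; rewrite /Pprod -(bJ b) (bigD1 (Ordinal lt)) //= mulKn ?modulus_gt0 //.
have H n : n <= sJ S -> iteri n (fun l s => if l == j then s %% sp S j else
    (s %% sp S j * sp S l) %% sp S j) (1 %% sp S j) =
    (\prod_(l < n | val l != j) modulus (sw S) (sF S) l) %% sp S j.
  elim: n => [|n IH] le; first by rewrite /= big_ord0.
  rewrite /= (IH (ltnW le)) [in RHS]big_mkcond big_ord_recr -big_mkcond /= modn_mod.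
  case: eqP => _ /=; first by rewrite muln1.
  by rewrite modnMml spE // ltnW.
by rewrite /mcofactor H //; congr (_ %% _); apply: eq_bigl => l; rewrite -val_eqE.
Qed.

Lemma SF_mcofactor b g : b <= 20 -> UDefF b g -> SF b (fun S rho => mcofactor S (g S rho)).
Proof.
move=> le hg; have l2 : b.+2 <= 30 by lia.
have l : b <= 30 by lia.
have hg2 := UDefF_beh2 l hg.
apply: (@SF_iter b (fun S rho => if nth 0 rho 0 == g S (behead (behead rho)) then
    nth 0 rho 1 %% sp S (g S (behead (behead rho))) else
    (nth 0 rho 1 %% sp S (g S (behead (behead rho))) * sp S (nth 0 rho 0)) %% sp S (g S (behead (behead rho))))
  (fun S rho => sJ S) (fun S rho => 1 %% sp S (g S rho))).
- by lia.
- have h1 := SF_modp l2 (UDefF_var _ 1) hg2.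
  apply: SF_if => //; first exact: (UDef_eq l2 (UDefF_var _ 0) hg2).
  apply: SF_modp => //; apply: UDefF_mulx => //; apply: SF_sp => //; exact: UDefF_var.
- by apply: SF_U; apply: SF_J.
- by apply: SF_modp => //; apply: UDefF_nat.
by move=> S ok rho; apply: bJrs (okS_big ok).
Qed.

Section Residue.
Variables (a : nat) (X : pred_t).
Hypotheses (hX : UDef a.+1 X).

(** Horner's rule from the leading bit; the long number is given only through the predicate [X] for
    its bits. *)
Definition mres S j rho :=
  iteri (sN S) (fun i s => (2 * (s %% sp S j) + X S (sN S - 1 - i :: rho)) %% sp S j) 0.

Lemma mresE S j rho x : x < 2 ^ sN S -> (forall i, i < sN S -> X S (i :: rho) = bit x i) ->
  mres S j rho = x %% sp S j.
Proof.
move=> lt h; have H n : n <= sN S -> iteri n (fun i s =>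
    (2 * (s %% sp S j) + X S (sN S - 1 - i :: rho)) %% sp S j) 0 = (x %/ 2 ^ (sN S - n)) %% sp S j.
  elim: n => [|n IH] le; first by rewrite subn0 divn_small // mod0n.
  rewrite /= (IH (ltnW le)) modn_mod h; last by lia.
  rewrite [in RHS]div_exp_bit.
  have -> : (sN S - n.+1).+1 = sN S - n by lia.
  have -> : sN S - 1 - n = sN S - n.+1 by lia.
  by rewrite -modnDml modnMmr modnDml.
by rewrite /mres H // subnn divn1.
Qed.

Lemma SF_mres m g : m + a <= 20 -> UDefF (m + a) g ->
  SF (m + a) (fun S rho => mres S (g S rho) (drop m rho)).
Proof.
move=> le hg; have l2 : (m + a).+2 <= 30 by lia.
have l : m + a <= 30 by lia.
have hg2 := UDefF_beh2 l hg.
apply: (@SF_iter (m + a) (fun S rho => (2 * (nth 0 rho 1 %% sp S (g S (behead (behead rho)))) +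
    X S (sN S - 1 - nth 0 rho 0 :: drop m (behead (behead rho)))) %% sp S (g S (behead (behead rho))))
  (fun S rho => sN S) (fun S rho => 0)).
- by lia.
- apply: SF_modp => //; apply: UDefF_addx => //.
    split=> [|S ok rho sr b].
      by apply: UDefF_mulx => //; [apply: SF_nat|apply: SF_modp => //; apply: UDefF_var].
    have := sp_lt (g S (behead (behead rho))) ok; have B := okS_big ok.
    have := ltn_pmod (nth 0 rho 1) (sp_gt0 S (g S (behead (behead rho)))).
    have : 2 ^ (sw S + 3) <= sSm S by rewrite /sSm leq_exp2l // (bfw B) (bw B); have := bg B; lia.
    by rewrite !addnS !expnS addn0; lia.
  apply: SF_bool => //; apply: UDef_comp12 => //; apply: SF_U.
  by apply: SF_sub => //; [apply: SF_sub => //; [apply: SF_N|apply: UDefF_nat]|apply: UDefF_var].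
- by apply: SF_U; apply: SF_N.
- exact: SF_nat.
by move=> S ok rho; have B := okS_big ok; have := bTrs B; rewrite (bT B); lia.
Qed.

End Residue.

Section Reciprocal.
Variables (a : nat) (Y : pred_t).
Hypotheses (hY : UDef a.+1 Y).

(** The bit length: the state is one more than the position of the last bit 1 met on the way up. *)
Definition blen S rho := iteri (sN S) (fun i s => if Y S (i :: rho) then minn i (sN S) + 1 else minn s (sN S)) 0.

Lemma blenE S rho y : y < 2 ^ sN S -> (forall i, i < sN S -> Y S (i :: rho) = bit y i) -> 0 < y ->
  [/\ y < 2 ^ blen S rho, 2 ^ blen S rho <= 2 * y & blen S rho <= sN S].
Proof.
move=> lt h y0; have H n : n <= sN S -> let s := iteri n (fun i s => if Y S (i :: rho) then
    minn i (sN S) + 1 else minn s (sN S)) 0 in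
    [/\ s <= n, y %% 2 ^ n < 2 ^ s & (s == 0) || bit y s.-1].
  elim: n => [|n IH] le /=; first by rewrite modn1.
  have [h1 h2 h3] := IH (ltnW le); rewrite h //; case: ifP => bt.
    rewrite (minn_idPl (ltnW le)) addn1 bt orbT; split=> //.
    by rewrite ltn_mod expn_gt0.
  rewrite (minn_idPl _); last by lia.
  by rewrite mod_exp_bit bt mul0n addn0; split=> //; apply: leqW.
have := H (sN S) (leqnn _); rewrite /= -/(blen S rho) modn_small // => -[h1 h2 h3]; split=> //.
case: (posnP (blen S rho)) h2 h3 => [->|s0]; first by rewrite expn0; lia.
move=> _ /= bt.
have : 2 ^ (blen S rho).-1 <= y.
  by rewrite leqNgt; apply/negP => lt'; rewrite bit_small in bt.
by rewrite -{2}(prednK s0) expnS; lia.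
Qed.

Lemma SF_blen m : m + a <= 20 -> SF (m + a) (fun S rho => blen S (drop m rho)).
Proof.
move=> le; have l2 : (m + a).+2 <= 30 by lia.
apply: (@SF_iter (m + a) (fun S rho => if Y S (nth 0 rho 0 :: drop m (behead (behead rho))) then
    minn (nth 0 rho 0) (sN S) + 1 else minn (nth 0 rho 1) (sN S)) (fun S rho => sN S) (fun S rho => 0)).
- by lia.
- apply: SF_if => //; first by apply: UDef_comp12 => //; [lia|apply: UDefF_var].
    split=> [|S ok rho _ _].
      apply: UDefF_addx => //; last exact: SF_nat.
      by apply: SF_minr => //; [apply: UDefF_var|apply: SF_N].
    by have B := okS_big ok; have := bTsm B; rewrite (bT B); have := geq_minr (nth 0 rho 0) (sN S); lia.
  by apply: SF_minr => //; [apply: UDefF_var|apply: SF_N].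
- by apply: SF_U; apply: SF_N.
- exact: SF_nat.
by move=> S ok rho; have B := okS_big ok; have := bTrs B; rewrite (bT B); lia.
Qed.

(** The bits from the leading one downwards are shifted in, followed by zeros if there are fewer
    than [sg], so short numbers are normalized as well. *)
Definition btop S rho := iteri (sg S) (fun i s => (2 * (s %% 2 ^ sg S) +
  ((i < blen S rho) && Y S (blen S rho - 1 - i :: rho))) %% 2 ^ sg S) 0.

Lemma btopE S rho y : y < 2 ^ sN S -> (forall i, i < sN S -> Y S (i :: rho) = bit y i) -> 0 < y ->
  btop S rho = topY (sg S) y (blen S rho).
Proof.
move=> lt h y0; have [h1 h2 h3] := blenE lt h y0.
rewrite /btop /topY; move: (blen S rho) h1 h2 h3 => lam h1 h2 h3.
have L0 : 0 < 2 ^ lam by rewrite expn_gt0.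
have H n : n <= sg S -> iteri n (fun i s => (2 * (s %% 2 ^ sg S) +
  ((i < lam) && Y S (lam - 1 - i :: rho))) %% 2 ^ sg S) 0 = (y * 2 ^ n) %/ 2 ^ lam.
  elim: n => [|n IH] le /=; first by rewrite expn0 muln1 divn_small.
  have B k : k <= sg S -> (y * 2 ^ k) %/ 2 ^ lam < 2 ^ sg S.
    move=> lek; rewrite ltn_divLR //; apply: leq_trans (_ : 2 ^ lam * 2 ^ k <= _).
      by rewrite ltn_mul2r expn_gt0 h1.
    by rewrite mulnC leq_mul2r leq_exp2l // lek orbT.
  rewrite (IH (ltnW le)) (modn_small (B _ (ltnW le))); have hb := B _ le.
  case: (ltnP n lam) => [ltn|gen] /=; last first.
    have e k : lam <= k -> (y * 2 ^ k) %/ 2 ^ lam = y * 2 ^ (k - lam).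
      by move=> lek; rewrite -{1}(subnK lek) expnD mulnA mulnK.
    rewrite (e _ (leqW gen)) in hb *; rewrite (e _ gen).
    by rewrite addn0 mulnCA -expnS -subSn // modn_small.
  have e k : k <= lam -> (y * 2 ^ k) %/ 2 ^ lam = y %/ 2 ^ (lam - k).
    by move=> lek; rewrite -{1}(subnK lek) expnD divnMr // expn_gt0.
  rewrite (e _ ltn) [y %/ 2 ^ (lam - n.+1)]div_exp_bit in hb *; rewrite (e _ (ltnW ltn)).
  have e1 : (lam - n.+1).+1 = lam - n by lia.
  have e2 : lam - 1 - n = lam - n.+1 by lia.
  by rewrite e1 in hb *; rewrite e2 h ?modn_small //; lia.
exact: H.
Qed.

Lemma SF_btop m : m + a <= 20 -> SF (m + a) (fun S rho => btop S (drop m rho)).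
Proof.
move=> le; have l2 : (m + a).+2 <= 30 by lia.
have l : m + a <= 30 by lia.
have hl := UDefF_beh2 l (SF_U (SF_blen le)).
apply: (@SF_iter (m + a) (fun S rho => (2 * (nth 0 rho 1 %% 2 ^ sg S) +
    ((nth 0 rho 0 < blen S (drop m (behead (behead rho)))) &&
     Y S (blen S (drop m (behead (behead rho))) - 1 - nth 0 rho 0 :: drop m (behead (behead rho))))) %% 2 ^ sg S)
  (fun S rho => sg S) (fun S rho => 0)).
- by lia.
- have h2 := SF_2g l2; have p2 : forall S, okS S -> forall rho : seq nat, 0 < 2 ^ sg S.
    by move=> S _ _; rewrite expn_gt0.
  apply: SF_mod => //; apply: UDefF_addx => //.
    split=> [|S ok rho sr b].
      apply: UDefF_mulx => //; [exact: SF_nat|apply: SF_mod => //; exact: UDefF_var].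
    have := ltn_pmod (nth 0 rho 1) (p2 S ok rho); have B := okS_big ok.
    have : 2 ^ (sg S + 1) <= sSm S by rewrite /sSm leq_exp2l // (bfw B) (bw B); have := bg B; lia.
    by rewrite addnS expnS addn0; lia.
  apply: SF_bool => //; apply: UDef_and; first by lia.
    exact: (UDef_lt l2 (UDefF_var _ 0) hl).
  apply: UDef_comp12 => //; apply: (UDefF_sub l2); last exact: UDefF_var.
  by apply: (UDefF_sub l2) => //; apply: UDefF_nat.
- by apply: SF_U; apply: SF_g.
- exact: SF_nat.
by move=> S ok rho; have B := okS_big ok; have := bTrs B; rewrite (bT B); have := bgN B; lia.
Qed.

Definition brec S rho := 2 ^ sw S %/ (btop S rho + 1).

Lemma brecE S rho y : bigS S -> y < 2 ^ sN S -> (forall i, i < sN S -> Y S (i :: rho) = bit y i) ->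
  0 < y -> brec S rho = recY (sg S) y (blen S rho).
Proof. by move=> b lt h y0; rewrite /brec /recY (btopE lt h y0) (bw b) addn1. Qed.

Lemma SF_brec m : m + a <= 20 -> SF (m + a) (fun S rho => brec S (drop m rho)).
Proof.
move=> le; have l : m + a <= 30 by lia.
apply: SF_div => //; first exact: SF_2w.
by apply: UDefF_addx => //; [apply: SF_btop|apply: SF_nat].
Qed.

End Reciprocal.

Lemma modn_sub c D p : 0 < p -> c <= D -> (D - c) %% p = (D %% p + (p - c %% p)) %% p.
Proof.
move=> p0 le; have h := ltn_pmod c p0.
have E : D + (p - c %% p) = (c %/ p).+1 * p + (D - c).
  by have := divn_eq c p; rewrite mulSn; move: (c %/ p * p) (c %% p) h => A B; lia.
by rewrite modnDml E modnMDl.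
Qed.

Lemma coprime_mcofactor S j : okS S -> j < sJ S -> coprime (mcofactor S j) (sp S j).
Proof.
move=> ok lt; have b := okS_big ok; rewrite (mcofactorE b lt) coprime_modl /Pprod -(bJ b).
rewrite (bigD1 (Ordinal lt)) //= mulKn ?modulus_gt0 // spE 1?ltnW //.
elim/big_rec: _ => [|i m ne IH]; first exact: coprime1n.
rewrite coprimeMl IH andbT.
by apply: (modulus_coprime (bF0 b) (bFd b) (bMw b) (bg b) (bwbig b) (brbig b) (bJsmall b) (bgN b));
  rewrite -?(bJ b).
Qed.

(** * Assembling one bit of [x1 x2 / y] from loops *)

Section Quotient.
Variables (a : nat) (X1 X2 Y : pred_t) (kf : fun_t).
Hypotheses (hX1 : UDef a.+1 X1) (hX2 : UDef a.+1 X2) (hY : UDef a.+1 Y) (hk : UDefF a kf).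

(* The quantities of [MulDiv], modulo the [j]-th modulus. *)
Definition qc S j rho := ((brec Y S rho %% sp S j * mres Y S j rho) %% sp S j *
  mpow S (sT S - blen Y S rho - sg S) j) %% sp S j.
Definition qE S i j rho := (mprod S (minn i (sJ S) * sM S) (sM S) j + (sp S j - qc S j rho)) %% sp S j.
Definition quu S j rho := (brec Y S rho %% sp S j *
  mpow S (sT S - blen Y S rho - sg S - kf S rho - 1) j) %% sp S j.
Definition qQ S j rho := iteri (sr S) (fun i s => ((qE S i j rho * (s %% sp S j)) %% sp S j +
  (mprod S 0 (minn i (sJ S) * sM S) j * quu S j rho) %% sp S j) %% sp S j) 0.
Definition qA S j rho := ((mres X1 S j rho * mres X2 S j rho) %% sp S j * qQ S j rho) %% sp S j.
(** The Bezout coefficient only names the solution of [h * mcofactor = qA] modulo the modulus; the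
    formula in [SF_qh] guesses the solution instead of running Euclid's algorithm. *)
Definition qh S j0 rho := let j := minn j0 (sJ S - 1) in
  (qA S j rho * (egcdn (mcofactor S j) (sp S j)).1) %% sp S j.
(** Bit [t] of [2^(sT + 1) h / p] rounded down depends only on the residue of [2^(sT - t) h] modulo
    [p]: it tells whether that residue is at least [p / 2]. *)
Definition qfrac S t j rho := (2 * ((mpow S (sT S - t) j * qh S j rho) %% sp S j)) %/ sp S j.
Definition qcol S t rho := iteri (sJ S) (fun j s => minn s (sJ S) + qfrac S t j rho) 0.
(** The initial carry is the summand [J + 1] of [Vnum]. After [sT = 4 N] columns, carry plus column
    sum has the parity of [Vnum / 2^(4 N)]. *)
Definition qcarry S rho := iteri (sT S) (fun t s => (minn s (sJ S + 1) + qcol S t rho) %/ 2) (sJ S + 1).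
Definition qbit S rho := odd (qcarry S rho + qcol S (sT S) rho).

Lemma SF_kf m : m + a <= 20 -> UDefF (m + a) (fun S rho => kf S (drop m rho)).
Proof. by move=> le; apply: UDefF_drop => //; lia. Qed.

Lemma SF_qc m g : m + a <= 20 -> UDefF (m + a) g ->
  SF (m + a) (fun S rho => qc S (g S rho) (drop m rho)).
Proof.
move=> le hg; have l : m + a <= 30 by lia.
apply: SF_modp => //; apply: UDefF_mulx => //.
  apply: SF_modp => //; apply: UDefF_mulx => //; last exact: (SF_mres hX1 le hg) || exact: (SF_mres hY le hg).
  by apply: SF_modp => //; apply: SF_U; apply: SF_brec hY _ le.
apply: SF_mpow => //; apply: SF_U; apply: SF_sub => //; last exact: SF_U (SF_g _).
by apply: SF_sub => //; [apply: SF_T|apply: SF_U; apply: SF_blen hY _ le].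
Qed.

Lemma SF_iM b f : b <= 30 -> UDefF b f -> UDefF b (fun S rho => minn (f S rho) (sJ S) * sM S).
Proof.
move=> le hf; apply: UDefF_mulx => //; last exact: SF_M.
by apply: SF_minr => //; apply: SF_J.
Qed.

Lemma SF_qE m f g : m + a <= 20 -> UDefF (m + a) f -> UDefF (m + a) g ->
  SF (m + a) (fun S rho => qE S (f S rho) (g S rho) (drop m rho)).
Proof.
move=> le hf hg; have l : m + a <= 30 by lia.
apply: SF_modp => //; apply: UDefF_addx => //.
  apply: SF_mprod => //; first exact: SF_iM.
  exact: SF_U (SF_M _).
by apply: SF_sub => //; [apply: SF_sp|apply: SF_U; apply: SF_qc].
Qed.

Lemma SF_quu m g : m + a <= 20 -> UDefF (m + a) g ->
  SF (m + a) (fun S rho => quu S (g S rho) (drop m rho)).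
Proof.
move=> le hg; have l : m + a <= 30 by lia.
apply: SF_modp => //; apply: UDefF_mulx => //.
  by apply: SF_modp => //; apply: SF_U; apply: SF_brec hY _ le.
apply: SF_mpow => //; apply: SF_U; apply: SF_sub => //; last exact: UDefF_nat.
apply: SF_sub => //; last exact: SF_kf.
apply: SF_sub => //; last exact: SF_U (SF_g _).
by apply: SF_sub => //; [apply: SF_T|apply: SF_U; apply: SF_blen hY _ le].
Qed.

Lemma SF_qQ m g : m + a <= 18 -> UDefF (m + a) g ->
  SF (m + a) (fun S rho => qQ S (g S rho) (drop m rho)).
Proof.
move=> le hg; have l : m + a <= 30 by lia.
have l2 : m.+2 + a <= 20 by lia.
have l2' : m.+2 + a <= 30 by lia.
have hg2 : UDefF (m.+2 + a) _ := UDefF_beh2 l hg.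
have hv j : UDefF (m.+2 + a) (fun S rho => nth 0 rho j) := UDefF_var _ j.
apply: (@SF_iter (m + a) (fun S rho => ((qE S (nth 0 rho 0) (g S (behead (behead rho))) (drop m.+2 rho) *
    (nth 0 rho 1 %% sp S (g S (behead (behead rho))))) %% sp S (g S (behead (behead rho))) +
  (mprod S 0 (minn (nth 0 rho 0) (sJ S) * sM S) (g S (behead (behead rho))) *
     quu S (g S (behead (behead rho))) (drop m.+2 rho)) %% sp S (g S (behead (behead rho)))) %%
   sp S (g S (behead (behead rho)))) (fun S rho => sr S) (fun S rho => 0)).
- by lia.
- apply: (SF_modp l2' _ hg2); apply: UDefF_addx => //.
    apply: (SF_modp l2' _ hg2); apply: UDefF_mulx => //; first exact: (SF_qE l2 (hv 0) hg2).
    exact: (SF_modp l2' (hv 1) hg2).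
  apply: (SF_modp l2' _ hg2); apply: UDefF_mulx => //; last exact: (SF_quu l2 hg2).
  apply: (SF_mprod l2 _ _ hg2); first exact: UDefF_nat.
  exact: (SF_iM l2' (hv 0)).
- exact: SF_U (SF_r _).
- exact: SF_nat.
by move=> S ok rho; have b := okS_big ok; apply: leq_trans (sr_J b) (bJrs b).
Qed.

Lemma SF_qA m g : m + a <= 18 -> UDefF (m + a) g ->
  SF (m + a) (fun S rho => qA S (g S rho) (drop m rho)).
Proof.
move=> le hg; have l : m + a <= 30 by lia.
have l2 : m + a <= 20 by lia.
apply: SF_modp => //; apply: UDefF_mulx => //; last exact: SF_qQ.
apply: SF_modp => //; apply: UDefF_mulx => //; [exact: (SF_mres hX1 l2 hg)|exact: (SF_mres hX2 l2 hg)].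
Qed.

(** The cofactor is invertible modulo the modulus, so the congruence has exactly one solution below
    it, and the condition on the left can serve as a definition. *)
Lemma qhP S j0 rho z : okS S -> let j := minn j0 (sJ S - 1) in
  (z < sp S j) && (((z %% sp S j) * mcofactor S j) %% sp S j == qA S j rho) = (z == qh S j0 rho).
Proof.
move=> ok; rewrite /qh; set j := minn _ _ => /=.
have b := okS_big ok; have J0 : 0 < sJ S by apply: leq_trans (sM_J b); apply: bM0.
have lt : j < sJ S by rewrite /j; lia.
have := coprime_mcofactor ok lt; rewrite /coprime => /eqP cop.
have p0 := sp_gt0 S j; set p := sp S j in cop p0 *; set W := mcofactor S j in cop *.
have p1 : 1 < p.
  have h := modulus_gt (bF0 b) (bMw b) (bg b) (bwbig b) (brbig b) (bJsmall b) (bgN b) j.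
  by rewrite /p (spE (ltnW lt)); apply: leq_ltn_trans h; rewrite expn_gt0.
have W0 : 0 < W by rewrite lt0n; apply/eqP => e; rewrite e gcd0n in cop; rewrite cop in p1.
have [u v huv _] := egcdnP p W0; rewrite cop in huv.
have A_lt : qA S j rho < p by rewrite ltn_mod.
have uW x : (x * (u * W)) %% p = x %% p by rewrite huv mulnDr mulnA muln1 modnMDl.
apply/andP/eqP => [[zp /eqP e]|->].
  by rewrite modnMml in e; rewrite -[LHS](modn_small zp) -uW -e modnMml /= -mulnA [W * u]mulnC.
split; first by rewrite ltn_mod.
by rewrite modn_mod modnMml -mulnA uW modn_small.
Qed.

Lemma SF_qh m g : m + a <= 17 -> UDefF (m + a) g ->
  SF (m + a) (fun S rho => qh S (g S rho) (drop m rho)).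
Proof.
move=> le hg; have l : m + a <= 30 by lia.
have bnd S : okS S -> forall j rho, qh S j rho < sSm S.
  by move=> ok j rho; apply: ltn_trans (ltn_pmod _ (sp_gt0 _ _)) (sp_Sm _ ok).
split=> [|S ok rho _ _]; last exact: bnd.
have l1 : m.+1 + a <= 30 by lia.
have l1' : m.+1 + a <= 20 by lia.
have l2 : m.+1 + a <= 18 by lia.
have hg1 : UDefF (m.+1 + a) (fun S rho => minn (g S (behead rho)) (sJ S - 1)).
  apply: SF_U; apply: SF_minr => //; first exact: (UDefF_beh1 l hg).
  by apply: SF_sub => //; [apply: SF_J|apply: UDefF_nat].
have hv : UDefF (m.+1 + a) (fun S rho => nth 0 rho 0) := UDefF_var _ 0.
have hR : UDef (m.+1 + a) (fun S rho => (nth 0 rho 0 < sp S (minn (g S (behead rho)) (sJ S - 1))) &&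
    (((nth 0 rho 0 %% sp S (minn (g S (behead rho)) (sJ S - 1))) *
       mcofactor S (minn (g S (behead rho)) (sJ S - 1))) %% sp S (minn (g S (behead rho)) (sJ S - 1)) ==
       qA S (minn (g S (behead rho)) (sJ S - 1)) (drop m.+1 rho))).
  apply: UDef_and; first by lia.
    exact: (UDef_lt l1 hv (SF_U (SF_sp l1 hg1))).
  apply: (UDef_eq l1); last exact: SF_U (SF_qA l2 hg1).
  apply: SF_U; apply: (SF_modp l1 _ hg1); apply: (UDefF_mulx l1).
    exact: (SF_modp l1 hv hg1).
  exact: (SF_mcofactor l1' hg1).
apply: (UDefF_graph hR) => S ok rho sr b; split=> [|z hz]; last exact: qhP.
by apply: leq_trans (bnd S ok _ _) _; have := bSm (okS_big ok); have : 0 < sSm S by [rewrite expn_gt0]; nia.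
Qed.

Lemma qfrac_le1 S t j rho : qfrac S t j rho <= 1.
Proof.
rewrite -ltnS /qfrac ltn_divLR ?sp_gt0 // ltn_mul2l /=; exact: ltn_pmod (sp_gt0 _ _).
Qed.

Lemma SF_qfrac m f g : m + a <= 17 -> UDefF (m + a) f -> UDefF (m + a) g ->
  SF (m + a) (fun S rho => qfrac S (f S rho) (g S rho) (drop m rho)).
Proof.
move=> le hf hg; have l : m + a <= 30 by lia.
have l2 : m + a <= 20 by lia.
apply: (@SF_le _ _ (fun _ _ => 1)); [|exact: SF_nat|by move=> *; apply: qfrac_le1].
apply: (UDefF_div l); last exact: SF_U (SF_sp l hg).
apply: UDefF_mulx => //; first exact: SF_nat.
apply: SF_modp => //; apply: UDefF_mulx => //; last exact: SF_qh.
by apply: SF_mpow => //; apply: SF_U; apply: SF_sub => //; apply: SF_T.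
Qed.

Lemma SF_qcol m f : m + a <= 15 -> UDefF (m + a) f ->
  SF (m + a) (fun S rho => qcol S (f S rho) (drop m rho)).
Proof.
move=> le hf; have l : m + a <= 30 by lia.
have l2 : m.+2 + a <= 17 by lia.
have l2' : m.+2 + a <= 30 by lia.
have hf2 : UDefF (m.+2 + a) _ := UDefF_beh2 l hf.
have hv j : UDefF (m.+2 + a) (fun S rho => nth 0 rho j) := UDefF_var _ j.
apply: (@SF_iter (m + a) (fun S rho => minn (nth 0 rho 1) (sJ S) +
   qfrac S (f S (behead (behead rho))) (nth 0 rho 0) (drop m.+2 rho)) (fun S rho => sJ S) (fun S rho => 0)).
- by lia.
- split=> [|S ok rho _ _].
    apply: (UDefF_addx l2'); last exact: (SF_qfrac l2 hf2 (hv 0)).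
    by apply: (SF_minr l2' (hv 1)); apply: SF_J.
  have := qfrac_le1 S (f S (behead (behead rho))) (nth 0 rho 0) (drop m.+2 rho).
  by have := bJsm (okS_big ok); have := geq_minr (nth 0 rho 1) (sJ S); lia.
- exact: SF_U (SF_J _).
- exact: SF_nat.
by move=> S ok rho; apply: bJrs (okS_big ok).
Qed.

Lemma SF_J1 b : b <= 30 -> SF b (fun S rho => sJ S + 1).
Proof.
move=> le; split=> [|S ok rho _ _]; last by have := bJsm (okS_big ok); lia.
by apply: UDefF_addx => //; [apply: SF_J|apply: SF_nat].
Qed.

Lemma SF_qcarry : a <= 13 -> SF a qcarry.
Proof.
move=> le; have l : a <= 30 by lia.
have l2 : 2 + a <= 15 by lia.
have l2' : 2 + a <= 30 by lia.
have hv j : UDefF (2 + a) (fun S rho => nth 0 rho j) := UDefF_var _ j.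
have hc := SF_qcol l2 (hv 0).
have h1 : SF (2 + a) (fun S rho => minn (nth 0 rho 1) (sJ S + 1)).
  by apply: (SF_minr l2' (hv 1)); apply: SF_J1.
have H := @SF_iter a (fun S rho => (minn (nth 0 rho 1) (sJ S + 1) + qcol S (nth 0 rho 0) (drop 2 rho)) %/ 2)
  (fun S rho => sT S) (fun S rho => sJ S + 1).
have {}H : SF a (fun S rho => iteri (sT S) (fun j s => (minn s (sJ S + 1) + qcol S j (drop 0 rho)) %/ 2) (sJ S + 1)).
  apply: H; [by lia| |exact: SF_U (SF_T _)|exact: SF_J1|by move=> S ok rho; apply: bTrs (okS_big ok)].
  split=> [|S ok rho sr b].
    by apply: (UDefF_div l2'); [exact: (UDefF_addx l2' h1 hc)|exact: UDefF_nat].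
  have h2 := hc.2 S ok rho sr b; have h3 := h1.2 S ok rho sr b.
  by rewrite ltn_divLR //; lia.
case: H => h2 h3; split=> [|S ok rho sr b].
  apply: UDefF_ext h2 => S ok rho _ _; rewrite /qcarry; congr iteri.
  by rewrite drop0.
by have := h3 S ok rho sr b; rewrite /qcarry drop0.
Qed.

Theorem UDef_qbit : a <= 13 -> UDef a qbit.
Proof.
move=> le; have l : a <= 30 by lia.
have l15 : 0 + a <= 15 by lia.
have hc : SF a (fun S rho => qcol S (sT S) (drop 0 rho)) := SF_qcol l15 (SF_U (SF_T _)).
have h := UDefF_mod l (UDefF_addx l (SF_qcarry le) hc) (@UDefF_nat a 2 isT).
apply: UDef_ext (UDef_eq l h (@UDefF_nat a 1 isT)) => S ok rho _ _.
by rewrite drop0 modn2 /qbit; case: odd.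
Qed.

Section Correct.
Variables (S : setting) (rho : seq nat) (x1 x2 y k : nat).
Hypotheses (ok : okS S) (x1_lt : x1 < 2 ^ sN S) (x2_lt : x2 < 2 ^ sN S) (y_lt : y < 2 ^ sN S).
Hypotheses (X1E : forall i, i < sN S -> X1 S (i :: rho) = bit x1 i).
Hypotheses (X2E : forall i, i < sN S -> X2 S (i :: rho) = bit x2 i).
Hypotheses (YE : forall i, i < sN S -> Y S (i :: rho) = bit y i).
Hypotheses (y0 : 0 < y) (kN : k < sN S) (kE : kf S rho = k).
Let b := okS_big ok.
Let lam := blen Y S rho.
Let lam_lt : y < 2 ^ lam. Proof. by case: (blenE y_lt YE y0). Qed.
Let lam_le : 2 ^ lam <= 2 * y. Proof. by case: (blenE y_lt YE y0). Qed.
Let lamN : lam <= sN S. Proof. by case: (blenE y_lt YE y0). Qed.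
Let F0 := bF0 b.
Local Notation mw := (sw S).
Local Notation F := (sF S).

Lemma qcE j : qc S j rho = cE (sN S) (sg S) y lam %% sp S j.
Proof.
rewrite /qc /cE mpowE (mresE _ y_lt YE) (brecE b y_lt YE y0) -/lam (minn_idPl _); last by lia.
by rewrite modnMm -modnMml modnMm modnMml (bT b).
Qed.

Lemma quuE j : quu S j rho = uu (sN S) (sg S) y k lam %% sp S j.
Proof.
rewrite /quu /uu mpowE (brecE b y_lt YE y0) -/lam kE (minn_idPl _); last by lia.
by rewrite modnMml modnMmr (bT b).
Qed.

Lemma iM_le i : i < sr S -> i * sM S + sM S <= sJ S.
Proof. by move=> lt; rewrite (bJ b) addnC -mulSn leq_mul2r lt orbT. Qed.

Lemma qEE i j : i < sr S -> qE S i j rho = Eterm (sN S) mw (sg S) (sM S) F y lam i %% sp S j.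
Proof.
move=> lt; have h := iM_le lt; have iJ : i <= sJ S by apply: leq_trans (ltnW lt) (sr_J b).
rewrite /qE (minn_idPl iJ) mprodE // qcE /Eterm -modn_sub ?sp_gt0 //.
apply: leq_trans (Dprod_ge F0 (bMw b) (bg b) (bwbig b) (brbig b) (bJsmall b) (bgN b) i).
apply: ltnW; apply: (cE_lt F0 (bMw b) (bg b) (bwbig b) (brbig b) (bJsmall b) (bgN b) x1_lt x2_lt lam_lt lam_le lamN kN).
Qed.

Lemma qQE j : qQ S j rho = Qnum (sN S) mw (sg S) (sM S) F y k lam (sr S) %% sp S j.
Proof.
rewrite /qQ; have H i : i <= sr S -> iteri i (fun i s => ((qE S i j rho * (s %% sp S j)) %% sp S j +
  (mprod S 0 (minn i (sJ S) * sM S) j * quu S j rho) %% sp S j) %% sp S j) 0 =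
  Qnum (sN S) mw (sg S) (sM S) F y k lam i %% sp S j.
  elim: i => [|i IH] lt; first by rewrite /= mod0n.
  have h := iM_le lt; have iJ : i <= sJ S by apply: leq_trans (ltnW lt) (sr_J b).
  rewrite /= (IH (ltnW lt)) modn_mod (qEE _ lt) quuE (minn_idPl iJ) mprodE; last by lia.
  rewrite modnMm modnMm modnDm; congr ((_ + _ * _) %% _).
  by rewrite (eq_bigr (fun l : 'I_(i * sM S) => modulus mw F l)) ?prod_nat_mul // => l _; rewrite add0n.
exact: H.
Qed.

Lemma qAE j : qA S j rho = Anum (sN S) mw (sg S) (sM S) (sr S) F x1 x2 y k lam %% sp S j.
Proof. by rewrite /qA (mresE _ x1_lt X1E) (mresE _ x2_lt X2E) qQE modnMm -modnMml modnMm modnMml. Qed.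

Lemma qhE j : j < sJ S -> qh S j rho * (Pprod mw (sM S) (sr S) F %/ modulus mw F j)
  = Anum (sN S) mw (sg S) (sM S) (sr S) F x1 x2 y k lam %[mod modulus mw F j].
Proof.
move=> lt; have jE : minn j (sJ S - 1) = j by apply/minn_idPl; lia.
have := qhP j rho (qh S j rho) ok; rewrite /= jE eqxx => /andP[h1 /eqP].
by rewrite qAE (mcofactorE b lt) modnMmr (modn_small h1) spE // ltnW.
Qed.

Let z j := (2 ^ (4 * sN S).+1 * qh S j rho) %/ modulus mw F j.

Lemma qfracE t j : j < sJ S -> t <= sT S -> qfrac S t j rho = bit (z j) t.
Proof.
move=> lt le; have p0 := modulus_gt0 mw F j.
have pE : sp S j = modulus mw F j by rewrite spE // ltnW.
have f1 := qfrac_le1 S t j rho.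
rewrite /qfrac mpowE pE modnMml in f1 *; rewrite (minn_idPl (leq_subr _ _)) in f1 *.
rewrite /bit /z -divnMA [modulus _ _ _ * 2 ^ t]mulnC; set B := 2 ^ (sT S - t) * _ in f1 *.
have -> : 2 ^ (4 * sN S).+1 * qh S j rho = 2 ^ t * (2 * B).
  by rewrite /B !mulnA -expnSr -expnD (bT b); congr (_ ^ _ * _); rewrite (bT b) in le; lia.
rewrite divnMl ?expn_gt0 // {2}(divn_eq B (modulus mw F j)) mulnDr mulnA divnMDl // oddD oddM /=.
by case: (_ %/ _) f1 => [|[]].
Qed.

Lemma qcolE t : t <= sT S -> qcol S t rho = \sum_(j < sJ S) bit (z j) t.
Proof.
move=> le; rewrite /qcol; have H n : n <= sJ S -> iteri n (fun j s => minn s (sJ S) + qfrac S t j rho) 0 =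
    \sum_(j < n) bit (z j) t /\ \sum_(j < n) bit (z j) t <= n.
  elim: n => [|n IH] lt; first by rewrite /= big_ord0.
  have [h1 h2] := IH (ltnW lt); rewrite /= h1 big_ord_recr /= qfracE //; split.
    by rewrite (minn_idPl _) //; apply: leq_trans h2 (ltnW lt).
  by apply: (@leq_trans (n + 1)); rewrite ?addn1 // -addn1 leq_add // leq_b1.
by case: (H (sJ S)).
Qed.

Lemma qcarryE : qcarry S rho = (sJ S + 1 + \sum_(j < sJ S) z j %% 2 ^ sT S) %/ 2 ^ sT S.
Proof.
rewrite -carry_sum /qcarry; set J1 := sJ S + 1.
have cb n : \sum_(j < sJ S) bit (z j) n <= sJ S.
  apply: (@leq_trans (\sum_(j < sJ S) 1)); last by rewrite sum1_card card_ord.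
  by apply: leq_sum => j _; apply: leq_b1.
have H n : n <= sT S -> iteri n (fun t s => (minn s J1 + qcol S t rho) %/ 2) J1 =
    iteri n (fun i s => (s + \sum_(j < sJ S) bit (z j) i) %/ 2) J1 /\
    iteri n (fun i s => (s + \sum_(j < sJ S) bit (z j) i) %/ 2) J1 <= J1.
  elim: n => [|n IH] lt //=; have [h1 h2] := IH (ltnW lt).
  rewrite h1 (minn_idPl h2) (qcolE (ltnW lt)); split=> //.
  move: (cb n) h2; move: (\sum_(j < sJ S) bit (z j) n) (iteri n _ J1) => c s.
  by rewrite /J1 => h3 h4; rewrite -ltnS ltn_divLR //; lia.
by case: (H (sT S)).
Qed.

(** Each [z j] is split at bit [sT]. The low parts contribute the carry, and the high parts matter
    for the parity only through their lowest bit, which is the column [sT]. *)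
Theorem qbitE : qbit S rho = bit ((x1 * x2) %/ y) k.
Proof.
rewrite {1}/bit -(muldiv_correct F0 (bFd b) (bMw b) (bg b) (bwbig b) (brbig b) (bJsmall b) (bgN b)
  x1_lt x2_lt lam_lt lam_le lamN kN (h := fun j => qh S j rho)); last first.
  by move=> j; rewrite -(bJ b); apply: qhE.
rewrite /qbit qcolE // qcarryE /Vnum -(bJ b) -(bT b).
have -> : \sum_(j < sJ S) (2 ^ (sT S).+1 * qh S j rho) %/ modulus mw F j =
    \sum_(j < sJ S) z j %% 2 ^ sT S + (\sum_(j < sJ S) z j %/ 2 ^ sT S) * 2 ^ sT S.
  rewrite big_distrl -big_split /=; apply: eq_bigr => j _.
  by rewrite (bT b) -/(z j) {1}(divn_eq (z j) (2 ^ (4 * sN S))) addnC.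
set A := \sum_(j < _) _ %% _; set B := \sum_(j < _) _ %/ _.
have -> : A + B * 2 ^ sT S + (sJ S).+1 = B * 2 ^ sT S + (sJ S + 1 + A) by lia.
rewrite divnMDl ?expn_gt0 // [in RHS]addnC !oddD /B.
congr (_ (+) _); elim: (sJ S) => [|n IH]; first by rewrite !big_ord0.
by rewrite !big_ord_recr /= !oddD IH /bit oddb.
Qed.

End Correct.
End Quotient.

(** * One evaluation step of the large structure *)

Definition gtag S g m := (g %/ minn (2 ^ ((6 * m) %% sU S)) (sU S - 1)) %% 64.
(** Shaped for the diagonal: the advice [k], the constants, and as the two arguments this same
    advice together with the code [g]. *)
Definition genv S k g := k :: scs S ++ [:: k; g].
(** The order is that of the tags in [ttag]; tags from 12 on select an entry of the environment. *)
Definition gops D x y := [:: cst D Zero; cst D One; cst D MinusOne; cst D En; uop D Neg x; uop D Pow x;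
  bop D Add x y; bop D Mul x y; bop D Div x y; bop D Max x y; bop D Min x y; bop D Cap x y].

(* The value, after [h] evaluation rounds, of the node [m] of the term coded by [g]. *)
Fixpoint gval S h m k g := if h is h'.+1 then
    nth 0 (gops (sD S) (gval S h' ((2 * m) %% sU S) k g)
                       (gval S h' (((2 * m) %% sU S + 1) %% sU S) k g) ++ genv S k g) (gtag S g m)
  else 0.

Lemma gvalS S h m k g : gval S h.+1 m k g =
  nth 0 (gops (sD S) (gval S h ((2 * m) %% sU S) k g)
    (gval S h (((2 * m) %% sU S + 1) %% sU S) k g) ++ genv S k g) (gtag S g m).
Proof. by []. Qed.

Lemma sU_le S : okS S -> sU S <= 2 ^ 2 ^ sD S.
Proof. by move=> ok; rewrite /sU !leq_exp2l // (bdD (okS_big ok)). Qed.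

Lemma genv_bounded S k g : okS S -> k < sU S -> g < sU S -> bounded (sU S) (genv S k g).
Proof. by case=> _ _ h _ _ hk hg; rewrite /bounded /= hk all_cat /= hk hg !andbT. Qed.

Lemma gval_lt S h m k g : okS S -> k < sU S -> g < sU S -> gval S h m k g < 2 ^ 2 ^ sD S.
Proof.
move=> ok hk hg; elim: h m => [|h IH] m; first by rewrite expn_gt0.
rewrite gvalS; apply: bounded_nth; first by rewrite expn_gt0.
rewrite /bounded all_cat; apply/andP; split; last first.
  apply/allP => x /(allP (genv_bounded ok hk hg)) lt; exact: leq_trans lt (sU_le ok).
apply/allP => z; rewrite !inE; do ?[case/orP]; move=> /eqP->;
  first [exact: cst_lt|exact: uop_lt|by apply: bop_lt].
Qed.

Fixpoint allUDef a (Ps : seq pred_t) := if Ps is P :: Ps' then UDef a P /\ allUDef a Ps' else True.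

Lemma UDef_nth Ps a f : a <= 30 -> allUDef a Ps -> UDefF a f ->
  UDef a (fun S rho => nth false [seq (P : pred_t) S rho | P <- Ps] (f S rho)).
Proof.
move=> le; elim: Ps f => [|P Ps IH] f /=.
  by move=> _ _; apply: UDef_ext (UDef_const a false) => S _ rho _ _; rewrite nth_nil.
case=> hP hPs hf; have l : a <= 38 by lia.
have h1 := UDef_eq le hf (@UDefF_nat a 0 isT).
have h2 := IH _ hPs (UDefF_sub le hf (@UDefF_nat a 1 isT)).
apply: UDef_ext (UDef_or l (UDef_and l h1 hP) (UDef_and l (UDef_not l h1) h2)) => S ok rho _ _.
by case: (f S rho) => [|n] /=; rewrite ?subn1 ?orbF ?andbT.
Qed.

(* The bits of the two subterms; the environment is [idx; i; m; k; g]. *)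
Definition arg1 : pred_t := fun S r => sO S [:: nth 0 r 0; (2 * nth 0 r 2) %% sU S; nth 0 r 3; nth 0 r 4].
Definition arg2 : pred_t := fun S r =>
  sO S [:: nth 0 r 0; ((2 * nth 0 r 2) %% sU S + 1) %% sU S; nth 0 r 3; nth 0 r 4].
(** The number 1 given by its bits: a product is [x y / 1] and a quotient is [x 1 / y], both
    instances of [qbit]. *)
Definition argone : pred_t := fun S r => nth 0 r 0 == 0.

Lemma UDefF_child1 : UDefF 5 (fun S r => (2 * nth 0 r 2) %% sU S).
Proof. by apply: UDefF_mul => //; [apply: UDefF_nat|apply: UDefF_var]. Qed.

Lemma UDef_arg1 : UDef 5 arg1.
Proof.
have h := @UDef_comp [:: fun S r => nth 0 r 0; fun S r => (2 * nth 0 r 2) %% sU S;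
  fun S r => nth 0 r 3; fun S r => nth 0 r 4] 5 (fun S rho => sO S rho).
apply: h => //=; last exact: UDef_orc.
by split; [|split; [exact: UDefF_child1|split; [|split]]]; try exact: UDefF_var.
Qed.

Lemma UDef_arg2 : UDef 5 arg2.
Proof.
have h := @UDef_comp [:: fun S r => nth 0 r 0; fun S r => ((2 * nth 0 r 2) %% sU S + 1) %% sU S;
  fun S r => nth 0 r 3; fun S r => nth 0 r 4] 5 (fun S rho => sO S rho).
apply: h => //=; last exact: UDef_orc.
split; [exact: UDefF_var|split; [|by split; [exact: UDefF_var|split; [exact: UDefF_var|]]]].
by apply: UDefF_add => //; [exact: UDefF_child1|exact: UDefF_nat].
Qed.

Lemma UDef_argone : UDef 5 argone.
Proof. by apply: UDef_eq => //; [exact: UDefF_var|exact: UDefF_nat]. Qed.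

Definition gcarry S rho := iteri (minn (nth 0 rho 0) (sN S))
  (fun j s => (minn s 1 + arg1 S (j :: rho) + arg2 S (j :: rho)) %/ 2) 0.
(** A scan from the lowest bit; the last position at which the bits differ decides the
    comparison. *)
Definition glt S rho := iteri (sN S)
  (fun j s => if arg1 S (j :: rho) == arg2 S (j :: rho) then minn s 1 else arg2 S (j :: rho)) 0.
(** Bit [i] of [2^x] capped at [2^N - 1] is 1 in two cases: [x = i], compared bit by bit, or
    [x >= N = 2^sD], that is, [x] has a bit 1 at a position from [sD] on. *)
Definition gpow : pred_t := fun S rho =>
  [forall j : 'I_(sU S), (val j < sN S) ==> (arg1 S (val j :: rho) == bit (nth 0 rho 0) (val j))] ||
  [exists j : 'I_(sU S), (sD S <= val j) && (val j < sN S) && arg1 S (val j :: rho)].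

Lemma UDef_arg (P : pred_t) j : UDef 5 P -> UDef 6 (fun S rho => P S (nth 0 rho j :: drop 2 rho)).
Proof. by move=> h; apply: (@UDef_comp1 2 4) => //; apply: UDefF_var. Qed.

Lemma SF_gcarry : SF 4 gcarry.
Proof.
have H := @SF_iter 4 (fun S rho => (minn (nth 0 rho 1) 1 + arg1 S (nth 0 rho 0 :: drop 2 rho) +
  arg2 S (nth 0 rho 0 :: drop 2 rho)) %/ 2) (fun S rho => minn (nth 0 rho 0) (sN S)) (fun S rho => 0).
have {}H : SF 4 (fun S rho => iteri (minn (nth 0 rho 0) (sN S)) (fun j s =>
    (minn s 1 + arg1 S (j :: drop 0 rho) + arg2 S (j :: drop 0 rho)) %/ 2) 0).
  apply: H => //; last 1 first.
  - move=> S ok rho; have B := okS_big ok; have := bTrs B; rewrite (bT B).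
    by have := geq_minr (nth 0 rho 0) (sN S); lia.
  - apply: SF_div => //; last exact: UDefF_nat.
    have h1 : SF 6 (fun S rho => minn (nth 0 rho 1) 1).
      by apply: SF_minr => //; [apply: UDefF_var|apply: SF_nat].
    have h2 : SF 6 (fun S rho => arg1 S (nth 0 rho 0 :: drop 2 rho) : nat).
      by apply: SF_bool => //; apply: UDef_arg; apply: UDef_arg1.
    have h3 : SF 6 (fun S rho => arg2 S (nth 0 rho 0 :: drop 2 rho) : nat).
      by apply: SF_bool => //; apply: UDef_arg; apply: UDef_arg2.
    have h4 : SF 6 (fun S rho => minn (nth 0 rho 1) 1 + arg1 S (nth 0 rho 0 :: drop 2 rho)).
      apply: (@SF_le _ _ (fun _ _ => 2)); [exact: UDefF_addx|exact: SF_nat|].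
      by move=> S ok rho; have := geq_minr (nth 0 rho 1) 1; case: (arg1 _ _) => /=; lia.
    apply: (@SF_le _ _ (fun _ _ => 3)); [exact: UDefF_addx|exact: SF_nat|].
    by move=> S ok rho; have := geq_minr (nth 0 rho 1) 1; case: (arg1 _ _); case: (arg2 _ _) => /=; lia.
  - by apply: SF_U; apply: SF_minr => //; [apply: UDefF_var|apply: SF_N].
  - exact: SF_nat.
case: H => h2 h3; split=> [|S ok rho sr b].
  by apply: UDefF_ext h2 => S ok rho _ _; rewrite drop0.
by have := h3 S ok rho sr b; rewrite drop0.
Qed.

Lemma SF_glt : SF 4 glt.
Proof.
have H := @SF_iter 4 (fun S rho => if arg1 S (nth 0 rho 0 :: drop 2 rho) == arg2 S (nth 0 rho 0 :: drop 2 rho)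
  then minn (nth 0 rho 1) 1 else arg2 S (nth 0 rho 0 :: drop 2 rho)) (fun S rho => sN S) (fun S rho => 0).
have {}H : SF 4 (fun S rho => iteri (sN S) (fun j s =>
    if arg1 S (j :: drop 0 rho) == arg2 S (j :: drop 0 rho) then minn s 1 else arg2 S (j :: drop 0 rho)) 0).
  apply: H => //; last 1 first.
  - by move=> S ok rho; have B := okS_big ok; have := bTrs B; rewrite (bT B); lia.
  - have h1 := UDef_arg 0 UDef_arg1; have h2 := UDef_arg 0 UDef_arg2.
    have n1 := UDef_not (isT : 6 <= 38) h1; have n2 := UDef_not (isT : 6 <= 38) h2.
    have he := UDef_and (isT : 6 <= 38) (UDef_or (isT : 6 <= 38) n1 h2) (UDef_or (isT : 6 <= 38) h1 n2).
    apply: SF_if => //; last exact: SF_bool.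
      by apply: UDef_ext he => S _ rho _ _; case: (arg1 _ _); case: (arg2 _ _).
    by apply: SF_minr => //; [apply: UDefF_var|apply: SF_nat].
  - exact: SF_U (SF_N _).
  - exact: SF_nat.
case: H => h2 h3; split=> [|S ok rho sr b].
  by apply: UDefF_ext h2 => S ok rho _ _; rewrite drop0.
by have := h3 S ok rho sr b; rewrite drop0.
Qed.

Lemma UDef_gpow : UDef 4 gpow.
Proof.
have h1 := UDef_arg1; have l : 5 <= 38 by [].
have v0 : UDefF 5 (fun S rho => nth 0 rho 0) by apply: UDefF_var.
have v1 : UDefF 5 (fun S rho => nth 0 rho 1) by apply: UDefF_var.
have hN := UDef_lt (isT : 5 <= 30) v0 (SF_U (SF_N 5)).
apply: UDef_or => //.
  have hb := UDef_bit (isT : 5 <= 30) v1 v0.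
  have he : UDef 5 (fun S rho => (nth 0 rho 0 < sN S) ==> (arg1 S rho == bit (nth 0 rho 1) (nth 0 rho 0))).
    apply: (UDef_imp l hN).
    have he := UDef_and l (UDef_or l (UDef_not l h1) hb) (UDef_or l h1 (UDef_not l hb)).
    by apply: UDef_ext he => S _ rho _ _; case: (arg1 _ _); case: (bit _ _).
  exact: (@UDef_all 4 _ isT he).
have hD := UDef_leq (isT : 5 <= 30) (SF_U (SF_D 5)) v0.
exact: (@UDef_ex 4 _ isT (UDef_and l (UDef_and l hD hN) h1)).
Qed.

Definition gY0 : pred_t := fun S rho => [exists j : 'I_(sU S), (val j < sN S) && arg2 S (val j :: rho)].
Definition gk : fun_t := fun S rho => nth 0 rho 0.

Definition glist : seq pred_t := [:: fun _ _ => false; fun S rho => nth 0 rho 0 == 0; fun _ _ => true;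
  fun S rho => nth 0 rho 0 == sD S; fun S rho => ~~ arg1 S (nth 0 rho 0 :: rho); gpow;
  fun S rho => odd (gcarry S rho + arg1 S (nth 0 rho 0 :: rho) + arg2 S (nth 0 rho 0 :: rho));
  qbit arg1 arg2 argone gk; fun S rho => gY0 S rho && qbit arg1 argone arg2 gk S rho;
  fun S rho => if glt S rho == 1 then arg2 S (nth 0 rho 0 :: rho) else arg1 S (nth 0 rho 0 :: rho);
  fun S rho => if glt S rho == 1 then arg1 S (nth 0 rho 0 :: rho) else arg2 S (nth 0 rho 0 :: rho);
  fun S rho => arg1 S (nth 0 rho 0 :: rho) && arg2 S (nth 0 rho 0 :: rho)] ++
  [seq (fun S rho => bit (nth 0 (genv S (nth 0 rho 2) (nth 0 rho 3)) j) (nth 0 rho 0)) | j <- iota 0 15].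

(** One round of evaluation in terms of bits: the values at the nodes are too long to be elements of
    the small structure, so the oracle gives the bits of the previous round and [gate] those of the
    next. *)
Definition gate : pred_t := fun S rho => (nth 0 rho 0 < sN S) &&
  nth false [seq (P : pred_t) S rho | P <- glist] (gtag S (nth 0 rho 3) (nth 0 rho 1)).

Lemma allUDef_cat a Ps Qs : allUDef a Ps -> allUDef a Qs -> allUDef a (Ps ++ Qs).
Proof. by elim: Ps => //= P Ps IH [h1 h2] h3; split; [|apply: IH]. Qed.

Lemma UDefF_genv j : j < 15 -> UDefF 4 (fun S rho => nth 0 (genv S (nth 0 rho 2) (nth 0 rho 3)) j).
Proof.
move=> lt; case: j lt => [_|j]; first by apply: UDefF_ext (UDefF_var 4 2) => S ok rho _ _.
rewrite ltnS => lt; case: (ltnP j 12) => [l|ge].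
  by apply: UDefF_ext (UDefF_cs 4 l) => S [_ s12 _ _ _] rho _ _; rewrite /genv /= nth_cat s12 l.
have : (j == 12) || (j == 13) by lia.
case/orP=> /eqP->; [apply: UDefF_ext (UDefF_var 4 2)|apply: UDefF_ext (UDefF_var 4 3)];
  by move=> S [_ s12 _ _ _] rho _ _; rewrite /genv /= nth_cat s12.
Qed.

Lemma UDef_self P : UDef 5 P -> UDef 4 (fun S rho => P S (nth 0 rho 0 :: rho)).
Proof. by move=> h; apply: (@UDef_let 4 (fun S rho => nth 0 rho 0)) => //; apply: UDefF_var. Qed.

Lemma UDef_glist : allUDef 4 glist.
Proof.
have l : 4 <= 38 by []. have l30 : 4 <= 30 by [].
have h1 := UDef_self UDef_arg1; have h2 := UDef_self UDef_arg2.
have v0 : UDefF 4 gk by apply: UDefF_var.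
have hl := UDef_eq l30 (SF_U SF_glt) (@UDefF_nat 4 1 isT).
have hif P Q : UDef 4 P -> UDef 4 Q -> UDef 4 (fun S rho => if glt S rho == 1 then P S rho else Q S rho).
  move=> hP hQ; have := UDef_or l (UDef_and l hl hP) (UDef_and l (UDef_not l hl) hQ).
  by apply: UDef_ext => S _ rho _ _; case: (_ == _) => //=; rewrite orbF.
apply: allUDef_cat.
  split; first exact: UDef_const.
  split; first exact: (UDef_eq l30 v0 (@UDefF_nat 4 0 isT)).
  split; first exact: UDef_const.
  split; first exact: (UDef_eq l30 v0 (SF_U (SF_D 4))).
  split; first exact: (UDef_not l h1).
  split; first exact: UDef_gpow.
  split.
    have hc := UDef_eq l30 (UDefF_mod l30 (SF_U SF_gcarry) (@UDefF_nat 4 2 isT)) (@UDefF_nat 4 1 isT).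
    have hx P Q : UDef 4 P -> UDef 4 Q -> UDef 4 (fun S rho => P S rho (+) Q S rho).
      move=> hP hQ; have := UDef_or l (UDef_and l hP (UDef_not l hQ)) (UDef_and l (UDef_not l hP) hQ).
      by apply: UDef_ext => S _ rho _ _; case: (P _ _); case: (Q _ _).
    apply: UDef_ext (hx _ _ (hx _ _ hc h1) h2) => S _ rho _ _.
    by rewrite !oddD !oddb modn2 eqb1.
  split; first by apply: UDef_qbit => //; [exact: UDef_arg1|exact: UDef_arg2|exact: UDef_argone].
  split.
    apply: (UDef_and l).
      have hN := UDef_lt (isT : 5 <= 30) (UDefF_var 5 0) (SF_U (SF_N 5)).
      exact: (@UDef_ex 4 _ isT (UDef_and (isT : 5 <= 38) hN UDef_arg2)).
    by apply: UDef_qbit => //; [exact: UDef_arg1|exact: UDef_argone|exact: UDef_arg2].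
  split; first exact: hif.
  split; first exact: hif.
  by split; first exact: (UDef_and l h1 h2).
have: forall j, j \in iota 0 15 -> j < 15 by move=> j; rewrite mem_iota.
elim: (iota 0 15) => //= j s IH h; split; last by apply: IH => i hi; apply: h; rewrite inE hi orbT.
by apply: (UDef_bit l30 (UDefF_genv _) v0); apply: h; rewrite inE eqxx.
Qed.

Theorem UDef_gate : UDef 4 gate.
Proof.
have l : 4 <= 38 by []. have l30 : 4 <= 30 by [].
apply: (UDef_and l); first exact: (UDef_lt l30 (UDefF_var 4 0) (SF_U (SF_N 4))).
apply: (UDef_nth l30 UDef_glist).
have h6 := UDefF_mul l30 (@UDefF_nat 4 6 isT) (UDefF_var 4 1).
exact: (UDefF_mod l30 (UDefF_div l30 (UDefF_var 4 3) (UDefF_pow l30 h6 h6)) (@UDefF_nat 4 64 isT)).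
Qed.

(** * Correctness of the evaluation step *)

Lemma bit_exp2 n i : bit (2 ^ n) i = (i == n).
Proof.
rewrite -[2 ^ n]mul1n bit_mulX; case: (ltngtP n i) => [lt|//|->] /=; last by rewrite subnn.
by rewrite (@bit_out 1 1) // subn_gt0.
Qed.

Lemma bit_add x y i :
  bit (x + y) i = odd (iteri i (fun j s => (s + bit x j + bit y j) %/ 2) 0 + bit x i + bit y i).
Proof.
pose z := fun j : 'I_2 => if val j == 0 then x else y.
have E n : iteri n (fun j s => (s + bit x j + bit y j) %/ 2) 0 = (x %% 2 ^ n + y %% 2 ^ n) %/ 2 ^ n.
  have := @carry_sum 2 0 z n; rewrite !big_ord_recl big_ord0 /= !addn0 add0n => <-.
  by apply: iteri_ext => j _ s; rewrite !big_ord_recl big_ord0 /= !addn0 addnA.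
rewrite E /bit {1}(divn_eq x (2 ^ i)) {1}(divn_eq y (2 ^ i)) addnACA -mulnDl divnMDl ?expn_gt0 //.
by rewrite !oddD !oddb addbC addbA.
Qed.

Lemma iteri_lt x y n :
  iteri n (fun j s => if bit x j == bit y j then minn s 1 else bit y j) 0 = (x %% 2 ^ n < y %% 2 ^ n).
Proof.
elim: n => [|n IH]; first by rewrite !modn1.
rewrite /= {}IH !mod_exp_bit.
have hx : x %% 2 ^ n < 2 ^ n by rewrite ltn_mod expn_gt0.
have hy : y %% 2 ^ n < 2 ^ n by rewrite ltn_mod expn_gt0.
move: (x %% 2 ^ n) (y %% 2 ^ n) hx hy => a c; move: (2 ^ n) => P hx hy.
by case: (bit x n); case: (bit y n) => /=; rewrite ?mul1n ?mul0n ?addn0 ?ltn_add2r //;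
  try (case: (a < c) => //); lia.
Qed.

Section GateCorrect.
Variables (S : setting) (h i m k g : nat).
Hypotheses (ok : okS S) (iU : i < sU S) (mU : m < sU S) (kU : k < sU S) (gU : g < sU S).
Hypothesis orcE : forall i m, i < sU S -> m < sU S -> sO S [:: i; m; k; g] = bit (gval S h m k g) i.
Hypothesis iN : i < sN S.
Let rho := [:: i; m; k; g].
Let x := gval S h ((2 * m) %% sU S) k g.
Let y := gval S h (((2 * m) %% sU S + 1) %% sU S) k g.
Let b := okS_big ok.
Let N := sN S.
Let NE : 2 ^ sD S = N. Proof. by rewrite /N (bND b). Qed.
Let xN : x < 2 ^ N. Proof. by rewrite -NE; apply: gval_lt. Qed.
Let yN : y < 2 ^ N. Proof. by rewrite -NE; apply: gval_lt. Qed.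
Let U0 : 0 < sU S. Proof. exact: sU_gt0. Qed.
Let NU : N < sU S.
Proof.
have := bSm b; have := bTsm b; rewrite (bT b) -/N; have : 0 < sSm S by rewrite expn_gt0.
by nia.
Qed.
Let a1 j : j < sU S -> arg1 S (j :: rho) = bit x j.
Proof. by move=> lt; rewrite /arg1 /= orcE // ltn_mod. Qed.
Let a2 j : j < sU S -> arg2 S (j :: rho) = bit y j.
Proof. by move=> lt; rewrite /arg2 /= orcE // ltn_mod. Qed.
Let jU j : j < N -> j < sU S. Proof. by move=> lt; apply: ltn_trans NU. Qed.

Lemma gpowE : gpow S rho = bit (minn (2 ^ x) (2 ^ N - 1)) i.
Proof.
have N0 : 0 < 2 ^ N by rewrite expn_gt0.
rewrite /gpow; case: (ltnP x N) => [lt|ge].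
  have : 2 ^ x < 2 ^ N by rewrite ltn_exp2l.
  move=> h2; rewrite (minn_idPl _) ?bit_exp2; last by lia.
  rewrite [X in _ || X](_ : _ = false) ?orbF; last first.
    apply/existsP => -[j /andP[/andP[h3 h4]]]; rewrite a1 //= (@bit_out x (sD S)) //.
    by rewrite NE.
  apply/forallP/eqP => [H|e j]; last by apply/implyP => lj; rewrite (a1 (ltn_ord j)) /= e.
  apply: bit_ext => j; case: (ltnP j N) => [lj|gej].
    by have /implyP/(_ lj)/eqP := H (Ordinal (jU lj)); rewrite a1 ?jU.
  rewrite (bit_out xN gej) (@bit_out _ N) //; apply: ltn_trans iN _; exact: ltn_expl.
have -> : minn (2 ^ x) (2 ^ N - 1) = 2 ^ N - 1.
  by apply/minn_idPr; have : 2 ^ N <= 2 ^ x by [rewrite leq_exp2l]; lia.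
rewrite bit_mask iN; apply/orP; right; apply/existsP.
case: (boolP [exists j : 'I_N, (sD S <= j) && bit x j]) => [/existsP[j /andP[h1 h2]]|/existsPn H].
  by exists (Ordinal (jU (ltn_ord j))); rewrite /= h1 ltn_ord a1 ?jU.
have : x = x %% 2 ^ sD S.
  apply: bit_ext => j; rewrite bit_mod; case: (ltnP j (sD S)) => //= h1.
  case: (ltnP j N) => [lj|gej]; last exact: bit_out gej.
  by have := H (Ordinal lj); rewrite /= h1 /= => /negbTE.
by move=> e; have := ltn_pmod x (expn_gt0 2 (sD S) : 0 < 2 ^ sD S); rewrite -e NE ltnNge ge.
Qed.

Lemma gcarryE : gcarry S rho = iteri i (fun j s => (s + bit x j + bit y j) %/ 2) 0.
Proof.
rewrite /gcarry /= (minn_idPl (ltnW iN)).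
have H n : n <= i -> iteri n (fun j s => (minn s 1 + arg1 S (j :: rho) + arg2 S (j :: rho)) %/ 2) 0 =
  iteri n (fun j s => (s + bit x j + bit y j) %/ 2) 0 /\
  iteri n (fun j s => (s + bit x j + bit y j) %/ 2) 0 <= 1.
  elim: n => [//|n IH] lt; have [h1 h2] := IH (ltnW lt).
  have nU : n < sU S by apply: ltn_trans lt iU.
  rewrite /= h1 (minn_idPl h2) a1 // a2 //; split=> //.
  by move: (iteri _ _ _) h2 => s; case: (bit x n); case: (bit y n) => /=; lia.
by case: (H i).
Qed.

Lemma gltE : (glt S rho == 1) = (x < y).
Proof.
rewrite /glt.
have -> : iteri (sN S) (fun j s => if arg1 S (j :: rho) == arg2 S (j :: rho) then minn s 1
    else arg2 S (j :: rho)) 0 = iteri N (fun j s => if bit x j == bit y j then minn s 1 else bit y j) 0.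
  by apply: iteri_ext => j lj s; rewrite a1 ?a2 ?jU.
by rewrite iteri_lt !modn_small ?eqb1.
Qed.

Lemma gateE : gate S rho = bit (gval S h.+1 m k g) i.
Proof.
rewrite /gate [nth 0 rho 0]/= [nth 0 rho 1]/= [nth 0 rho 3]/= iN andTb gvalS -/x -/y; set t := gtag _ _ _.
have a1i := a1 iU; have a2i := a2 iU.
have Y1 j : j < sN S -> argone S (j :: rho) = bit 1 j by move=> _; rewrite -(expn0 2) bit_exp2.
have one_lt : 1 < 2 ^ sN S by rewrite -(expn0 2) ltn_exp2l //; apply: leq_ltn_trans iN.
have e0 : bit (bop (sD S) Mul x y) i = qbit arg1 arg2 argone gk S rho.
  rewrite (@qbitE arg1 arg2 argone gk S rho x y 1 i ok xN yN one_lt) //.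
  - by rewrite divn1 /= bit_mod NE iN.
  - by move=> j lj; apply: a1; apply: jU.
  - by move=> j lj; apply: a2; apply: jU.
have e1 : bit (bop (sD S) Div x y) i = gY0 S rho && qbit arg1 argone arg2 gk S rho.
  have g0 : gY0 S rho = (0 < y).
    apply/existsP/idP => [[j /andP[h1]]|y0].
      by rewrite (a2 (ltn_ord j)); case: (posnP y) => // y0; rewrite y0 /bit div0n.
    case: (boolP [exists j : 'I_N, bit y j]) => [/existsP[j h2]|/existsPn H].
      by exists (Ordinal (jU (ltn_ord j))); rewrite /= ltn_ord a2 ?jU.
    suff e : y = 0 by rewrite e in y0.
    apply: bit_ext => j; rewrite {2}/bit div0n; case: (ltnP j N) => [lj|gej]; last exact: bit_out gej.
    by have := H (Ordinal lj) => /negbTE.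
  rewrite g0 /=; case: (posnP y) => [->|y0] /=; first by rewrite divn0 /bit div0n.
  rewrite (@qbitE arg1 argone arg2 gk S rho x 1 y i ok xN one_lt yN) ?muln1 //.
  - by move=> j lj; apply: a1; apply: jU.
  - by move=> j lj; apply: a2; apply: jU.
(* The two lists agree entry by entry, so selecting by the tag commutes with taking bit [i]. *)
have E : [seq (P : pred_t) S rho | P <- glist] =
    [seq bit z i | z <- gops (sD S) x y ++ genv S k g].
  rewrite /glist !map_cat; congr (_ ++ _); last first.
    have [_ s12 _ _ _] := ok.
    rewrite -map_comp -[genv S k g in RHS](mkseq_nth 0) /mkseq -map_comp.
    by rewrite (_ : size (genv S k g) = 15) //= size_cat s12.
  rewrite /gops [map _ _]/= [in RHS]/= -/(bop (sD S) Mul x y) -/(bop (sD S) Div x y).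
  rewrite a1i a2i gltE gpowE gcarryE -/N.
  have c0 : bit 0 i = false by rewrite /bit div0n.
  have c1 : bit 1 i = (i == 0) by rewrite -(expn0 2) bit_exp2.
  rewrite c0 c1 !bit_exp2 bit_mask NE iN bit_land -(neg_of_bits xN) bit_of_bits iN e0 e1.
  rewrite bit_mod iN bit_add /=.
  by case: (ltnP x y).
rewrite E; case: (ltnP t (size (gops (sD S) x y ++ genv S k g))) => lt.
  by rewrite (nth_map 0).
by rewrite !nth_default ?size_map // /bit div0n.
Qed.

End GateCorrect.

(** * Diagonalization *)

(** Unary nodes and leaves also have two children here, so every heap position carries a tag. *)
Definition chd (b : bool) t := match t with
  | U1 _ u => u
  | B2 _ u v => if b then v else u
  | _ => t end.

(* The subterm at the node [m] of the binary tree of [t], in heap numbering; [n] is fuel. *)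
Fixpoint node n t m := if n is n'.+1 then
  if m <= 1 then t else chd (odd m) (node n' t m./2) else t.

Lemma nodeS n t m : node n.+1 t m = if m <= 1 then t else chd (odd m) (node n t m./2).
Proof. by []. Qed.

Lemma node_fuel n t m : m <= n -> node n t m = node m t m.
Proof.
elim/ltn_ind: n m => -[|n] IH m; first by case: m.
case: m => [|m] //= le; case: ifP => // m1; congr chd.
rewrite !(IH _ _ (uphalf m)) //; rewrite ?uphalf_half; lia.
Qed.

Definition subtm t m := node m t m.

Lemma subtm_child (b : bool) t m : 0 < m -> subtm t (b + m.*2) = chd b (subtm t m).
Proof.
move=> m0; rewrite {1}/subtm; set n := b + m.*2.
have n2 : 1 < n by rewrite /n; lia.
have nh : n./2 = m by rewrite /n half_bit_double.
have no : odd n = b by rewrite /n oddD odd_double addbF oddb.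
have le : m <= n.-1 by rewrite /n; lia.
move: n n2 nh no le => n n2 nh no le; have nE : n = n.-1.+1 by lia.
by rewrite {1}nE nodeS leqNgt n2 nh no node_fuel.
Qed.

(** The environment has 15 entries; a variable beyond them has the value 0 and gets the tag of
    [Zero]. *)
Definition ttag t := match t with
  | V j => if j < 15 then 12 + j else 0
  | C Zero => 0 | C One => 1 | C MinusOne => 2 | C En => 3
  | U1 Neg _ => 4 | U1 Pow _ => 5
  | B2 Add _ _ => 6 | B2 Mul _ _ => 7 | B2 Div _ _ => 8
  | B2 Max _ _ => 9 | B2 Min _ _ => 10 | B2 Cap _ _ => 11 end.

Lemma ttag_lt t : ttag t < 64.
Proof. by case: t => [j|[]|[] ?|[] ? ?] //=; case: ifP => // lt; lia. Qed.

Definition tcode L t := num 64 L (fun m => ttag (subtm t m)).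

Lemma tcode_lt L t : tcode L t < 2 ^ (6 * L).
Proof. by rewrite expnM; apply: num_lt => m _; apply: ttag_lt. Qed.

Section Eval.
Variables (S : setting) (L k : nat) (t : tm).
Hypotheses (ok : okS S) (L_small : 6 * L <= 2 ^ sd S).
Let g := tcode L t.

Lemma gtagE m : m < L -> gtag S g m = ttag (subtm t m).
Proof.
move=> lt; have m6 : 6 * m < 2 ^ sd S by lia.
rewrite /gtag (modn_small (m := 6 * m)); last by apply: ltn_trans m6 (ltn_expl _ _).
have h : 2 ^ (6 * m) < sU S by rewrite ltn_exp2l.
rewrite (minn_idPl _); last by lia.
by rewrite expnM num_dig // => j _; apply: ttag_lt.
Qed.

(** The heap numbers of the descendants of [m] down to the depth of its subterm are below
    [(m + 1) 2^depth], so the last condition keeps all of them among the [L] coded positions. *)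
Lemma gval_ev h m : 0 < m -> tdepth (subtm t m) < h -> m.+1 * 2 ^ tdepth (subtm t m) <= L ->
  gval S h m k g = ev (sD S) (genv S k g) (subtm t m).
Proof.
elim: h m => // h IH m m0 dh mL.
have mL' : m < L by apply: leq_trans mL; rewrite leq_pmulr // expn_gt0.
have mU : 2 * m + 1 < sU S.
  have : 2 ^ sd S < sU S by apply: ltn_expl.
  by lia.
rewrite gvalS gtagE // (modn_small (m := 2 * m)); last by lia.
rewrite (modn_small mU).
have s0 := @subtm_child false t m m0; have s1 := @subtm_child true t m m0.
rewrite add0n -mul2n in s0; rewrite add1n -addn1 -mul2n in s1.
have [_ s12 _ _ _] := ok.
case E : (subtm t m) dh mL s0 s1 => [j|c|f u|f u v].
- move=> _ _ _ _; rewrite [ttag _]/= [ev _ _ _]/=; case: ltnP => lt.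
    by rewrite nth_cat [size _]/= ltnNge leq_addr [LHS]/= addKn.
  by rewrite [RHS]nth_default //= size_cat s12.
- by case: c {E}.
- move=> /= dh mL s0 s1; have hu : gval S h (2 * m) k g = ev (sD S) (genv S k g) u.
    rewrite -s0; apply: IH; rewrite ?s0 //; first by lia.
    by move: mL; rewrite expnS; lia.
  by case: f {E}; rewrite /= -hu.
- move=> /= dh mL s0 s1; have [du dv] : tdepth u < h /\ tdepth v < h by lia.
  have pw w : tdepth w <= maxn (tdepth u) (tdepth v) -> (2 * m + 1).+1 * 2 ^ tdepth w <= L.
    move=> le; apply: leq_trans mL; rewrite expnS mulnA.
    by apply: leq_mul; [lia|rewrite leq_exp2l].
  have hu : gval S h (2 * m) k g = ev (sD S) (genv S k g) u.
    rewrite -s0; apply: IH; rewrite ?s0 //; first by lia.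
    apply: leq_trans (pw u (leq_maxl _ _)); rewrite leq_mul2r; lia.
  have hv : gval S h (2 * m + 1) k g = ev (sD S) (genv S k g) v.
    rewrite -s1; apply: IH; rewrite ?s1 //; first by lia.
    exact: (pw v (leq_maxr _ _)).
  by case: f {E}; rewrite /= -hu -hv.
Qed.

End Eval.

Lemma gval_orc d cs O O' h m k g : gval (Setting d cs O) h m k g = gval (Setting d cs O') h m k g.
Proof. by elim: h m => // h IH m; rewrite !gvalS !IH. Qed.

(** A nonzero value at the root, which is node 1: the coded term rejects the pair of its own advice
    and code, since [decided] accepts by the value 0. *)
Definition diag : pred_t := fun S rho =>
  [exists i : 'I_(sU S), sO S [:: val i; 1; nth 0 rho 0; nth 0 rho 1]].

Lemma UDef_diag : UDef 2 diag.
Proof.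
have h := @UDef_comp [:: fun S r => nth 0 r 0; fun S r => 1; fun S r => nth 0 r 1; fun S r => nth 0 r 2]
  3 (fun S rho => sO S rho).
apply: (@UDef_ex 2 (fun S r => sO S [:: nth 0 r 0; 1; nth 0 r 1; nth 0 r 2])) => //.
apply: h => //=; last exact: UDef_orc.
by split; [exact: UDefF_var|split; [exact: UDefF_nat|split; [exact: UDefF_var|split; [exact: UDefF_var|]]]].
Qed.

Section Diagonal.
Variables (G : nat -> tm) (d nu t K : nat) (cs : seq nat).
Hypothesis d6 : 6 <= d.
Hypothesis nu_d : 3 * nu + 6 <= d.
Hypothesis nu6 : 6 <= nu.
Hypothesis size_cs : size cs = 12.
Hypothesis cs_lt : bounded (2 ^ 2 ^ d) cs.
Hypothesis cs0 : nth 0 cs 0 = 2 ^ nu.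
Hypothesis kbitsK : kbits nu K <= 2 ^ d.
Hypothesis depth_G : forall i, i < K -> tdepth (G (level d nu i.+1)) <= t.
Hypothesis G_spec : forall i y, i < K -> y < 2 ^ 2 ^ level d nu i.+1 ->
  ev (level d nu i.+1) [:: y] (G (level d nu i.+1)) = 0 <->
  exists2 x, x < 2 ^ 2 ^ level d nu i.+1 & ev (level d nu i.+1) [:: x; y] Funiv = 0.
Hypothesis n_big : forall i, i < K ->
  100 + 2 * level d nu i + 2 ^ (T0 t).+2 * loc_size (level d nu i) <= 2 ^ nu.
Hypothesis okC : forall O, okS (Setting d cs O).
Hypothesis cs4 : nth 0 cs 4 = level d nu K.
Hypothesis code_small : 6 * 2 ^ (T0 t).+1 <= 2 ^ d.
Variables phi psi : form.
Hypotheses (wphi : wf 4 phi) (wpsi : wf 2 psi) (dphi : adepth phi <= T0 t) (dpsi : adepth psi <= T0 t).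
Hypothesis phiE : forall S, okS S -> forall rho, size rho = 4 -> bounded (sU S) rho ->
  sem S phi rho = gate S rho.
Hypothesis psiE : forall S, okS S -> forall rho, size rho = 2 -> bounded (sU S) rho ->
  sem S psi rho = diag S rho.
Hypothesis KE : (T0 t).+1 * rk phi + rk psi = K.
Let dec := decided d nu t cs.
Let S0 := Setting d cs (fun=> false).
Let stage h rho := bit (gval S0 h (nth 0 rho 1) (nth 0 rho 2) (nth 0 rho 3)) (nth 0 rho 0).

(** The oracle of round [h + 1] is stage [h], already decided at its level, so each round adds
    [rk phi] levels. *)
Lemma stages h : h <= (T0 t).+1 -> dec (h * rk phi) 4 (stage h).
Proof.
elim: h => [|h IH] le.
  exists 0, (C One); split=> // rho _ _.
  by rewrite /stage /= /bit div0n.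
have hO := IH (ltnW le); set S := Setting d cs (stage h).
have hK : h * rk phi + rk phi <= K.
  by rewrite -KE addnC -mulSn; apply: leq_trans (leq_addr _ _); rewrite leq_mul2r le orbT.
have := collapse d6 nu_d nu6 size_cs cs_lt cs0 kbitsK depth_G G_spec n_big hO wphi isT dphi hK.
rewrite addnC -mulSn; apply: decided_ext => rho sr bd.
have ok := okC (stage h); rewrite phiE // /stage.
case: rho sr bd => [|i [|m [|k [|g []]]]] // _ /and5P[hi hm hk hg _].
case: (ltnP i (sN S)) => [lt|ge]; last first.
  have gl : gval S0 h.+1 m k g < 2 ^ sN S by rewrite (bND (okS_big ok)); exact: (gval_lt _ _ (okC _) hk hg).
  by rewrite /gate [nth 0 _ 0]/= ltnNge ge andFb; exact/esym/(bit_out gl ge).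
have oE i' m' : i' < sU S -> m' < sU S -> sO S [:: i'; m'; k; g] = bit (gval S h m' k g) i'.
  by move=> _ _; rewrite /= /stage (gval_orc _ _ (stage h) (fun=> false)).
have gE : gate S [:: i; m; k; g] = bit (gval S h.+1 m k g) i by apply: gateE.
by rewrite [LHS]gE (gval_orc _ _ (stage h) (fun=> false)).
Qed.

(** [diag] over the last stage is decided by some [tau] with advice [kap]. On [kap] and the code of
    [tau], [diag] says that [tau] does not vanish there, while [tau] decides [diag] by vanishing.
    The simulated exponent had to be fixed in advance as [level K]; [KE] makes the eliminations end
    exactly at this level. *)
Theorem diagonal_contradiction : False.
Proof.
have hO := stages (leqnn _); set H := (T0 t).+1 in hO.
have hK : H * rk phi + rk psi <= K by rewrite KE.
have := collapse d6 nu_d nu6 size_cs cs_lt cs0 kbitsK depth_G G_spec n_big hO wpsi isT dpsi hK.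
rewrite KE => -[kap [tau [kap_lt dtau tauE]]].
have ok0 : okS S0 by apply: okC.
pose g := tcode (2 ^ H) tau.
have kU : kap < sU S0 by apply: leq_trans kap_lt _; rewrite leq_exp2l.
have gU : g < sU S0 by apply: leq_trans (tcode_lt _ _) _; rewrite leq_exp2l.
have bd : bounded (sU S0) [:: kap; g] by rewrite /bounded /= kU gU.
have := tauE [:: kap; g] erefl bd.
rewrite (psiE (okC _)) //.
have e : gval S0 H 1 kap g = ev (level d nu K) (kap :: cs ++ [:: kap; g]) tau.
  have := @gval_ev S0 (2 ^ H) kap tau ok0 code_small H 1 isT.
  rewrite [sD S0]/= /sD /= cs4; apply; first by rewrite ltnS.
  by rewrite -expnS leq_exp2l.
have dE : diag (Setting d cs (stage H)) [:: kap; g] = (gval S0 H 1 kap g != 0).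
  apply/existsP/idP => [[i]|ne].
    by rewrite /= /stage /=; apply: contraL => /eqP->; rewrite /bit div0n.
  (* The quantifier in [diag] reaches every bit of the value, because there are [sN] of them and
     [sN] is below [sU]. *)
  case: (boolP [exists i : 'I_(2 ^ 2 ^ d), bit (gval S0 H 1 kap g) i]) => [/existsP[i hi]|/existsPn Hn].
    by exists i.
  case/eqP: ne; apply: bit_ext => i; rewrite [in RHS]/bit div0n.
  case: (ltnP i (2 ^ 2 ^ d)) => [lt|ge]; first by apply/negbTE/(Hn (Ordinal lt)).
  have b := okS_big ok0; apply: (@bit_out _ (sN S0)).
    by rewrite (bND b); apply: gval_lt.
  apply: leq_trans ge; apply: ltnW.
  have := bSm b; have := bTsm b; rewrite (bT b); have : 0 < sSm S0 by rewrite expn_gt0.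
  by rewrite /sU /=; nia.
by rewrite dE e; case: eqP.
Qed.

End Diagonal.

(** * Choice of the parameters *)

(** Entry 0 is the number of rows used by the eliminations; the other entries follow the order of
    the projections from [sfw] to [sg]. *)
Definition clist nu e v := let J := 2 ^ (e + v + 8) * 2 ^ (e + v + 5) in
  [:: 2 ^ nu; 2 ^ (15 * e - 1); 2 ^ e; 2 ^ (16 * e + v); 16 * e + v; 2 ^ (15 * e - 3);
      2 ^ (e + v + 5); 2 ^ (e + v + 8); J`!; 4 * 2 ^ (16 * e + v); J; 2 ^ (15 * e - 4)].

Lemma clist_bounded nu e v : 20 <= e -> v <= e -> nu < 2 ^ (16 * e) ->
  bounded (2 ^ 2 ^ (16 * e)) (clist nu e v).
Proof.
move=> e20 ve hnu; have lt2 a : a < 2 ^ (16 * e) -> 2 ^ a < 2 ^ 2 ^ (16 * e) by rewrite ltn_exp2l.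
have le20 : 20 <= 16 * e by clear -e20; lia.
have big : 80 * e <= 2 ^ (16 * e) by apply: leq_trans (exp2_ge5 le20); clear; lia.
have lt3 a : a < 80 * e -> 2 ^ a < 2 ^ 2 ^ (16 * e) by move=> h; apply/lt2/(leq_trans h).
have lt4 a : a < 80 * e -> a < 2 ^ 2 ^ (16 * e).
  by move=> h; apply: ltn_trans (lt3 _ h); apply: ltn_expl.
have JE : 2 ^ (e + v + 8) * 2 ^ (e + v + 5) = 2 ^ (2 * e + 2 * v + 13).
  by rewrite -expnD; congr (_ ^ _); clear; lia.
have F_lt : (2 ^ (2 * e + 2 * v + 13))`! < 2 ^ 2 ^ (16 * e).
  apply: leq_ltn_trans (fact_le_exp _) _; rewrite -expnM ltn_exp2l //.
  apply: leq_ltn_trans (_ : 2 ^ e * 2 ^ (5 * e) < _); last first.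
    by rewrite -expnD ltn_exp2l //; clear -e20; lia.
  apply: leq_mul; last by rewrite leq_exp2l //; clear -e20 ve; lia.
  by apply: leq_trans (exp2_ge5 e20); clear -e20 ve; lia.
have T_lt : 4 * 2 ^ (16 * e + v) < 2 ^ 2 ^ (16 * e).
  have -> : 4 * 2 ^ (16 * e + v) = 2 ^ (2 + (16 * e + v)) by rewrite (expnD 2 2).
  by apply: lt3; clear -e20 ve; lia.
rewrite /clist JE /bounded /= F_lt T_lt lt2 // !lt3 ?lt4 //; clear -e20 ve; lia.
Qed.

Lemma clist_ok nu e v O : 20 <= e -> v <= e -> nu < 2 ^ (16 * e) ->
  okS (Setting (16 * e) (clist nu e v) O).
Proof.
move=> e20 ve hnu; split.
- split; first by rewrite /=; clear -e20; lia.
  by exists e, v; split; [split|split; [split|split]].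
- by [].
- exact: clist_bounded.
- rewrite /srs /sfw /=.
  have -> : 16 * e = e + 1 + (15 * e - 1) by clear -e20; lia.
  rewrite expnD leq_mul2r expnD; apply/orP; right.
  by have := ltn_expl e (isT : 1 < 2); move: (2 ^ e) => A; lia.
- rewrite /srs /sfw /sU /=; apply/andP; split; first (apply/andP; split).
  + by rewrite expn_gt0.
  + by rewrite -{1}(expn0 2) ltn_exp2l //; clear -e20; lia.
  rewrite -expnM ltn_exp2l //; have le20 : 20 <= 16 * e by clear -e20; lia.
  by apply: leq_trans (exp2_ge5 le20); clear -e20; lia.
Qed.

Lemma kbitsE nu i : kbits nu i + (5 * lam nu + 3) = 2 ^ i * (5 * lam nu + 3).
Proof. by elim: i => [|i IH] /=; rewrite ?mul1n // expnS -mulnA -IH; lia. Qed.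

Lemma kbits_lt nu i : kbits nu i <= 2 ^ (i + 3 * nu + 8).
Proof.
apply: (@leq_trans (2 ^ i * (5 * lam nu + 3))); first by rewrite -kbitsE leq_addr.
rewrite -addnA expnD leq_mul2l /lam -!expnD; apply/orP; right.
have -> : 3 * nu + 8 = nu + nu + nu + 8 by lia.
rewrite (expnD _ (nu + nu + nu)) (_ : 2 ^ 8 = 256) //; have := expn_gt0 2 (nu + nu + nu).
by move: (2 ^ (nu + nu + nu)) => A; lia.
Qed.

(** Supplies the scale: the total rise of the level is quadratic in [x], whereas [d = 2^x]. *)
Lemma exp2_beats_square C X : exists2 x, X <= x & C * (x + 1) ^ 2 <= 2 ^ x.
Proof.
pose m := C + X + 20; exists (4 * m); first by rewrite /m; lia.
have m20 : 20 <= m by rewrite /m; lia.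
have h5 := exp2_ge5 m20; have hC : C <= 2 ^ m.
  by apply: leq_trans (ltnW (ltn_expl m (isT : 1 < 2))); rewrite /m; lia.
have -> : 4 * m = m + (m + m) + m by lia.
rewrite (expnD 2 (m + (m + m))) (expnD 2 m (m + m)) (expnD 2 m m).
apply: (@leq_trans (2 ^ m * (2 ^ m * 2 ^ m))); last by rewrite leq_pmulr // expn_gt0.
apply: leq_mul => //; rewrite expnS expn1.
have h : m + (m + m) + m + 1 <= 2 ^ m by apply: leq_trans h5; lia.
exact: leq_mul.
Qed.

(** All levels used lie between [d = 2^x] and [2^(x + 1)], where [G] has depth at most [x + 1]. Then
    [T0] and [nu] are linear in [x], hence so are the number [K] of eliminations and the cost of
    each, and their product [v] is at most [e = d / 16], as [params] demands. *)
Theorem no_shallow_decision (G : nat -> tm) N0 :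
  (forall D y, N0 <= D -> y < 2 ^ 2 ^ D ->
    ev D [:: y] (G D) = 0 <-> exists2 x, x < 2 ^ 2 ^ D & ev D [:: x; y] Funiv = 0) ->
  (forall D x, N0 <= D -> D <= 2 ^ x -> tdepth (G D) <= x) -> False.
Proof.
move=> G_spec depth_G; have [phi wphi phiE] := UDef_gate; have [psi wpsi psiE] := UDef_diag.
have [c0 c0E] : exists c, tdepth tpack = c by exists (tdepth tpack).
pose R := rk phi + rk psi + 1.
(* The three factors come from [d = 16 e], from the bound [(x + 1) (c0 + 2) R] for [K], and from the
   bound [(x + 1) (3 c0 + 48)] for [cost nu]. The lower bound on [x] also covers the threshold [N0]
   and the depth of the atoms in both formulas. *)
have [x hx hsq] := exp2_beats_square (16 * ((c0 + 2) * R) * (3 * c0 + 48)) (N0 + adepth phi + adepth psi + 20).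
(* [2^nu] rows must accommodate two terms of depth [T0 s], about [2^(T0 s + 2)] nodes with
   [loc_size] at most [2^(x + 6)] each; one more factor 2 covers the constants. *)
pose s := x + 1; pose nu := T0 s + x + 9; pose K := (T0 s).+1 * rk phi + rk psi.
pose e := 2 ^ (x - 4); pose v := K * cost nu.
have T0E : T0 s = x + 1 + c0 by rewrite /T0 c0E.
pose K' := (x + 1) * (c0 + 2) * R; pose c' := (x + 1) * (3 * c0 + 48).
have KK : K <= K'.
  rewrite /K T0E /K' /R; move: (rk phi) (rk psi) => r1 r2.
  have h : (x + 1 + c0).+1 <= (x + 1) * (c0 + 2) by clear; nia.
  move: ((x + 1) * (c0 + 2)) h => A h; rewrite !mulnDr muln1.
  apply: leq_trans (leq_addr _ _); apply: leq_add; first by rewrite leq_mul2r h orbT.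
  by rewrite leq_pmull //; clear -h; lia.
have cc : cost nu <= c' by rewrite /cost /nu T0E /c'; clear; nia.
have K0 : 0 < K' by rewrite /K' /R !muln_gt0 !addn1 addn2.
have c0' : 48 <= c' by rewrite /c'; clear; nia.
have Kc : 16 * (K' * c') <= 2 ^ x.
  by apply: leq_trans hsq; rewrite expnS expn1 /K' /c'; apply: eq_leq; clear; lia.
have dE : 2 ^ x = 16 * e by rewrite /e (_ : 16 = 2 ^ 4) // -expnD; congr (_ ^ _); lia.
have vK : v <= K' * c' by apply: leq_mul.
have ve : v <= e by clear - vK Kc dE; lia.
have e20 : 20 <= e.
  by apply: (@leq_trans (2 ^ 5)) => //; rewrite leq_exp2l //; clear -hx; lia.
have costE : cost nu = 3 * nu + 12 by [].
have Kcd : K + cost nu <= 2 ^ x.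
  apply: leq_trans Kc; apply: leq_trans (leq_add KK cc) _.
  by clear -K0 c0'; nia.
have Td : T0 s + 4 <= 2 ^ x by apply: leq_trans Kcd; rewrite costE /nu; clear; lia.
have nud : nu < 2 ^ (16 * e).
  by rewrite -dE; apply: leq_ltn_trans (ltn_expl (2 ^ x) (isT : 1 < 2)); clear -Kcd costE; lia.
have x20 : 20 <= x by clear -hx; lia.
have level_le i : i <= K -> level (2 ^ x) nu i <= 2 ^ x.+1.
  move=> le; rewrite /level expnS mul2n -addnn leq_add2l.
  apply: (@leq_trans v); first by rewrite leq_mul2r le orbT.
  by clear -ve dE; lia.
have ltx : N0 <= 2 ^ x by apply: leq_trans (ltnW (ltn_expl x (isT : 1 < 2))); clear -hx; lia.
have level_ge i : N0 <= level (2 ^ x) nu i by apply: leq_trans ltx _; apply: leq_addr.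
apply: (@diagonal_contradiction G (2 ^ x) nu s K (clist nu e v) _ _ _ _ _ _ _ _ _ _ _ _ _ phi psi) => //.
- by rewrite dE; clear -e20; lia.
- by clear -Kcd costE; lia.
- by rewrite /nu; clear; lia.
- by rewrite dE; apply: clist_bounded.
- apply: leq_trans (kbits_lt _ _) _; rewrite leq_exp2l //; clear -Kcd costE; lia.
- by move=> i iK; rewrite /s addn1; apply: depth_G => //; apply: level_le.
- by move=> i y iK hy; apply: G_spec.
- move=> i iK; have := level_le _ (ltnW iK); move: (level _ _ _) => l; rewrite expnS => hl.
  have x8 : 2 ^ 8 <= 2 ^ x by rewrite leq_exp2l //; clear -x20; lia.
  have h1 : loc_size l <= 2 ^ (x + 6).
    by rewrite /loc_size expnD; move: (2 ^ x) x8 hl => A; clear; lia.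
  have h2 : 100 + 2 * l <= 2 ^ (T0 s).+2 * 2 ^ (x + 6).
    apply: (@leq_trans (1 * 2 ^ (x + 6))); last by rewrite leq_mul2r expn_gt0 orbT.
    by rewrite mul1n expnD; move: (2 ^ x) x8 hl => A; clear; lia.
  have h3 : 2 ^ (T0 s).+2 * loc_size l <= 2 ^ (T0 s).+2 * 2 ^ (x + 6) by rewrite leq_mul2l h1 orbT.
  have -> : nu = ((T0 s).+2 + (x + 6)).+1 by rewrite /nu; clear; lia.
  rewrite (expnS 2 ((T0 s).+2 + (x + 6))) (expnD 2 (T0 s).+2).
  by move: (2 ^ (T0 s).+2 * 2 ^ (x + 6)) h2 h3 => A; clear; lia.
- by move=> O; rewrite dE; apply: clist_ok.
- by rewrite /= /level dE.
- apply: (@leq_trans (2 ^ 3 * 2 ^ (T0 s).+1)); first by rewrite leq_mul2r orbT.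
  by rewrite -expnD leq_exp2l //; clear -Td; lia.
- by rewrite T0E; clear -hx; lia.
- by rewrite T0E; clear -hx; lia.
Qed.

(** * Return to the interpretation in the statement and to real logarithms *)

Lemma solution_tm_of D (G : term 1) (F : term 2) :
  (forall y : universe D, eval [tuple y] G = const_interp D Zero <->
     exists x : universe D, eval [tuple x; y] F = const_interp D Zero) ->
  forall y, (y < 2 ^ 2 ^ D)%N -> ev D [:: y] (tm_of G) = 0%N <->
    exists2 x, (x < 2 ^ 2 ^ D)%N & ev D [:: x; y] (tm_of F) = 0%N.
Proof.
move=> h y hy; have {}h := h (Ordinal hy).
have e1 : val (eval [tuple Ordinal hy] G) = ev D [:: y] (tm_of G) by rewrite ev_tm_of.
have e2 x : val (eval [tuple x; Ordinal hy] F) = ev D [:: val x; y] (tm_of F) by rewrite ev_tm_of.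
split=> [h1|[x hx h1]].
  have /h[x hx] : eval [tuple Ordinal hy] G = const_interp D Zero by apply: val_inj; rewrite e1 h1.
  by exists (val x); rewrite ?ltn_ord // -e2 hx.
rewrite -e1; suff -> : eval [tuple Ordinal hy] G = const_interp D Zero by [].
by apply/h; exists (Ordinal hx); apply: val_inj; rewrite e2 h1.
Qed.

Import Order.TTheory GRing.Theory Num.Theory.
Local Open Scope ring_scope.

Lemma ln2_gt0 (R : realType) : 0 < ln (2 : R).
Proof. by rewrite ln_gt0 // ltr1n. Qed.

Lemma log2_exp2 (R : realType) n : log2 ((2 ^ n)%N%:R : R) = n%:R.
Proof.
rewrite /log2 natrX lnXn // -[ln _ *+ n]mulr_natl mulfK //.
by rewrite lt0r_neq0 // ln2_gt0.
Qed.

Lemma log2_le (R : realType) (m n : nat) : (0 < m)%N -> (m <= n)%N -> log2 (m%:R : R) <= log2 n%:R.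
Proof.
move=> m0 le; rewrite /log2 ler_pM2r ?invr_gt0 ?ln2_gt0 // ler_ln ?posrE ?ltr0n ?ler_nat //.
exact: leq_trans le.
Qed.

(** The witness is [eps = 1]. If the bound failed for all large [d], the depth of [G D] would stay
    below the square root of [log2 D], hence be at most [x] whenever [D <= 2^x], which
    [no_shallow_decision] refutes. The second equation is [log2 n = d]. *)
Theorem theorem3 (R : realType) :
  exists (eps : R) (F : term 2), 0 < eps /\
    forall G : nat -> term 1, decides_solvability G F ->
      forall N : nat, exists d : nat, (N <= d)%N /\
        let n := (2 ^ d)%N in
        eps * Num.sqrt (log2 (d%:R : R)) <= (depth (G d))%:R /\
        eps * Num.sqrt (log2 (d%:R : R)) =
          eps * Num.sqrt (log2 (log2 (n%:R : R))).
Proof.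
exists 1, (term_of 1 Funiv); split=> // G [d0 hG] N.
apply: boolp.contrapT => hN.
have small D : (N <= D)%N -> (depth (G D))%:R < Num.sqrt (log2 (D%:R : R)).
  move=> le; rewrite ltNge; apply/negP => h; apply: hN; exists D; split=> //.
  by rewrite /= log2_exp2 mul1r.
apply: (@no_shallow_decision (fun D => tm_of (G D)) (N + d0 + 1)) => [D y hD|D x hD le].
  have hF : tm_of (term_of 1 Funiv) = Funiv by apply: tm_of_term_of.
  rewrite -hF; apply: solution_tm_of; apply: hG.
  by apply: leq_trans hD; rewrite addn1 leqW // leq_addl.
rewrite tdepth_tm_of -(ler_nat R); apply: ltW; apply: lt_le_trans (small _ _) _.
  by apply: leq_trans hD; rewrite -addnA leq_addr.
have D0 : (0 < D)%N by apply: leq_trans hD; rewrite addn1.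
have := log2_le R D0 le; rewrite log2_exp2 => hl.
(* From [log2 D <= x <= x^2] the square root is at most [x]. *)
apply: (@le_trans _ _ (Num.sqrt (x%:R ^+ 2))); last by rewrite sqrtr_sqr ger0_norm // ler0n.
rewrite ler_wsqrtr //; apply: le_trans hl _; rewrite -natrX ler_nat expnS expn1.
by case: x {le} => // x; rewrite leq_pmull.
Qed.
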